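(* Let $u_0,f$ satisfy the standing assumptions below, and let $T^-,x^-(t),T^+,x^+(t)$ be as described in the context. Then for each $t>\max\{T^-,T^+\}$, the minimizer of the minimization problem $$\underset{\psi\ge0,\ \psi\in L^1(0,1)}{\mathrm{Minimize}}\left\{-\frac{1}{2\pi}\int_0^1\!\!\int_0^1\log\left|\frac{\eta-\mu}{\eta+\mu}\right|\psi(\eta)\psi(\mu)\,d\eta\,d\mu+\int_0^1a(\eta,x,t)\psi(\eta)\,d\eta\right\}$$ is supported on a single interval when $x\le x^-(t)$ and when $x\ge x^+(t)$.
   Context: Standing assumptions: $u_0:\mathbb{R}\to(0,1)$ is a smooth strictly decreasing function with $u_0(-\infty)=1$, $u_0(+\infty)=0$; $f:(0,1)\to\mathbb{R}$ is its inverse (smooth, $f'<0$, $f(0^+)=+\infty$, $f(1^-)=-\infty$); and $f'''(u)<0$ for $u$ in a neighborhood of $0$ and of $1$. Here $a(\eta,x,t)=\eta x-16\eta^5t-\theta(\eta)$ with $\theta(\eta)=\eta f(\eta^2)+\int_{f(\eta^2)}^{+\infty}[\eta-\sqrt{\eta^2-u_0(y)}]\,dy$. For $t>0$, $\xi,v\in(0,1)$ let $\Phi_0(\xi,v)=\frac{1}{2\sqrt2}\int_{-1}^{1}H'(\frac{1+\mu}{2}\xi+\frac{1-\mu}{2}v)(1-\mu)^{-1/2}d\mu$ with $H'(u)=-60tu-f'(u)$, and $F_0(\xi,v)$ the same expression with $H'$ replaced by $f'$. Let $\delta>0$ be such that $\partial_\xi^2F_0(\xi,u_1)<0$ for $0<\xi<1$,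 $1-\delta<u_1<1$, and $\delta_2>0$ such that $f''>0$ on $(0,\delta_2)$. $T^->0$ is a constant such that for each $t>T^-$ the (trailing edge) system $\Phi_0(u_3,u_1)=0$, $\partial_\xi\Phi_0(\xi,u_1)|_{\xi=u_3}=0$, $x-30tu_1^2-f(u_1)=0$ has a unique solution $(u_1^-(t),u_3^-(t),x^-(t))$, with $u_1^-$ increasing, $u_1^-(t)\to1$, $u_3^-(t)\to1/4$ as $t\to\infty$. $T^+>0$ is a constant such that for each $t>T^+$ the (leading edge) system $\Phi_0(u_1,u_3)=0$, $\int_{u_3}^{u_1}\Phi_0(\xi,u_3)\sqrt{\xi-u_3}\,d\xi=0$, $x-30tu_3^2-f(u_3)=0$ has a unique solution $(u_1^+(t),u_3^+(t),x^+(t))$, with $u_1^+$ increasing, $u_3^+$ decreasing, $u_1^+(t)\to1$, $u_3^+(t)\to0$, and $1-\delta<u_1^+(t)<1$, $0<u_3^+(t)<\delta_2$ for $t>T^+$. *)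

(* Defs.v *)
From HB Require Import structures.
From mathcomp Require Import all_boot all_order all_algebra.
From mathcomp Require Import all_classical all_reals all_analysis.
Set Implicit Arguments. Unset Strict Implicit. Unset Printing Implicit Defensive.
Import Order.TTheory GRing.Theory Num.Theory.
Import numFieldNormedType.Exports.
Local Open Scope classical_set_scope.
Local Open Scope ring_scope.

Section KdVGas.
Variable R : realType.
Local Notation mu := (@lebesgue_measure R).

Definition I01 : set R := `]0, 1[.
Definition Icc (c d : R) : set R := `[c, d].
Definition Ioo (c d : R) : set R := `]c, d[.

Definition smooth (g : R -> R) : Prop :=
  forall (n : nat) (x : R), derivable (derive1n n g) x 1.

Definition smooth_on (D : set R) (g : R -> R) : Prop :=
  forall (n : nat) (x : R), D x -> derivable (derive1n n g) x 1.

Definition theta (u0 f : R -> R) (eta : R) : R :=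
  eta * f (eta ^+ 2) +
  Rintegral mu `[f (eta ^+ 2), +oo[ (fun y => eta - Num.sqrt (eta ^+ 2 - u0 y)).

Definition a_fun (u0 f : R -> R) (eta x t : R) : R :=
  eta * x - 16 * eta ^+ 5 * t - theta u0 f eta.

Definition avg_op (G : R -> R) (xi v : R) : R :=
  (2 * Num.sqrt 2)^-1 *
  Rintegral mu `[-1, 1]
    (fun m => G ((1 + m) / 2 * xi + (1 - m) / 2 * v) * (Num.sqrt (1 - m))^-1).

Definition Hprime (f : R -> R) (t u : R) : R := - (60 * t * u) - derive1 f u.

Definition Phi0 (f : R -> R) (t xi v : R) : R := avg_op (Hprime f t) xi v.
Definition F0 (f : R -> R) (xi v : R) : R := avg_op (derive1 f) xi v.

Definition trailing_sys (f : R -> R) (t u1 u3 x : R) : Prop :=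
  [/\ Phi0 f t u3 u1 = 0,
      derive1 (fun xi => Phi0 f t xi u1) u3 = 0 &
      x - 30 * t * u1 ^+ 2 - f u1 = 0].

Definition leading_sys (f : R -> R) (t u1 u3 x : R) : Prop :=
  [/\ Phi0 f t u1 u3 = 0,
      Rintegral mu `[u3, u1] (fun xi => Phi0 f t xi u3 * Num.sqrt (xi - u3)) = 0 &
      x - 30 * t * u3 ^+ 2 - f u3 = 0].

(* quadratic (logarithmic) energy, as an extended real (the integrand is >= 0
   a.e. for psi >= 0 a.e.) *)
Definition quad_energy (psi : R -> R) : \bar R :=
  (\int[mu]_(eta in I01)
     \int[mu]_(m in I01)
       ((- (2 * pi)^-1 * ln (`|eta - m| / `|eta + m|)) * psi eta * psi m)%:E)%E.

Definition lin_energy (u0 f : R -> R) (x t : R) (psi : R -> R) : \bar R :=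
  (\int[mu]_(eta in I01) (a_fun u0 f eta x t * psi eta)%:E)%E.

Definition energy (u0 f : R -> R) (x t : R) (psi : R -> R) : \bar R :=
  (quad_energy psi + lin_energy u0 f x t psi)%E.

(* admissible competitors: psi in L^1(0,1), psi >= 0 a.e. on (0,1), and the
   linear term finite (so that the energy is well defined in (-oo,+oo]) *)
Definition admissible (u0 f : R -> R) (x t : R) (psi : R -> R) : Prop :=
  measurable_fun I01 psi /\
  mu.-integrable I01 (EFin \o psi) /\
  ({ae mu, forall eta, I01 eta -> 0 <= psi eta}) /\
  mu.-integrable I01 (fun eta => (a_fun u0 f eta x t * psi eta)%:E).

Definition is_minimizer (u0 f : R -> R) (x t : R) (psi : R -> R) : Prop :=
  admissible u0 f x t psi /\
  forall phi, admissible u0 f x t phi ->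
    (energy u0 f x t psi <= energy u0 f x t phi)%E.

(* the (essential) support of psi, as an element of L^1(0,1), is a single
   nondegenerate interval [alpha, beta] included in [0,1] *)
Definition supported_on_single_interval (psi : R -> R) : Prop :=
  exists alpha beta : R,
    0 <= alpha /\ alpha < beta /\ beta <= 1 /\
    ({ae mu, forall eta, I01 eta -> ~ Icc alpha beta eta -> psi eta = 0}) /\
    (forall c d : R, alpha <= c -> c < d -> d <= beta ->
       ~ ({ae mu, forall eta, Ioo c d eta -> psi eta = 0})).

End KdVGas.

(* Main.v *)
Require Import Defs.
From HB Require Import structures.
From mathcomp Require Import all_boot all_order all_algebra.
From mathcomp Require Import all_classical all_reals all_analysis.
From mathcomp Require Import measurable_realfun ring lra.
Set Implicit Arguments. Unset Strict Implicit. Unset Printing Implicit Defensive.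
Import Order.TTheory GRing.Theory Num.Theory.
Import numFieldNormedType.Exports.
Local Open Scope classical_set_scope.
Local Open Scope ring_scope.

(** Write [A psi (c)] for the Abel transform, the integral of [psi(eta) (eta^2 - c)^{-1/2}] over
    [eta^2 > c], and [H(c) = x - 30 t c^2 - f(c)].  The logarithmic kernel is the product of the
    Abel kernel with its transpose, and [2 a(eta)] is the integral over [(0, eta^2)] of
    [H(c) (eta^2 - c)^{-1/2}]; hence the energy of [psi] is [(2 pi)^{-1}] times the integral over
    [(0, 1)] of [(A psi)^2 + pi H A psi].

    Suppose that [H(u) = 0].  The density [2 eta sqrt(u - eta^2) Phi0(eta^2, u)] on [(0, sqrt u)]
    has Abel transform [- (pi / 2) H] on [(0, u)] and [0] beyond.  If it is nonnegative and no mass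
    beyond [sqrt u] lowers the energy, then completing the square shows that every minimizer has
    the same transform, hence the same tails by Abel inversion.  (The density is first cut off near
    [0]; if [sqrt(c) f(c)] is unbounded near [0] the energy is unbounded below and there is no
    minimizer at all.)

    Such a [u] is found in [[u1m t, 1)] when [x <= xm t] and in [(0, u3p t]] when [xp t <= x].  The
    sign conditions hold for [u] close to [1], respectively to [0], because [f] is steep there, and
    the first [u] at which they fail would be a second solution of the trailing, respectively
    leading, edge system. *)

(** The uniqueness hypotheses speak of solutions with [u3 < u1] only, so a first failure of the
    trailing edge sign condition on the diagonal [xi = u] is not a second solution. It is a double
    zero of [Hprime], excluded by letting the time vary: it would persist on a whole time interval
    and move there at infinite speed. At the leading edge [f'' > 0] near 0 makes [Hprime]
    decreasing, which keeps the first failure off the diagonal.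

    The cut-off near 0 keeps all integrals of the candidate density finite. It is removed only at
    the end, where the error is the integral of [|H A psi|] over [(0, e)] for the given minimizer
    [psi], small by absolute continuity. So every minimizer is determined, although the density
    without cut-off is never itself shown to be admissible.

    The kernel identities are exchanges of integrals of nonnegative functions. Signed functions such
    as [Hprime] and [H] are first made nonnegative by adding a constant, or a multiple of
    [c^(-1/2)], whose contribution is known and subtracted afterwards. *)

Section calculus.
Context {R : realType}.
Local Notation mu := (@lebesgue_measure R).
Implicit Types (a b x y : R) (f F : R -> R).

Lemma itvoo_bigcup_cc a b : a < b ->
  `]a, b[%classic = \bigcup_n `[a + (b - a) / n.+2%:R, b - (b - a) / n.+2%:R]%classic.
Proof.
move=> ab; apply/seteqP; split => x /=; last first.
  move=> [n _] /=; rewrite !in_itv/= => /andP[h1 h2].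
  have : 0 < (b - a) / n.+2%:R by rewrite divr_gt0// subr_gt0.
  by move: ((b - a) / _) h1 h2 => e h1 h2 h; apply/andP; split; lra.
rewrite in_itv/= => /andP[ax xb].
have m0 : 0 < Num.min (x - a) (b - x) by rewrite lt_min; apply/andP; split; lra.
set m := Num.min _ _ in m0.
exists (Num.truncn ((b - a) / m)) => //=.
have h : (b - a) / (Num.truncn ((b - a) / m)).+2%:R <= m.
  rewrite ler_pdivrMr// mulrC -ler_pdivrMr//.
  have /ltW/le_trans := Num.Theory.truncnS_gt ((b - a) / m); apply.
  by rewrite ler_nat.
have h1 : m <= x - a by rewrite ge_min lexx.
have h2 : m <= b - x by rewrite ge_min lexx orbT.
by rewrite in_itv/=; move: (_ / _) h => e h; apply/andP; split; lra.
Qed.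

(** Monotone convergence over the compact subintervals of [itvoo_bigcup_cc]. Only [F] is continuous
    up to the end points; [f] may blow up there, as the Abel kernels do. *)
Lemma ge0_FTC2_oo f F a b : a < b ->
  {in `]a, b[, continuous f} -> {in `]a, b[, forall x, 0 <= f x} ->
  {within `[a, b], continuous F} ->
  (forall x, x \in `]a, b[ -> is_derive x 1 F (f x)) ->
  (\int[mu]_(x in `]a, b[) (f x)%:E = (F b - F a)%:E)%E.
Proof.
move=> ab cf f0 cF dF.
have e0 n : 0 < (b - a) / n.+2%:R by rewrite divr_gt0// subr_gt0.
have e2 n : (b - a) / n.+2%:R <= (b - a) / 2.
    by rewrite ler_pM2l ?subr_gt0// lef_pV2 ?posrE// ler_nat.
pose E n := `[a + (b - a) / n.+2%:R, b - (b - a) / n.+2%:R]%classic.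
have En n x : E n x -> x \in `]a, b[.
  rewrite /E /= !in_itv/= => /andP[h1 h2]; have := e0 n.
  by move: ((b - a) / _) h1 h2 => e h1 h2 h; apply/andP; split; lra.
have EF n : (\int[mu]_(x in E n) (f x)%:E =
   (F (b - (b - a) / n.+2%:R) - F (a + (b - a) / n.+2%:R))%:E)%E.
  (* For [n = 0] the subinterval is a single point, a case apart for the closed-interval theorem. *)
  have := e2 n; have := e0 n; have := @En n; rewrite /E; move: ((b - a) / n.+2%:R) => e Ene e0'; rewrite le_eqVlt => /predU1P[h|h].
    rewrite h (_ : b - (b - a) / 2 = a + (b - a) / 2); last by lra.
    by rewrite set_itv1 integral_set1 subrr.
  have cf' : {within `[a + e, b - e], continuous f}.
    apply: continuous_in_subspaceT => x; rewrite inE => /Ene; exact: cf.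
  apply: continuous_FTC2 => //; first by lra.
  - split.
    + move=> x xab; apply: (@ex_derive _ _ _ _ _ _ _ (dF x _)).
      by apply: Ene; exact: subset_itv_oo_cc.
    + apply: cvg_at_right_filter.
      apply: differentiable_continuous; apply/derivable1_diffP.
      apply: (@ex_derive _ _ _ _ _ _ _ (dF _ _)).
      by apply: Ene; rewrite /= in_itv/= lexx/=; lra.
    + apply: cvg_at_left_filter.
      apply: differentiable_continuous; apply/derivable1_diffP.
      apply: (@ex_derive _ _ _ _ _ _ _ (dF _ _)).
      by apply: Ene; rewrite /= in_itv/= lexx/= andbT; lra.
  - move=> x xab; rewrite derive1E; apply: (@derive_val _ _ _ _ _ _ _ (dF x _)).
    by apply: Ene; exact: subset_itv_oo_cc.
have mf : measurable_fun `]a, b[ (EFin \o f).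
  apply/measurable_EFinP; apply: open_continuous_measurable_fun => //.
  by move=> x; rewrite inE; exact: cf.
have h1 : (\int[mu]_(x in E n) (f x)%:E @[n --> \oo] -->
           \int[mu]_(x in `]a, b[) (f x)%:E)%E.
  rewrite itvoo_bigcup_cc//; apply: ge0_nondecreasing_set_cvg_integral.
  - move=> m n mn; apply/subsetPset => x; rewrite /E/= !in_itv/= => /andP[h1 h2].
    have h : (b - a) / n.+2%:R <= (b - a) / m.+2%:R.
      by rewrite ler_pM2l ?subr_gt0// lef_pV2 ?posrE// ler_nat !ltnS.
    by apply/andP; split; [apply: le_trans h1|apply: (le_trans h2)]; rewrite ?lerD2l ?lerN2.
  - by move=> i; exact: measurable_itv.
  - move=> i; apply: measurable_funS mf => //; exact: En.
  - by move=> i x /En /f0; rewrite lee_fin.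
have [_ Fa Fb] := (continuous_within_itvP F ab).1 cF.
have le : (b - a) / n.+2%:R @[n --> \oo] --> (0 : R).
  rewrite -(mulr0 (b - a)); apply: cvgM; first exact: cvg_cst.
  apply/(@gtr0_cvgV0 R); first by near=> n.
  apply: (@cvg_comp _ _ _ (fun n => n.+2) (fun n => n%:R) _ \oo).
    by have := @cvg_addnr 2; under eq_fun do rewrite addn2.
  exact: cvgr_idn.
have h2 : (F (b - (b - a) / n.+2%:R) @[n --> \oo] --> F b).
  apply: ((cvg_at_leftP _ _ _).1 Fb (fun n => b - (b - a) / n.+2%:R)).
  by split => [n|]; [by rewrite ltrBlDr ltrDl|rewrite -[X in _ --> X]subr0; exact: (cvgB (cvg_cst _) le)].
have h3 : (F (a + (b - a) / n.+2%:R) @[n --> \oo] --> F a).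
  apply: ((cvg_at_rightP _ _ _).1 Fa (fun n => a + (b - a) / n.+2%:R)).
  by split => [n|]; [by rewrite ltrDl|rewrite -[X in _ --> X]addr0; exact: (cvgD (cvg_cst _) le)].
have h4 : (\int[mu]_(x in E n) (f x)%:E @[n --> \oo] --> (F b - F a)%:E)%E.
  under eq_fun do rewrite EF.
  by apply: cvg_EFin; [exact: nearW|exact: cvgB].
exact: (cvg_unique _ h1 h4).
Unshelve. all: by end_near. Qed.

End calculus.

(** * The Abel kernel *)

Section abel_kernel.
Context {R : realType}.
Local Notation mu := (@lebesgue_measure R).
Implicit Types (a b c p q : R).

(* [(p - c)^{-1/2}] for [c < p], and [0] for [p <= c] *)
Definition abk p c : R := (Num.sqrt (p - c))^-1.

Lemma abk_ge0 p c : 0 <= abk p c.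
Proof. by rewrite invr_ge0 sqrtr_ge0. Qed.

(** Two default values are at work: the square root of a nonpositive number and the inverse of 0 are
    both 0. So kernel integrals with different ranges can all be written over [(0, 1)]. *)
Lemma abk_le0 p c : p <= c -> abk p c = 0.
Proof. by move=> pc; rewrite /abk ler0_sqrtr ?invr0// subr_le0. Qed.

Lemma measurable_inv : measurable_fun setT (fun y : R => y^-1).
Proof.
rewrite -(setvU [set 0 : R]); apply/measurable_funU => //.
- exact: measurableC.
- split; last exact: measurable_fun_set1.
  apply: open_continuous_measurable_fun; first by apply: closed_openC; exact: closed_eq.
  move=> y; rewrite inE => /= y0; apply: inv_continuous.
  exact/eqP.
Qed.

Lemma measurable_abk d (T : measurableType d) (D : set T) (f g : T -> R) :
  measurable_fun D f -> measurable_fun D g ->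
  measurable_fun D (fun x => abk (f x) (g x)).
Proof.
move=> mf mg; apply: (measurableT_comp measurable_inv).
apply: (measurableT_comp (f := @Num.sqrt R)); last exact: measurable_funB.
by apply: continuous_measurable_fun; exact: sqrt_continuous.
Qed.

Lemma sqrt_sub_continuous p c : {for c, continuous (fun c => Num.sqrt (p - c))}.
Proof.
apply: (continuous_comp (f := fun c => p - c) (g := @Num.sqrt R)).
  by apply: continuousB; [exact: cvg_cst|exact: cvg_id].
exact: sqrt_continuous.
Qed.

Lemma abk_continuous_r p c : c < p -> {for c, continuous (abk p)}.
Proof.
move=> cp; apply: (continuous_comp (f := fun c => Num.sqrt (p - c)) (g := fun y => y^-1)).
  exact: sqrt_sub_continuous.
by apply: inv_continuous; rewrite sqrtr_eq0 -ltNge subr_gt0.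
Qed.

Lemma abk_continuous_l p c : c < p -> {for p, continuous (abk ^~ c)}.
Proof.
move=> cp; apply: (continuous_comp (f := fun p => Num.sqrt (p - c)) (g := fun y => y^-1)).
  apply: (continuous_comp (f := fun p => p - c) (g := @Num.sqrt R)).
    by apply: continuousB; [exact: cvg_id|exact: cvg_cst].
  exact: sqrt_continuous.
by apply: inv_continuous; rewrite sqrtr_eq0 -ltNge subr_gt0.
Qed.


Lemma is_derive_sqrt_sub p c : c < p ->
  is_derive c 1 (fun c => Num.sqrt (p - c)) (- (abk p c) / 2).
Proof.
move=> cp.
have pc : 0 < p - c by rewrite subr_gt0.
have d1 : is_derive c 1 (fun c => p - c) (-1).
  by have := is_deriveB (is_derive_cst p c (1:R)) (is_derive_id c (1:R)); rewrite sub0r.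
have d2 := @is_derive1_sqrt R _ pc.
have := @is_derive1_comp _ (@Num.sqrt R) (fun c => p - c) _ _ _ d2 d1.
rewrite /abk mulrN1 invfM mulrC mulNr => h; exact: h.
Qed.

Lemma is_derive_sqrt_subl p c : c < p ->
  is_derive p 1 (fun p => Num.sqrt (p - c)) ((abk p c) / 2).
Proof.
move=> cp.
have pc : 0 < p - c by rewrite subr_gt0.
have d1 : is_derive p 1 (fun p => p - c) 1.
  by have := is_deriveB (is_derive_id p (1:R)) (is_derive_cst c p (1:R)); rewrite subr0.
have d2 := @is_derive1_sqrt R _ pc.
have := @is_derive1_comp _ (@Num.sqrt R) (fun p => p - c) _ _ _ d2 d1.
rewrite /abk mulr1 invfM mulrC => h; exact: h.
Qed.

Lemma int_abk_r q p : q < p ->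
  (\int[mu]_(c in `]q, p[) (abk p c)%:E = (2 * Num.sqrt (p - q))%:E)%E.
Proof.
move=> qp.
pose F (c : R) : R := - 2 * Num.sqrt (p - c).
have -> : 2 * Num.sqrt (p - q) = F p - F q by rewrite /F subrr sqrtr0; ring.
apply: ge0_FTC2_oo; first exact: qp.
- by move=> c; rewrite in_itv/= => /andP[_ cp]; exact: abk_continuous_r.
- by move=> c _; exact: abk_ge0.
- apply: continuous_subspaceT => c.
  by apply: cvgM; [exact: cvg_cst|exact: sqrt_sub_continuous].
- move=> c; rewrite in_itv/= => /andP[_ cp].
  have pc : 0 < p - c by rewrite subr_gt0.
  have d1 := is_derive_sqrt_sub cp.
  have := @is_deriveZ _ _ _ _ (-2 : R) _ _ _ d1.
  rewrite (_ : -2 *: (- abk p c / 2) = abk p c); first exact.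
  by rewrite /GRing.scale/=; field.
Qed.


Lemma int_abk_l q p : q < p ->
  (\int[mu]_(r in `]q, p[) (abk r q)%:E = (2 * Num.sqrt (p - q))%:E)%E.
Proof.
move=> qp.
pose F (c : R) : R := 2 * Num.sqrt (c - q).
have -> : 2 * Num.sqrt (p - q) = F p - F q by rewrite /F subrr sqrtr0; ring.
apply: ge0_FTC2_oo; first exact: qp.
- by move=> c; rewrite in_itv/= => /andP[qc _]; exact: abk_continuous_l.
- by move=> c _; exact: abk_ge0.
- apply: continuous_subspaceT => c.
  apply: cvgM; [exact: cvg_cst|].
  apply: (continuous_comp (f := fun p => p - q) (g := @Num.sqrt R)).
    by apply: continuousB; [exact: cvg_id|exact: cvg_cst].
  exact: sqrt_continuous.
- move=> c; rewrite in_itv/= => /andP[qc _].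
  have d1 := is_derive_sqrt_subl qc.
  have := @is_deriveZ _ _ _ _ (2 : R) _ _ _ d1.
  rewrite (_ : 2 *: (abk c q / 2) = abk c q); first exact.
  by rewrite /GRing.scale/=; field.
Qed.

Lemma asin_continuous : {within `[-1, 1], continuous (@asin R)}.
Proof.
have h : - (pi / 2) <= pi / 2 :> R by have := @pi_gt0 R; lra.
have := segment_can_le_continuous h (continuous_subspaceT (@continuous_sin R)) (@sinK R).
by rewrite sinN sin_pihalf.
Qed.

Lemma asin_1 : asin 1 = pi / 2 :> R.
Proof. by rewrite -[X in asin X]sin_pihalf sinK// in_itv/= lexx andbT; have := @pi_gt0 R; lra. Qed.

Lemma asin_N1 : asin (-1) = - (pi / 2) :> R.
Proof. 
rewrite -[X in asin (- X)]sin_pihalf -sinN sinK// in_itv/= lexx /=; have := @pi_gt0 R; lra. 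
Qed.

End abel_kernel.

Lemma within_continuous_comp2 (U V W : topologicalType) (A : set U) (B : set V)
    (f : U -> V) (g : V -> W) : (forall x, A x -> B (f x)) ->
  {within A, continuous f} -> {within B, continuous g} ->
  {within A, continuous (g \o f)}.
Proof.
move=> AB /subspace_continuousP cf /subspace_continuousP cg.
apply/subspace_continuousP => x Ax.
apply: cvg_trans (cg _ (AB _ Ax)).
move=> S; rewrite /within/= => /(cf _ Ax); rewrite /within/= => h.
by apply: (@filterS _ (nbhs x) _ _ _ _ h) => y {}h Ay; exact: h Ay (AB _ Ay).
Qed.

Lemma sqrt_ltE (R : rcfType) (c y : R) : 0 <= c -> 0 <= y ->
  (Num.sqrt c < y) = (c < y ^+ 2).
Proof.
move=> c0 y0; by rewrite -[in RHS](sqr_sqrtr c0) ltr_pXn2r ?nnegrE//.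
Qed.

Lemma lt_sqrtE (R : rcfType) (b y : R) : 0 <= b -> 0 <= y ->
  (y < Num.sqrt b) = (y ^+ 2 < b).
Proof.
move=> b0 y0; by rewrite -[in RHS](sqr_sqrtr b0) ltr_pXn2r ?nnegrE//.
Qed.

Section abel_kernel2.
Context {R : realType}.
Local Notation mu := (@lebesgue_measure R).
Implicit Types (a b c p q : R).

Let ac q p (c : R) : R := (2 * c - p - q) / (p - q).

Let ac_continuous q p : continuous (ac q p).
Proof.
move=> c; apply: cvgMl; apply: cvgB; last exact: cvg_cst.
by apply: cvgB; [apply: cvgMr; exact: cvg_id|exact: cvg_cst].
Qed.

Let ac_bnd q p c : q < p -> q <= c <= p -> -1 <= ac q p c <= 1.
Proof.
move=> qp /andP[qc cp]; have h : 0 < p - q by rewrite subr_gt0.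
by rewrite /ac ler_pdivlMr// ler_pdivrMr//; apply/andP; split; lra.
Qed.

Let is_derive_asin_ac q p c : q < c -> c < p ->
  is_derive c 1 (asin \o ac q p) (abk p c * abk c q).
Proof.
move=> qc cp; have h : 0 < p - q by lra.
have h1 : 0 < c - q by lra.
have h2 : 0 < p - c by lra.
have y1 : -1 < ac q p c < 1.
  by rewrite /ac ltr_pdivlMr// ltr_pdivrMr//; apply/andP; split; lra.
have d1 : is_derive c 1 (ac q p) (2 / (p - q)).
  have := is_deriveB (is_deriveB (is_deriveZ (2 : R) (is_derive_id c (1:R)))
    (is_derive_cst p c (1:R))) (is_derive_cst q c (1:R)).
  move=> /(is_deriveZ (p - q)^-1).
  rewrite !subr0 /GRing.scale/= mulr1 mulrC => e.
  rewrite (_ : ac q p = ((p - q)^-1 \*: (2 \*: id - cst p - cst q)))//.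
  by apply/funext => z; rewrite /ac /= mulrC.
have := is_derive1_comp (is_derive1_asin y1) d1.
rewrite (_ : _ * (2 / (p - q)) = abk p c * abk c q); first exact.
rewrite (_ : 1 - ac q p c ^+ 2 = (2 / (p - q)) ^+ 2 * ((p - c) * (c - q))); last first.
  by rewrite /ac; field; rewrite gt_eqF.
rewrite sqrtrM ?sqr_ge0// sqrtr_sqr ger0_norm; last by rewrite divr_ge0// ltW.
rewrite sqrtrM ?(ltW h2)// /abk; field.
by rewrite !gt_eqF ?sqrtr_gt0.
Qed.

(** The primitive is the arcsine of the affine map of [[q, p]] onto [[-1, 1]]. That the value does
    not depend on [p] and [q] is what makes Abel inversion work. *)
Lemma int_abk_beta q p : q < p ->
  (\int[mu]_(c in `]q, p[) (abk p c * abk c q)%:E = pi%:E)%E.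
Proof.
move=> qp; have h : p - q != 0 by rewrite subr_eq0 gt_eqF.
pose F (c : R) : R := asin (ac q p c).
have -> : pi = F p - F q.
  rewrite /F /ac.
  rewrite (_ : (2 * p - p - q) / (p - q) = 1); last by field.
  rewrite (_ : (2 * q - p - q) / (p - q) = -1); last by field.
  by rewrite asin_1 asin_N1; field.
apply: ge0_FTC2_oo; first exact: qp.
- move=> c; rewrite in_itv/= => /andP[qc cp].
  by apply: cvgM; [exact: abk_continuous_r|exact: abk_continuous_l].
- by move=> c _; rewrite mulr_ge0 ?abk_ge0.
- apply: (@within_continuous_comp2 R R R _ `[-1, 1]%classic (ac q p) (@asin R)).
  + by move=> x /=; rewrite !in_itv/=; exact: ac_bnd.
  + by apply: continuous_subspaceT; exact: ac_continuous.
  + exact: asin_continuous.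
- by move=> c; rewrite in_itv/= => /andP[qc cp]; exact: is_derive_asin_ac.
Qed.

(** The substitution of [y^2] in [int_abk_beta]; its Jacobian [2 y] accounts for the factor one
    half. *)
Lemma int_abk_beta_sq c b : 0 <= c -> c < b ->
  (\int[mu]_(y in `]Num.sqrt c, Num.sqrt b[)
     (y * abk b (y ^+ 2) * abk (y ^+ 2) c)%:E = (pi / 2)%:E)%E.
Proof.
move=> c0 cb; have h : b - c != 0 by rewrite subr_eq0 gt_eqF.
have b0 : 0 <= b by lra.
have scb : Num.sqrt c < Num.sqrt b by rewrite ltr_sqrt ?(le_lt_trans c0).
pose F (y : R) : R := 2^-1 * asin (ac c b (y ^+ 2)).
have -> : pi / 2 = F (Num.sqrt b) - F (Num.sqrt c).
  rewrite /F /ac !sqr_sqrtr//.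
  rewrite (_ : (2 * b - b - c) / (b - c) = 1); last by field.
  rewrite (_ : (2 * c - b - c) / (b - c) = -1); last by field.
  by rewrite asin_1 asin_N1; field.
have y2 y : Num.sqrt c < y < Num.sqrt b -> c < y ^+ 2 < b.
  move=> /andP[h1 h2]; have y0 : 0 < y by exact: le_lt_trans h1.
  by rewrite -sqrt_ltE ?(ltW y0)// h1/= -lt_sqrtE// ltW.
apply: ge0_FTC2_oo; first exact: scb.
- move=> y; rewrite in_itv/= => /y2/andP[cy yb].
  have c1 : {for y, continuous (fun y : R => abk b (y ^+ 2))}.
    apply: (continuous_comp (f := fun y : R => y ^+ 2) (g := abk b)).
      exact: exprn_continuous.
    exact: abk_continuous_r.
  have c2 : {for y, continuous (fun y : R => abk (y ^+ 2) c)}.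
    apply: (continuous_comp (f := fun y : R => y ^+ 2) (g := abk ^~ c)).
      exact: exprn_continuous.
    exact: abk_continuous_l.
  exact: (cvgM (cvgM cvg_id c1) c2).
- move=> y; rewrite in_itv/= => /andP[/ltW h1 _].
  by rewrite !mulr_ge0 ?abk_ge0// (le_trans _ h1).
- apply: (@within_continuous_comp2 R R R _ setT (fun y => asin (ac c b (y ^+ 2))) ( *%R 2^-1)) => //.
    apply: (@within_continuous_comp2 R R R _ `[-1, 1]%classic (fun y => ac c b (y ^+ 2)) (@asin R)).
    + move=> y /=; rewrite !in_itv/= => /andP[h1 h2]; apply: ac_bnd => //.
      have y0 : 0 <= y by exact: le_trans h1.
      by rewrite leNgt -lt_sqrtE// -leNgt h1/= leNgt -sqrt_ltE// -leNgt.
    + apply: continuous_subspaceT => y.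
      apply: (continuous_comp (f := fun y : R => y ^+ 2) (g := ac c b)).
        exact: exprn_continuous.
      exact: ac_continuous.
    + exact: asin_continuous.
  by apply: continuous_subspaceT => y; apply: mulrl_continuous.
- move=> y; rewrite in_itv/= => /y2/andP[cy yb].
  have d1 : is_derive y 1 (fun y : R => y ^+ 2) (2 * y).
    have := is_deriveX 2 (is_derive_id y (1:R)).
    rewrite (_ : _ *: 1 = 2 * y); first exact.
    by rewrite /GRing.scale/= expr1 mulr1.
  have := @is_derive1_comp _ (asin \o ac c b) (fun y => y ^+ 2) _ _ _ (is_derive_asin_ac cy yb) d1.
  move/(is_deriveZ (2^-1 : R)).
  rewrite (_ : _ *: _ = y * abk b (y ^+ 2) * abk (y ^+ 2) c); first exact.
  by rewrite /GRing.scale/=; field.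
Qed.

End abel_kernel2.

(** * Explicit Abel integrals and Tonelli on product sets *)

Section abel_kernel3.
Context {R : realType}.
Local Notation mu := (@lebesgue_measure R).
Implicit Types (a b c p q : R).

(** A primitive is [-2 ln (sqrt (x^2 - c) + sqrt (y^2 - c))]; its increment is
    [2 ln (x + y) - ln (y^2 - x^2)]. *)
Lemma int_abk_log (x y : R) : 0 < x -> x < y ->
  (\int[mu]_(c in `]0%R, (x ^+ 2)%R[) (abk (x ^+ 2) c * abk (y ^+ 2) c)%:E =
   (ln ((x + y) / (y - x)))%:E)%E.
Proof.
move=> x0 xy; have y0 : 0 < y by exact: lt_trans xy.
have xy2 : x ^+ 2 < y ^+ 2 by rewrite ltr_pXn2r// nnegrE ltW.
have x2 : 0 < x ^+ 2 by rewrite exprn_gt0.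
pose S (c : R) : R := Num.sqrt (x ^+ 2 - c) + Num.sqrt (y ^+ 2 - c).
pose F (c : R) : R := (-2) * ln (S c).
have S0 c : c <= x ^+ 2 -> 0 < S c.
  by move=> cx; rewrite ltr_wpDl ?sqrtr_ge0// sqrtr_gt0; lra.
have -> : ln ((x + y) / (y - x)) = F (x ^+ 2) - F 0.
  rewrite /F /S subrr sqrtr0 add0r !subr0 !sqrtr_sqr !gtr0_norm//.
  have yx0 : 0 < y - x by lra.
  have xy0 : 0 < x + y by lra.
  have -> : y ^+ 2 - x ^+ 2 = (y - x) * (x + y) by ring.
  rewrite sqrtrM; last exact: ltW.
  rewrite ln_div ?posrE// lnM ?posrE ?sqrtr_gt0//.
  have lns z : 0 < z -> ln z = 2 * ln (Num.sqrt z) :> R.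
    move=> z0; rewrite -[in LHS](sqr_sqrtr (ltW z0)) expr2 lnM ?posrE ?sqrtr_gt0//.
    by ring.
  by rewrite (lns _ yx0) (lns _ xy0); ring.
apply: ge0_FTC2_oo; first exact: x2.
- move=> c; rewrite in_itv/= => /andP[_ cx].
  by apply: cvgM; apply: abk_continuous_r => //; exact: lt_trans xy2.
- by move=> c _; rewrite mulr_ge0 ?abk_ge0.
- apply: (@within_continuous_comp2 R R R _ setT (fun c => ln (S c)) ( *%R (-2))) => //.
    apply: (@within_continuous_comp2 R R R _ `]0, +oo[%classic S (@ln R)).
    + by move=> c /=; rewrite !in_itv/= andbT => /andP[_]; exact: S0.
    + apply: continuous_subspaceT => c.
      by apply: cvgD; exact: sqrt_sub_continuous.
    + apply: continuous_in_subspaceT => z; rewrite inE/= in_itv/= andbT.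
      exact: continuous_ln.
  by apply: continuous_subspaceT => z; apply: mulrl_continuous.
- move=> c; rewrite in_itv/= => /andP[_ cx].
  have cy : c < y ^+ 2 by exact: lt_trans xy2.
  have d1 := is_deriveD (is_derive_sqrt_sub cx) (is_derive_sqrt_sub cy).
  have d2 := @is_derive1_comp _ (@ln R) S _ _ _ (is_derive1_ln (S0 _ (ltW cx))) d1.
  move: (is_deriveZ (-2 : R) d2).
  rewrite (_ : _ *: _ = abk (x ^+ 2) c * abk (y ^+ 2) c); first exact.
  have h1 : 0 < Num.sqrt (x ^+ 2 - c) by rewrite sqrtr_gt0 subr_gt0.
  have h2 : 0 < Num.sqrt (y ^+ 2 - c) by rewrite sqrtr_gt0 subr_gt0.
  rewrite /GRing.scale/= /abk /S; field.
  by rewrite !gt_eqF// addr_gt0.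
Qed.

(** The moment behind the term [16 eta^5 t] of the external field: [30 t] times [16/15 eta^5] is
    twice that term. *)
Lemma int_abk_sqr p : 0 < p ->
  (\int[mu]_(c in `]0%R, p[) (c ^+ 2 * abk p c)%:E =
   (16 / 15 * p ^+ 2 * Num.sqrt p)%:E)%E.
Proof.
move=> p0.
pose F (c : R) : R := (- 2 / 15) * (Num.sqrt (p - c) * (3 * c ^+ 2 + 4 * p * c + 8 * p ^+ 2)).
have -> : 16 / 15 * p ^+ 2 * Num.sqrt p = F p - F 0.
  by rewrite /F subrr sqrtr0 subr0; field.
have cP : continuous (fun c : R => 3 * c ^+ 2 + 4 * p * c + 8 * p ^+ 2).
  move=> c; apply: cvgD; last exact: cvg_cst.
  by apply: cvgD; apply: cvgMr; [exact: exprn_continuous|exact: cvg_id].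
apply: ge0_FTC2_oo; first exact: p0.
- move=> c; rewrite in_itv/= => /andP[_ cx].
  by apply: cvgM; [exact: exprn_continuous|exact: abk_continuous_r].
- by move=> c _; rewrite mulr_ge0 ?abk_ge0// sqr_ge0.
- apply: continuous_subspaceT => c.
  by apply: cvgMr; apply: cvgM; [exact: sqrt_sub_continuous|exact: cP].
- move=> c; rewrite in_itv/= => /andP[_ cp].
  have d0 : is_derive c 1 (fun y : R => y ^+ 2) (2 * c).
    have := is_deriveX 2 (is_derive_id c (1:R)).
    rewrite (_ : _ *: 1 = 2 * c); first exact.
    by rewrite /GRing.scale/= expr1 mulr1.
  have dp := is_deriveD (is_deriveD (is_deriveZ (3 : R) d0) (is_deriveZ (4 * p) (is_derive_id c (1:R)))) (is_derive_cst (8 * p ^+ 2) c (1:R)).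
  move: (is_deriveZ (- 2 / 15 : R) (is_deriveM (is_derive_sqrt_sub cp) dp)).
  rewrite (_ : _ *: _ = c ^+ 2 * abk p c); first exact.
  rewrite !fctE /= /GRing.scale/= /abk.
  have h : 0 < Num.sqrt (p - c) by rewrite sqrtr_gt0 subr_gt0.
  have h2 : p - c = Num.sqrt (p - c) ^+ 2 by rewrite sqr_sqrtr// subr_ge0 ltW.
  rewrite (_ : p = Num.sqrt (p - c) ^+ 2 + c); last by rewrite -h2; ring.
  rewrite (_ : Num.sqrt (p - c) ^+ 2 + c - c = Num.sqrt (p - c) ^+ 2); last by ring.
  rewrite sqrtr_sqr gtr0_norm//.
  by field; rewrite gt_eqF.
Qed.

Lemma tonelli_set (D E : set R) (f : R * R -> \bar R) :
  measurable D -> measurable E -> measurable_fun (D `*` E) f ->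
  (forall z, (D `*` E) z -> (0 <= f z)%E) ->
  (\int[mu]_(x in D) \int[mu]_(y in E) f (x, y) =
   \int[mu]_(y in E) \int[mu]_(x in D) f (x, y))%E.
Proof.
move=> mD mE mf f0.
have mDE : measurable (D `*` E) by exact: measurableX.
pose g := f \_ (D `*` E).
have mg : measurable_fun setT g by apply/(measurable_restrictT _ _).1.
have g0 z : (0 <= g z)%E by apply: erestrict_ge0.
rewrite integral_mkcond [in RHS]integral_mkcond.
have e1 : (fun x => \int[mu]_y g (x, y))%E = ((fun x => \int[mu]_(y in E) f (x, y)) \_ D)%E.
  apply/funext => x; rewrite patchE; case: ifPn => xD.
    rewrite [RHS]integral_mkcond; apply: eq_integral => y _.
    rewrite /g !patchE; congr (if _ then _ else _).
    by rewrite in_setX/= xD.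
  rewrite (eq_integral (cst 0%E)) ?integral0// => y _.
  by rewrite /g patchE in_setX (negbTE xD).
have e2 : (fun y => \int[mu]_x g (x, y))%E = ((fun y => \int[mu]_(x in D) f (x, y)) \_ E)%E.
  apply/funext => y; rewrite patchE; case: ifPn => yE.
    rewrite [RHS]integral_mkcond; apply: eq_integral => x _.
    rewrite /g !patchE; congr (if _ then _ else _).
    by rewrite in_setX/= yE andbT.
  rewrite (eq_integral (cst 0%E)) ?integral0// => x _.
  by rewrite /g patchE in_setX (negbTE yE) andbF.
by rewrite -e1 -e2; exact: (@fubini_tonelli _ _ _ _ _ mu mu g mg g0).
Qed.

Lemma measurable_int_snd (D E : set R) (f : R * R -> \bar R) :
  measurable D -> measurable E -> measurable_fun (D `*` E) f ->
  (forall z, (D `*` E) z -> (0 <= f z)%E) ->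
  measurable_fun D (fun x => \int[mu]_(y in E) f (x, y))%E.
Proof.
move=> mD mE mf f0.
have mDE : measurable (D `*` E) by exact: measurableX.
pose g := f \_ (D `*` E).
have mg : measurable_fun setT g by apply/(measurable_restrictT _ _).1.
have g0 z : (0 <= g z)%E by apply: erestrict_ge0.
have := @measurable_fun_fubini_tonelli_F _ _ _ _ _ mu g mg g0.
move=> /(measurable_funS measurableT (@subsetT _ D)); apply: eq_measurable_fun => x xD.
rewrite /fubini_F [RHS]integral_mkcond; apply: eq_integral => y _.
rewrite /g !patchE; congr (if _ then _ else _).
by rewrite in_setX/= xD.
Qed.

Lemma measurable_int_fst (D E : set R) (f : R * R -> \bar R) :
  measurable D -> measurable E -> measurable_fun (D `*` E) f ->
  (forall z, (D `*` E) z -> (0 <= f z)%E) ->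
  measurable_fun E (fun y => \int[mu]_(x in D) f (x, y))%E.
Proof.
move=> mD mE mf f0.
have mDE : measurable (D `*` E) by exact: measurableX.
pose g := f \_ (D `*` E).
have mg : measurable_fun setT g by apply/(measurable_restrictT _ _).1.
have g0 z : (0 <= g z)%E by apply: erestrict_ge0.
have := @measurable_fun_fubini_tonelli_G _ _ _ _ _ mu g mg g0.
move=> /(measurable_funS measurableT (@subsetT _ E)); apply: eq_measurable_fun => y yE.
rewrite /fubini_G [RHS]integral_mkcond; apply: eq_integral => x _.
rewrite /g !patchE; congr (if _ then _ else _).
by rewrite in_setX/= yE andbT.
Qed.
End abel_kernel3.

(** * Affine change of variables *)

Section affine.
Context {R : realType}.
Local Notation mu := (@lebesgue_measure R).

Let phi (k b x : R) : measurableTypeR R := k * x + b.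

Let mphi k b : measurable_fun setT (phi k b).
Proof. by apply: measurable_funD => //; exact: measurable_funM. Qed.

Let nk (k : R) : {nonneg R} := NngNum (normr_ge0 k).

Let phi_itv k b u v : k != 0 ->
  (`|k|%:E * mu (phi k b @^-1` `]u, v]) = mu `]u, v])%E.
Proof.
rewrite neq_lt => /orP[k0|k0].
- have -> : phi k b @^-1` `]u, v] = `[(v - b) / k, (u - b) / k[%classic.
    apply/seteqP; split => x /=; rewrite !in_itv/= /phi ler_ndivrMr// ltr_ndivlMr//;
    by rewrite -lerBrDr -ltrBlDr mulrC andbC.
  rewrite !lebesgue_measure_itv/= !lte_fin ltr_nM2r ?invr_lt0// ltrD2r.
  case: ifPn => _; last by rewrite mule0.
  by rewrite -EFinB -EFinM ltr0_norm//; congr EFin; field; rewrite lt_eqF.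
- have -> : phi k b @^-1` `]u, v] = `](u - b) / k, (v - b) / k]%classic.
    apply/seteqP; split => x /=; rewrite !in_itv/= /phi ler_pdivlMr// ltr_pdivrMr//;
    by rewrite -lerBrDr -ltrBlDr mulrC.
  rewrite !lebesgue_measure_itv/= !lte_fin ltr_pM2r ?invr_gt0// ltrD2r.
  case: ifPn => _; last by rewrite mule0.
  by rewrite -EFinB -EFinM gtr0_norm//; congr EFin; field; rewrite gt_eqF.
Qed.

(** The scaled image measure agrees with Lebesgue measure on half-open intervals, hence everywhere.
    Negative slopes are needed because [mix] decreases in [m] when [xi < v]. *)
Lemma ge0_integral_affine (k b : R) (f : R -> \bar R) : k != 0 ->
  measurable_fun setT f -> (forall x, 0 <= f x)%E ->
  (\int[mu]_x f x = `|k|%:E * \int[mu]_x f (k * x + b)%R)%E.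
Proof.
move=> k0 mf f0.
rewrite (eq_measure_integral (mscale (nk k) (pushforward mu (phi k b)))).
- exact: mphi.
- move=> mp; rewrite ge0_integral_mscale//; congr (_ * _)%E.
  by rewrite ge0_integral_pushforward//.
- move=> mp A mA _.
  apply: (@lebesgue_measure_unique R (mscale (nk k) (pushforward mu (phi k b)))) => //.
  by move=> _ [[u v]] _ <-; apply/esym; exact: phi_itv.
Qed.

End affine.

(** * The averaging operator *)

Section averages.
Context {R : realType}.
Local Notation mu := (@lebesgue_measure R).
Implicit Types (G : R -> R) (xi v m : R).

Lemma bounded_onP (T : Type) (D : set T) (h : T -> R) (M : R) :
  (forall x, D x -> `|h x| <= M) -> [bounded h x | x in D].
Proof.
move=> hM; exists M; split; first exact: num_real.
by move=> N MN x Dx; apply: (le_trans (hM x Dx)); exact: ltW.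
Qed.

Definition mix xi v m : R := (1 + m) / 2 * xi + (1 - m) / 2 * v.

Lemma mix_between xi v m (c d : R) : m \in `[-1, 1] -> c <= xi <= d -> c <= v <= d ->
  c <= mix xi v m <= d.
Proof.
rewrite in_itv/= => /andP[m1 m2] /andP[c1 d1] /andP[c2 d2]; rewrite /mix.
have h1 : 0 <= (1 + m) / 2 by lra.
have h2 : 0 <= (1 - m) / 2 by lra.
have h3 : (1 + m) / 2 + (1 - m) / 2 = 1 by field.
set a := (1 + m) / 2 in h1 h3 *; set b := (1 - m) / 2 in h2 h3 *.
by apply/andP; split; nra.
Qed.

Lemma mix01 xi v m : m \in `[-1, 1] -> xi \in `]0, 1[ -> v \in `]0, 1[ ->
  mix xi v m \in `]0, 1[.
Proof.
move=> mI; rewrite !in_itv/= => /andP[x0 x1] /andP[v0 v1].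
have hx : Num.min xi v <= xi <= Num.max xi v by rewrite ge_min le_max lexx.
have hv : Num.min xi v <= v <= Num.max xi v by rewrite ge_min le_max lexx !orbT.
have /andP[] := mix_between mI hx hv.
move=> h1 h2; apply/andP; split.
  by apply: lt_le_trans h1; rewrite lt_min x0.
by apply: le_lt_trans h2 _; rewrite gt_max x1.
Qed.

Lemma mix_continuous xi v : continuous (mix xi v).
Proof.
move=> m; rewrite /mix.
apply: cvgD; apply: cvgMl; apply: cvgMl.
  by apply: cvgD; [exact: cvg_cst|exact: cvg_id].
by apply: cvgB; [exact: cvg_cst|exact: cvg_id].
Qed.

Lemma integrable_abk1 : mu.-integrable `[-1, 1] (fun m => (abk 1 m)%:E).
Proof.
have mk : measurable_fun setT (fun m => (abk 1 m)%:E : \bar R).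
  by apply/measurable_EFinP; apply: measurable_abk.
apply/integrableP; split; first exact: measurable_funTS.
rewrite -integral_itv_obnd_cbnd; last first.
  by apply: measurableT_comp => //; exact: measurable_funTS.
rewrite -integral_itv_bndo_bndc; last first.
  by apply: measurableT_comp => //; exact: measurable_funTS.
under eq_integral do rewrite gee0_abs ?lee_fin ?abk_ge0//.
by rewrite int_abk_r ?ltry//; lra.
Qed.

Lemma Rint_abk1 : \int[mu]_(m in `[-1, 1]) abk 1 m = 2 * Num.sqrt 2.
Proof.
have mk : measurable_fun setT (fun m => (abk 1 m)%:E : \bar R).
  by apply/measurable_EFinP; apply: measurable_abk.
rewrite /Rintegral -integral_itv_obnd_cbnd; last exact: measurable_funTS.
rewrite -integral_itv_bndo_bndc; last exact: measurable_funTS.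
rewrite int_abk_r//=.
by congr (2 * Num.sqrt _); lra.
Qed.

(** Integration against a probability measure on [[-1, 1]]: by [Rint_abk1] the constant in front
    normalises the weight. *)
Definition wavg (h : R -> R) : R :=
  (2 * Num.sqrt 2)^-1 * \int[mu]_(m in `[-1, 1]) (h m * abk 1 m).

Definition wint (h : R -> R) := mu.-integrable `[-1, 1] (fun m => (h m * abk 1 m)%:E).

Lemma wint_bounded (h : R -> R) (M : R) : measurable_fun (`[-1, 1] : set R) h ->
  (forall m, m \in `[-1, 1] -> `|h m| <= M) -> wint h.
Proof.
move=> mh hM; rewrite /wint.
rewrite (_ : (fun m => _) = (EFin \o h) \* (fun m => (abk 1 m)%:E))%E; last first.
  by apply/funext => m /=; rewrite EFinM.
apply: (@integrableMr _ _ _ mu _ _ h (fun m => (abk 1 m)%:E)) => //.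
- exact: bounded_onP hM.
- exact: integrable_abk1.
Qed.

Lemma wavg_cst (k : R) : wavg (fun=> k) = k.
Proof.
rewrite /wavg RintegralZl//; last exact: integrable_abk1.
by rewrite Rint_abk1 mulrCA mulVf// mulr1.
Qed.

Lemma wint_cst (k : R) : wint (fun=> k).
Proof. by apply: (@wint_bounded _ `|k|) => // m _; exact: lexx. Qed.

Lemma wavg_le (h h' : R -> R) : wint h -> wint h' ->
  (forall m, m \in `[-1, 1] -> h m <= h' m) -> wavg h <= wavg h'.
Proof.
move=> ih ih' hh; rewrite /wavg ler_wpM2l ?invr_ge0 ?mulr_ge0 ?sqrtr_ge0//.
apply: le_Rintegral => //.
by move=> m mI; rewrite ler_wpM2r ?abk_ge0 ?hh.
Qed.

Lemma wintD (h h' : R -> R) : wint h -> wint h' -> wint (h \+ h').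
Proof.
move=> ih ih'; rewrite /wint.
rewrite (_ : (fun m => _) = (fun m => (h m * abk 1 m)%:E) \+ (fun m => (h' m * abk 1 m)%:E))%E.
  exact: integrableD.
by apply/funext => m /=; rewrite mulrDl EFinD.
Qed.

Lemma wavgD (h h' : R -> R) : wint h -> wint h' -> wavg (h \+ h') = wavg h + wavg h'.
Proof.
move=> ih ih'; rewrite /wavg -mulrDr -RintegralD//.
by congr (_ * _); apply: eq_Rintegral => m _; rewrite /= mulrDl.
Qed.

Lemma wintZ (k : R) (h : R -> R) : wint h -> wint (fun m => k * h m).
Proof.
move=> ih; rewrite /wint.
rewrite (_ : (fun m => _) = (fun m => k%:E * (h m * abk 1 m)%:E))%E.
  exact: integrableZl.
by apply/funext => m /=; rewrite -mulrA EFinM.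
Qed.

Lemma wavgZ (k : R) (h : R -> R) : wint h -> wavg (fun m => k * h m) = k * wavg h.
Proof.
move=> ih; rewrite /wavg mulrCA -[X in _ = _ * X]RintegralZl//.
by congr (_ * _); apply: eq_Rintegral => m _; rewrite /= mulrA.
Qed.

Lemma avg_opE G xi v : avg_op G xi v = wavg (G \o mix xi v).
Proof. by []. Qed.

Lemma continuous_mix G xi v : {in `]0, 1[, continuous G} ->
  xi \in `]0, 1[ -> v \in `]0, 1[ -> {within `[-1, 1], continuous (G \o mix xi v)}.
Proof.
move=> cG x0 v0; apply: continuous_in_subspaceT => m; rewrite inE => mI.
apply: continuous_comp; first exact: mix_continuous.
by apply: cG; exact: mix01.
Qed.

Lemma wint_mix G xi v : {in `]0, 1[, continuous G} ->
  xi \in `]0, 1[ -> v \in `]0, 1[ -> wint (G \o mix xi v).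
Proof.
move=> cG x0 v0.
have c := continuous_mix cG x0 v0.
have /compact_bounded [M [_ hM]] := continuous_compact c (@segment_compact _ _ _).
apply: (@wint_bounded _ (M + 1)).
  by apply: subspace_continuous_measurable_fun.
move=> m mI; apply: hM; first by rewrite ltrDl.
by exists m.
Qed.

Lemma avg_op_cst (k : R) xi v : avg_op (fun=> k) xi v = k.
Proof. exact: wavg_cst. Qed.

Lemma avg_op_diag G v : avg_op G v v = G v.
Proof.
rewrite avg_opE -[RHS]wavg_cst; congr wavg; apply/funext => m /=.
by congr G; rewrite /mix; field.
Qed.

Lemma avg_op_le G G' xi v (c d : R) : {in `]0, 1[, continuous G} -> {in `]0, 1[, continuous G'} ->
  xi \in `]0, 1[ -> v \in `]0, 1[ -> c <= xi <= d -> c <= v <= d ->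
  (forall y, y \in `]0, 1[ -> c <= y <= d -> G y <= G' y) ->
  avg_op G xi v <= avg_op G' xi v.
Proof.
move=> cG cG' x0 v0 hx hv h; rewrite !avg_opE.
apply: wavg_le; [exact: wint_mix|exact: wint_mix|].
by move=> m mI /=; apply: h; [exact: mix01|exact: mix_between].
Qed.

Lemma avg_op_gt0 G xi v (c d : R) : {in `]0, 1[, continuous G} ->
  xi \in `]0, 1[ -> v \in `]0, 1[ -> c <= xi <= d -> c <= v <= d ->
  (forall y, y \in `]0, 1[ -> c <= y <= d -> 0 < G y) ->
  0 < avg_op G xi v.
Proof.
move=> cG x0 v0 hx hv h.
have h11 : (-1 : R) <= 1 by lra.
have [m0 m0I hm] := EVT_min h11 (continuous_mix cG x0 v0).
apply: (@lt_le_trans _ _ (G (mix xi v m0))).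
  by apply: h; [exact: mix01|exact: mix_between].
rewrite -[leLHS]wavg_cst avg_opE; apply: wavg_le; [exact: wint_cst|exact: wint_mix|].
by move=> m mI; exact: hm.
Qed.

Lemma avg_op_lip G (L c d xi v xi' v' : R) : {in `]0, 1[, continuous G} -> 0 <= L ->
  0 < c -> d < 1 ->
  (forall y y', c <= y <= d -> c <= y' <= d -> `|G y - G y'| <= L * `|y - y'|) ->
  c <= xi <= d -> c <= v <= d -> c <= xi' <= d -> c <= v' <= d ->
  `|avg_op G xi v - avg_op G xi' v'| <= L * (`|xi - xi'| + `|v - v'|).
Proof.
move=> cG L0 c0 d1 hL hx hv hx' hv'.
have I y : c <= y <= d -> y \in `]0, 1[.
  by move=> /andP[h1 h2]; rewrite in_itv/=; apply/andP; split; lra.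
have w1 := wint_mix cG (I _ hx) (I _ hv).
have w2 := wint_mix cG (I _ hx') (I _ hv').
have w3 := wintZ (-1) w2.
have -> : avg_op G xi v - avg_op G xi' v' =
    wavg ((G \o mix xi v) \+ (fun m => -1 * (G \o mix xi' v') m)).
  by rewrite wavgD// wavgZ// mulN1r.
have key m : m \in `[-1, 1] ->
    `|G (mix xi v m) - G (mix xi' v' m)| <= L * (`|xi - xi'| + `|v - v'|).
  move=> mI; apply: (le_trans (hL _ _ (mix_between mI hx hv) (mix_between mI hx' hv'))).
  rewrite ler_wpM2l// /mix.
  have -> : (1 + m) / 2 * xi + (1 - m) / 2 * v - ((1 + m) / 2 * xi' + (1 - m) / 2 * v')
    = (1 + m) / 2 * (xi - xi') + (1 - m) / 2 * (v - v') by ring.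
  move: mI; rewrite in_itv/= => /andP[m1 m2].
  apply: (le_trans (ler_normD _ _)).
  by apply: lerD; rewrite normrM ler_piMl// ger0_norm; lra.
set B := L * _ in key *; rewrite ler_norml; apply/andP; split.
  rewrite -(wavg_cst (- B)); apply: wavg_le; [exact: wint_cst|exact: wintD|].
  by move=> m mI /=; have := key m mI; rewrite ler_norml !mulN1r => /andP[].
rewrite -[leRHS](wavg_cst B); apply: wavg_le; [exact: wintD|exact: wint_cst|].
by move=> m mI /=; have := key m mI; rewrite ler_norml !mulN1r => /andP[].
Qed.

Lemma avg_op_lin G G' (k : R) xi v : {in `]0, 1[, continuous G} ->
  {in `]0, 1[, continuous G'} -> xi \in `]0, 1[ -> v \in `]0, 1[ ->
  avg_op (fun y => G y + k * G' y) xi v = avg_op G xi v + k * avg_op G' xi v.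
Proof.
move=> cG cG' x0 v0; have w1 := wint_mix cG x0 v0; have w2 := wint_mix cG' x0 v0.
rewrite !avg_opE -wavgZ//; exact: (wavgD w1 (wintZ k w2)).
Qed.

(** Differentiation under the integral sign, dominated by a bound of [derive1 G] times the
    weight. *)
Lemma avg_op_derivable G xi v : {in `]0, 1[, continuous G} ->
  (forall y, y \in `]0, 1[ -> derivable G y 1) -> {in `]0, 1[, continuous (derive1 G)} ->
  xi \in `]0, 1[ -> v \in `]0, 1[ -> derivable (fun x => avg_op G x v) xi 1.
Proof.
move=> cG dG cG' x0 v0.
move: (x0) (v0); rewrite !in_itv/= => /andP[x1 x2] /andP[v1 v2].
(* All mixtures of [v] with a point near [xi] stay in [[c, d]], a compact part of [(0, 1)] on which
   [derive1 G] is bounded. *)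
pose c := Num.min (xi / 2) (v / 2); pose d := Num.max ((1 + xi) / 2) ((1 + v) / 2).
have c0 : 0 < c by rewrite lt_min; apply/andP; split; lra.
have d1 : d < 1 by rewrite gt_max; apply/andP; split; lra.
have cxi : c < xi by rewrite gt_min; apply/orP; left; lra.
have cv : c < v by rewrite gt_min; apply/orP; right; lra.
have dxi : xi < d by rewrite lt_max; apply/orP; left; lra.
have dv : v < d by rewrite lt_max; apply/orP; right; lra.
have cd : c <= d by lra.
have I y : c <= y <= d -> y \in `]0, 1[.
  by move=> /andP[h1 h2]; rewrite in_itv/=; apply/andP; split; lra.
have cG'' : {within `[c, d], continuous (derive1 G)}.
  by apply: continuous_in_subspaceT => y; rewrite inE/= in_itv/= => /I; exact: cG'.
have /compact_bounded [M [_ hM]] := continuous_compact cG'' (@segment_compact _ _ _).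
have {}hM y : c <= y <= d -> `|(derive1 G) y| <= `|M| + 1.
  move=> yI; apply: hM; first by rewrite (le_lt_trans (ler_norm _))// ltrDl.
  by exists y => //=; rewrite in_itv.
pose F (x m : R) : R := G (mix x v m) * abk 1 m.
have dmix (x m : R) : is_derive x 1 (fun x => mix x v m) ((1 + m) / 2).
  have := is_deriveD (is_deriveZ ((1 + m) / 2) (is_derive_id x (1 : R))) (is_derive_cst ((1 - m) / 2 * v) x (1:R)).
  by rewrite /GRing.scale/= mulr1 addr0.
have mI (x m : R) : c < x < d -> m \in `[-1, 1] -> c <= mix x v m <= d.
  by move=> /andP[h1 h2] mm; apply: mix_between => //; rewrite !ltW.
have dF (x m : R) : c < x < d -> m \in `[-1, 1] ->
    is_derive x 1 (F ^~ m) (derive1 G (mix x v m) * ((1 + m) / 2) * abk 1 m).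
  move=> xI mm.
  have dg : is_derive (mix x v m) 1 G (derive1 G (mix x v m)).
    by rewrite derive1E; apply/derivableP/dG/I/mI.
  have d2 := @is_derive1_comp _ G (fun x => mix x v m) _ _ _ dg (dmix x m).
  have := is_deriveZ (abk 1 m) d2.
  rewrite /GRing.scale/= (mulrC (abk 1 m)).
  rewrite (_ : (_ \*: _) = F ^~ m)//.
  by apply/funext => z; rewrite /F /= (mulrC _ (abk 1 m)).
rewrite (_ : (fun x => avg_op G x v) =
    ((2 * Num.sqrt 2)^-1 \*: (fun x => \int[mu]_(m in `[-1, 1]) F x m)))//.
apply: derivableZ.
apply: (@derivable_under_integral R _ _ mu F `[-1, 1]%classic _ xi c d _ _ _ (fun m => (`|M| + 1) * abk 1 m)).
- by [].
- by rewrite /= in_itv/= cxi.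
- move=> x; rewrite /= in_itv/= => /andP[cx xd]; apply: wint_mix => //.
  by apply: I; rewrite !ltW.
- move=> x m; rewrite /= in_itv/= => xI mm.
  exact: (@ex_derive _ _ _ _ _ _ _ (dF x m xI mm)).
- by move=> m; rewrite mulr_ge0 ?abk_ge0// addr_ge0.
- exact: wint_cst.
- move=> x m; rewrite /= in_itv/= => xI mm.
  rewrite partial1of2E (@derive_val _ _ _ _ _ _ _ (dF x m xI mm)).
  rewrite normrM (ger0_norm (abk_ge0 _ _)) ler_wpM2r ?abk_ge0// normrM.
  move: (mm); rewrite in_itv/= => /andP[m1 m2].
  rewrite -[leRHS]mulr1 ler_pM//; first exact/hM/mI.
  by rewrite ger0_norm; lra.
Qed.

End averages.

Section averages2.
Context {R : realType}.
Local Notation mu := (@lebesgue_measure R).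
Implicit Types (G : R -> R).

Lemma continuous_measurable_oo G (a b : R) (D : set R) : {in `]a, b[, continuous G} ->
  measurable D -> D `<=` `]a, b[ -> measurable_fun D G.
Proof.
move=> cG mD Dab.
apply: (@measurable_funS _ _ _ _ `]a, b[%classic) => //.
by apply: open_continuous_measurable_fun => // x; rewrite inE; exact: cG.
Qed.

(** The substitution [b = mix xi v m] turns the average into an Abel integral between [xi] and [v]
    whose kernel is singular at [xi]. [ka] stands for that kernel on either side, so that [xi < v]
    and [v < xi] are treated together. *)
Let avg_kernel G (xi v : R) (D : set R) (ka : R -> R) :
  {in `]0, 1[, continuous G} -> xi \in `]0, 1[ -> v \in `]0, 1[ -> xi != v ->
  measurable D -> D `<=` `]0, 1[ -> measurable_fun setT ka -> (forall b, 0 <= ka b) ->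
  (forall m, (mix xi v m \in D) = (m \in `]-1, 1[)) ->
  (forall m, m \in `]-1, 1[ -> ka (mix xi v m) = (Num.sqrt (`|v - xi| / 2))^-1 * abk 1 m) ->
  (forall b, D b -> 0 <= G b) ->
  (\int[mu]_(b in D) (G b * ka b)%:E = (2 * Num.sqrt `|v - xi| * avg_op G xi v)%:E)%E.
Proof.
move=> cG x01 v01 xv mD D01 mka ka0 hD hka G0.
have vx0 : 0 < `|v - xi| by rewrite normr_gt0 subr_eq0 eq_sym.
have w : wint (G \o mix xi v) by exact: wint_mix.
have mG : measurable_fun D (fun b => (G b * ka b)%:E).
  apply/measurable_EFinP; apply: measurable_funM; last exact: measurable_funTS.
  exact: (continuous_measurable_oo cG).
rewrite integral_mkcond.
have k0 : (xi - v) / 2 != 0 by rewrite mulf_neq0// subr_eq0.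
rewrite (ge0_integral_affine ((xi + v) / 2) k0); last 2 first.
- exact/(measurable_restrictT _ _).1.
- by move=> b; apply: erestrict_ge0 => {}b Db; rewrite lee_fin mulr_ge0// G0.
pose s := (Num.sqrt (`|v - xi| / 2))^-1.
have -> : (\int[mu]_m ((fun b => (G b * ka b)%:E) \_ D) ((xi - v) / 2 * m + (xi + v) / 2)%R =
   \int[mu]_(m in `](-1)%R, 1%R[) (s%:E * (G (mix xi v m) * abk 1 m)%:E))%E.
  rewrite [RHS]integral_mkcond; apply: eq_integral => m _.
  rewrite (_ : _ * m + _ = mix xi v m); last by rewrite /mix; field.
  rewrite !patchE hD mem_setE; case: ifPn => // mI.
  by rewrite hka// -EFinM; congr EFin; rewrite -/s; ring.
have mw : measurable_fun (`[-1, 1] : set R) (fun m : R => (G (mix xi v m) * abk 1 m)%:E).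
  exact: measurable_int w.
have mw' : measurable_fun (`]-1, 1[ : set R) (fun m : R => (s%:E * (G (mix xi v m) * abk 1 m)%:E)%E).
  apply: emeasurable_funM; first exact: measurable_cst.
  by apply: measurable_funS mw => //; exact: subset_itv_oo_cc.
rewrite (integral_itv_bndo_bndc mw').
rewrite integral_itv_obnd_cbnd; last first.
  apply: emeasurable_funM; first exact: measurable_cst.
  by apply: measurable_funS mw => //; exact: subset_itv_oc_cc.
rewrite integralZl//.
have -> : (\int[mu]_(x in `[(-1)%R, 1%R]) (G (mix xi v x) * abk 1 x)%:E =
   (\int[mu]_(x in `[-1, 1]) (G (mix xi v x) * abk 1 x))%R%:E)%E.
  by rewrite /Rintegral fineK//; exact: integrable_fin_num.
rewrite -!EFinM; congr EFin.
rewrite avg_opE /wavg /=; move: (\int[mu]_(x in _) _) => I.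
rewrite /s normrM (distrC xi) (ger0_norm (_ : 0 <= 2^-1)); last by rewrite invr_ge0.
move: (`|v - xi|) vx0 => d vx0.
have d2 : 0 < d / 2 by rewrite divr_gt0.
have -> : Num.sqrt d = Num.sqrt (d / 2) * Num.sqrt 2.
  by rewrite -sqrtrM ?mulfVK// ltW.
have a0 : Num.sqrt (d / 2) != 0 by rewrite gt_eqF// sqrtr_gt0.
rewrite -[in X in X * _](sqr_sqrtr (ltW d2)).
move: (Num.sqrt (d / 2)) a0 => a a0.
by field; rewrite a0 gt_eqF// sqrtr_gt0.
Qed.

Lemma avg_kernel_r G (p u : R) : {in `]0, 1[, continuous G} ->
  p \in `]0, 1[ -> u \in `]0, 1[ -> p < u -> (forall b, b \in `]p, u[ -> 0 <= G b) ->
  (\int[mu]_(b in `]p, u[) (G b * abk b p)%:E = (2 * Num.sqrt (u - p) * avg_op G p u)%:E)%E.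
Proof.
move=> cG p01 u01 pu G0.
have up0 : 0 < u - p by lra.
have -> : u - p = `|u - p| by rewrite gtr0_norm.
apply: avg_kernel => //.
- by rewrite lt_eqF.
- move=> b; rewrite /= !in_itv/=; move: p01 u01; rewrite !in_itv/= => /andP[? ?] /andP[? ?] /andP[? ?].
  by apply/andP; split; lra.
- exact: measurable_abk.
- by move=> b; exact: abk_ge0.
- move=> m; rewrite mem_setE !in_itv/=.
  have e1 : mix p u m - p = (1 - m) / 2 * (u - p) by rewrite /mix; field.
  have e2 : u - mix p u m = (1 + m) / 2 * (u - p) by rewrite /mix; field.
  rewrite -subr_gt0 e1 -[X in _ && X]subr_gt0 e2 !pmulr_lgt0// andbC.
  by congr (_ && _); lra.
- move=> m; rewrite in_itv/= => /andP[m1 m2].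
  rewrite gtr0_norm// /abk (_ : mix p u m - p = (u - p) / 2 * (1 - m)); last by rewrite /mix; field.
  by rewrite sqrtrM ?invfM// divr_ge0// ltW.
Qed.

Lemma avg_kernel_l G (u v : R) : {in `]0, 1[, continuous G} ->
  u \in `]0, 1[ -> v \in `]0, 1[ -> u < v -> (forall b, b \in `]u, v[ -> 0 <= G b) ->
  (\int[mu]_(b in `]u, v[) (G b * abk v b)%:E = (2 * Num.sqrt (v - u) * avg_op G v u)%:E)%E.
Proof.
move=> cG u01 v01 uv G0.
have vu0 : 0 < v - u by lra.
have -> : v - u = `|u - v| by rewrite distrC gtr0_norm.
apply: avg_kernel => //.
- by rewrite gt_eqF.
- move=> b; rewrite /= !in_itv/=; move: u01 v01; rewrite !in_itv/= => /andP[? ?] /andP[? ?] /andP[? ?].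
  by apply/andP; split; lra.
- exact: measurable_abk.
- by move=> b; exact: abk_ge0.
- move=> m; rewrite mem_setE !in_itv/=.
  have e1 : mix v u m - u = (1 + m) / 2 * (v - u) by rewrite /mix; field.
  have e2 : v - mix v u m = (1 - m) / 2 * (v - u) by rewrite /mix; field.
  rewrite -subr_gt0 e1 -[X in _ && X]subr_gt0 e2 !pmulr_lgt0//.
  by congr (_ && _); lra.
- move=> m; rewrite in_itv/= => /andP[m1 m2].
  rewrite distrC gtr0_norm// /abk (_ : v - mix v u m = (v - u) / 2 * (1 - m)); last by rewrite /mix; field.
  by rewrite sqrtrM ?invfM// divr_ge0// ltW.
Qed.

End averages2.

(** * The profile [f] and positivity of [Phi0] *)

Section profile.
Context {R : realType}.
Local Notation mu := (@lebesgue_measure R).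
Context (f : R -> R).
Hypothesis hf_smooth : smooth_on (@I01 R) f.
Hypothesis hf_neg : forall u : R, 0 < u < 1 -> derive1 f u < 0.
Hypothesis hf_0 : f u @[u --> 0^'+] --> +oo.
Hypothesis hf_1 : f u @[u --> 1^'-] --> -oo.

Lemma derivable_profile n (u : R) : u \in `]0, 1[ -> derivable (derive1n n f) u 1.
Proof. by move=> u01; apply: hf_smooth. Qed.

Lemma is_derive_profile n (u : R) : u \in `]0, 1[ ->
  is_derive u 1 (derive1n n f) (derive1n n.+1 f u).
Proof. by move=> u01; rewrite /= derive1E; apply/derivableP/derivable_profile. Qed.

Lemma continuous_profile n : {in `]0, 1[, continuous (derive1n n f)}.
Proof.
move=> u u01; apply: differentiable_continuous.
exact/derivable1_diffP/derivable_profile.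
Qed.

Lemma within_continuous_profile n (a b : R) : 0 < a -> b < 1 ->
  {within `[a, b], continuous (derive1n n f)}.
Proof.
move=> a0 b1; apply: continuous_in_subspaceT => u; rewrite inE/= in_itv/= => /andP[h1 h2].
by apply: continuous_profile; rewrite in_itv/=; apply/andP; split; lra.
Qed.

Lemma MVT_profile n (a b : R) : 0 < a -> a < b -> b < 1 ->
  exists2 c, c \in `]a, b[ & derive1n n f b - derive1n n f a = derive1n n.+1 f c * (b - a).
Proof.
move=> a0 ab b1; apply: MVT; [exact: ab| |exact: within_continuous_profile].
move=> c; rewrite in_itv/= => /andP[h1 h2]; apply: is_derive_profile.
by rewrite in_itv/=; apply/andP; split; lra.
Qed.

Lemma profile_decr (a b : R) : 0 < a -> a < b -> b < 1 -> f b < f a.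
Proof.
move=> a0 ab b1; have [c] := MVT_profile 0 a0 ab b1.
rewrite in_itv/= => /andP[h1 h2] e; rewrite -subr_lt0 e.
by rewrite pmulr_llt0 ?subr_gt0// hf_neg//; apply/andP; split; lra.
Qed.

Lemma profile_nincr (a b : R) : 0 < a -> a <= b -> b < 1 -> f b <= f a.
Proof.
by move=> a0; rewrite le_eqVlt => /predU1P[->//|ab b1]; exact/ltW/profile_decr.
Qed.

Lemma profile_large (M : R) : exists2 a, 0 < a < 1 & forall c, 0 < c <= a -> M < f c.
Proof.
have : \forall u \near 0^'+, M < f u by apply: (cvgry_gt hf_0).
rewrite near_withinE => -[e /= e0 he].
exists (Num.min (e / 2) 2^-1).
  by rewrite lt_min gt_min; apply/andP; split; [rewrite divr_gt0/=|apply/orP; right; lra].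
move=> c /andP[c0]; rewrite le_min => /andP[ce _]; apply: he => //=.
by rewrite sub0r normrN gtr0_norm//; lra.
Qed.

Lemma profile_small (M : R) : exists2 b, 0 < b < 1 & forall c, b <= c < 1 -> f c < M.
Proof.
have : \forall u \near 1^'-, f u < M by apply: (cvgrNy_lt hf_1).
rewrite near_withinE => -[e /= e0 he].
exists (Num.max (1 - e / 2) 2^-1).
  by rewrite lt_max gt_max; apply/andP; split; [apply/orP; right|apply/andP; split]; lra.
move=> c /andP[+ c1]; rewrite ge_max => /andP[ce _]; apply: he => //=.
by rewrite gtr0_norm; lra.
Qed.

Lemma HprimeE (t : R) : Hprime f t = (fun u => - (60 * t) * u + -1 * derive1 f u).
Proof. by apply/funext => u; rewrite /Hprime; ring. Qed.

Lemma is_derive_Hprime (t u : R) : u \in `]0, 1[ ->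
  is_derive u 1 (Hprime f t) (- (60 * t) - derive1n 2 f u).
Proof.
move=> u01; rewrite HprimeE.
have := is_deriveD (is_deriveZ (- (60 * t)) (is_derive_id u (1:R))) (is_deriveZ (-1 : R) (is_derive_profile 1 u01)).
by rewrite /GRing.scale/= mulr1 mulN1r.
Qed.

Lemma continuous_Hprime (t : R) : {in `]0, 1[, continuous (Hprime f t)}.
Proof.
move=> u u01; apply: differentiable_continuous; apply/derivable1_diffP.
exact: (@ex_derive _ _ _ _ _ _ _ (is_derive_Hprime t u01)).
Qed.

Lemma continuous_derive1_Hprime (t : R) : {in `]0, 1[, continuous (derive1 (Hprime f t))}.
Proof.
move=> u u01.
have : {for u, continuous (fun u => - (60 * t) - derive1n 2 f u)}.
  by apply: cvgB; [exact: cvg_cst|exact: continuous_profile].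
have u01' : u \in (`]0, 1[%classic : set R) by rewrite inE.
move=> h; rewrite /continuous_at.
rewrite derive1E (@derive_val _ _ _ _ _ _ _ (is_derive_Hprime t u01)).
apply: cvg_trans h; apply: near_eq_cvg.
near=> z.
have z01 : z \in `]0, 1[ by near: z; apply: near_in_itvoo.
by rewrite derive1E (@derive_val _ _ _ _ _ _ _ (is_derive_Hprime t z01)).
Unshelve. all: by end_near. Qed.

Lemma Phi0_derivable (t xi v : R) : xi \in `]0, 1[ -> v \in `]0, 1[ ->
  derivable (fun x => Phi0 f t x v) xi 1.
Proof.
move=> x0 v0.
apply: (@avg_op_derivable _ (Hprime f t) xi v _ _ _ x0 v0).
- exact: continuous_Hprime.
- move=> y y01; exact: (@ex_derive _ _ _ _ _ _ _ (is_derive_Hprime t y01)).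
- exact: continuous_derive1_Hprime.
Qed.

Lemma Hprime_lip (t a b : R) : 0 < a -> a <= b -> b < 1 ->
  exists2 L, 0 <= L & forall y y', a <= y <= b -> a <= y' <= b ->
    `|Hprime f t y - Hprime f t y'| <= L * `|y - y'|.
Proof.
move=> a0 ab b1.
have c2 : {within `[a, b], continuous (derive1 (Hprime f t))}.
  apply: continuous_in_subspaceT => u; rewrite inE/= in_itv/= => /andP[h1 h2].
  by apply: continuous_derive1_Hprime; rewrite in_itv/=; apply/andP; split; lra.
have /compact_bounded [M [_ hM]] := continuous_compact c2 (@segment_compact _ _ _).
exists (`|M| + 1); first by rewrite addr_ge0.
have {}hM y : a <= y <= b -> `|derive1 (Hprime f t) y| <= `|M| + 1.
  move=> yI; apply: hM; first by rewrite (le_lt_trans (ler_norm _))// ltrDl.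
  by exists y => //=; rewrite in_itv.
have key y y' : a <= y -> y < y' -> y' <= b -> `|Hprime f t y - Hprime f t y'| <= (`|M| + 1) * `|y - y'|.
  move=> h1 h2 h3.
  have [| |c] := @MVT _ (Hprime f t) (derive1 (Hprime f t)) y y' h2.
  - move=> c; rewrite in_itv/= => /andP[h4 h5].
    have c01 : c \in `]0, 1[ by rewrite in_itv/=; apply/andP; split; lra.
    by rewrite derive1E; apply/derivableP; apply: (@ex_derive _ _ _ _ _ _ _ (is_derive_Hprime t c01)).
  - apply: continuous_in_subspaceT => u; rewrite inE/= in_itv/= => /andP[h4 h5].
    by apply: continuous_Hprime; rewrite in_itv/=; apply/andP; split; lra.
  - rewrite in_itv/= => /andP[h4 h5] e.
    by rewrite distrC e normrM (distrC y) ler_wpM2r// hM//; apply/andP; split; lra.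
move=> y y' /andP[h1 h2] /andP[h3 h4].
have [h|h|->] := ltgtP y y'; first exact: key.
- by rewrite distrC (distrC y); exact: key.
- by rewrite !subrr normr0 mulr0.
Qed.

Lemma int_derive1_profile (a b : R) : 0 < a -> a < b -> b < 1 ->
  (\int[mu]_(y in `]a, b[) (- derive1 f y)%:E = (f a - f b)%:E)%E.
Proof.
move=> a0 ab b1.
have I c : c \in `]a, b[ -> c \in `]0, 1[.
  by rewrite !in_itv/= => /andP[h1 h2]; apply/andP; split; lra.
have -> : f a - f b = (- f b) - (- f a) by ring.
apply: (@ge0_FTC2_oo _ (fun y => - derive1 f y) (fun y => - f y)); first exact: ab.
- by move=> c cI; apply: cvgN; exact: (@continuous_profile 1 _ (I _ cI)).
- by move=> c /I; rewrite in_itv/= => h; rewrite oppr_ge0; exact/ltW/hf_neg.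
- apply: continuous_in_subspaceT => u; rewrite inE/= in_itv/= => /andP[h4 h5].
  by apply: cvgN; apply: (@continuous_profile 0); rewrite in_itv/=; apply/andP; split; lra.
- by move=> c cI; apply: is_deriveN; exact: (is_derive_profile 0 (I _ cI)).
Qed.

Let Phi0_pos_aux (t xi v : R) (A : R) : 0 < t -> xi \in `]0, 1[ -> v \in `]0, 1[ ->
  120 * t < A -> A / 2 <= avg_op (fun y => - derive1 f y) xi v -> 0 < Phi0 f t xi v.
Proof.
move=> t0 x01 v01 hA hav.
have cN : {in `]0, 1[, continuous (fun y => - derive1 f y)}.
  by move=> y y01; apply: cvgN; exact: (@continuous_profile 1).
have c1 : {in `]0, 1[, continuous (fun _ : R => -(60 * t))} by move=> y _; exact: cvg_cst.
have e := avg_op_lin 1 cN c1 x01 v01.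
have : avg_op (fun y => - derive1 f y + 1 * - (60 * t)) xi v <= Phi0 f t xi v.
  apply: (@avg_op_le _ _ _ _ _ 0 1) => //.
  - by move=> y y01; apply: cvgD; [exact: cN|exact: cvg_cst].
  - exact: continuous_Hprime.
  - by move: x01; rewrite in_itv/= => /andP[? ?]; rewrite !ltW.
  - by move: v01; rewrite in_itv/= => /andP[? ?]; rewrite !ltW.
  - move=> y; rewrite in_itv/= => /andP[y0 y1] _; rewrite /Hprime; nra.
by rewrite e avg_op_cst; lra.
Qed.

(** Between [xi] and [v] the Abel kernel is at least [|v - xi|^(-1/2)], so the average of [- f'] is
    at least half of [|f xi - f v|], that is, more than [60 t]. This outweighs the term [- 60 t u]
    of [Hprime]. *)
Lemma Phi0_pos (t xi v : R) : 0 < t -> xi \in `]0, 1[ -> v \in `]0, 1[ ->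
  120 * t < `|f xi - f v| -> 0 < Phi0 f t xi v.
Proof.
move=> t0 x01 v01 hA; apply: (Phi0_pos_aux t0 x01 v01 hA).
have cN : {in `]0, 1[, continuous (fun y => - derive1 f y)}.
  by move=> y y01; apply: cvgN; exact: (@continuous_profile 1).
move: (x01) (v01); rewrite !in_itv/= => /andP[x0 x1] /andP[v0 v1].
have N0 y : 0 < y < 1 -> 0 <= - derive1 f y by move=> h; rewrite oppr_ge0; exact/ltW/hf_neg.
have key (a b A : R) (ka : R -> R) : 0 < a -> a < b -> b < 1 -> measurable_fun setT ka ->
   (forall y, y \in `]a, b[ -> abk b a <= ka y) ->
   (\int[mu]_(y in `]a, b[) (- derive1 f y * ka y)%:E = (2 * Num.sqrt (b - a) * A)%:E)%E ->
   `|f a - f b| / 2 <= A.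
  move=> a0 ab b1 mka hka e.
  have h : ((abk b a)%:E * (f a - f b)%:E <= (2 * Num.sqrt (b - a) * A)%:E)%E.
    have mf : measurable_fun (`]a, b[ : set R) (fun y => - derive1 f y).
      apply: (continuous_measurable_oo cN) => // y /=.
      by rewrite !in_itv/= => /andP[h1 h2]; apply/andP; split; lra.
    have J y : y \in `]a, b[ -> 0 < y < 1.
      by rewrite in_itv/= => /andP[h1 h2]; apply/andP; split; lra.
    rewrite -int_derive1_profile// -e -ge0_integralZl//; last 3 first.
    - exact/measurable_EFinP.
    - by move=> y /J/N0; rewrite lee_fin.
    - by rewrite lee_fin abk_ge0.
    apply: ge0_le_integral => //.
    - by move=> y /J/N0 h; rewrite mule_ge0// lee_fin// abk_ge0.
    - by apply: emeasurable_funM => //; exact/measurable_EFinP.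
    - apply/measurable_EFinP; apply: measurable_funM => //.
      exact: measurable_funTS.
    - move=> y yI; rewrite -EFinM lee_fin mulrC ler_wpM2l ?hka//.
      exact/N0/J.
  move: h; rewrite -EFinM lee_fin /abk.
  have ba0 : 0 < b - a by lra.
  have s0 : 0 < Num.sqrt (b - a) by rewrite sqrtr_gt0.
  have s1 : Num.sqrt (b - a) ^+ 2 <= 1 by rewrite sqr_sqrtr ?(ltW ba0)//; lra.
  rewrite gtr0_norm ?subr_gt0 ?profile_decr//.
  have d0 : 0 < f a - f b by rewrite subr_gt0 profile_decr.
  move: (f a - f b) d0 (Num.sqrt (b - a)) s0 s1 => D D0 s s0 s1.
  rewrite mulrC ler_pdivrMr// => h.
  have : D <= 2 * A * s ^+ 2 by rewrite (le_trans h)//; lra.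
  have : 0 <= A.
    rewrite leNgt; apply/negP => A0.
    have : D <= 2 * s ^+ 2 * A by lra.
    have : 0 < s ^+ 2 by rewrite exprn_gt0.
    nra.
  nra.
have [h|h|h] := ltgtP xi v.
- apply: (key _ _ _ (fun y => abk y xi) x0 h v1); first exact: measurable_abk.
    move=> y; rewrite in_itv/= => /andP[h1 h2]; rewrite lef_pV2 ?posrE ?sqrtr_gt0; [|lra|lra].
    by rewrite ler_sqrt; lra.
  apply: avg_kernel_r => // b; rewrite in_itv/= => /andP[h1 h2].
  by apply: N0; apply/andP; split; lra.
- rewrite distrC; apply: (key _ _ _ (fun y => abk xi y) v0 h x1); first exact: measurable_abk.
    move=> y; rewrite in_itv/= => /andP[h1 h2]; rewrite lef_pV2 ?posrE ?sqrtr_gt0; [|lra|lra].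
    by rewrite ler_sqrt; lra.
  apply: avg_kernel_l => // b; rewrite in_itv/= => /andP[h1 h2].
  by apply: N0; apply/andP; split; lra.
- by move: hA; rewrite h subrr normr0; lra.
Qed.

End profile.

(** * The trailing edge *)

Lemma derive1_pos_sign (R : realType) (G : R -> R) (u : R) : derivable G u 1 -> G u = 0 ->
  0 < derive1 G u ->
  exists2 k, 0 < k & forall y, y != u -> `|y - u| < k -> 0 < (y - u) * G y.
Proof.
move=> dG Gu0 l0.
have : (fun h : R => h^-1 *: (G (h + u) - G u)) @ 0^' --> derive1 G u.
  rewrite /derive1; move: dG; rewrite /derivable => /cvg_ex[l hl].
  have e : (fun h : R => h^-1 *: (G (h *: 1 + u) - G u)) = (fun h : R => h^-1 *: (G (h + u) - G u)).
    by apply/funext => h; rewrite [h *: 1]mulr1.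
  by rewrite e in hl; apply/cvg_ex; exists l.
move=> /(cvgr_gt (derive1 G u)) /(_ _ l0).
rewrite near_withinE => -[k /= k0 hk]; exists k => // y yu yk.
have yu0 : y - u != 0 by rewrite subr_eq0.
have := hk (y - u); rewrite /= sub0r normrN => /(_ yk yu0).
rewrite subrK Gu0 subr0 /GRing.scale/= => h.
have : 0 < (y - u) ^+ 2 * ((y - u)^-1 * G y) by rewrite mulr_gt0// exprn_even_gt0.
by rewrite expr2 -mulrA mulVKf.
Qed.

(* Over an [n]-step subdivision of [[a, b]] the increments are at least [c n^{-1/2}], so that
   their sum is unbounded in [n]. *)
Lemma no_square_growth (R : realType) (y : R -> R) (k a b : R) : 0 < k -> a < b ->
  (forall s, a <= s <= b -> 0 <= y s <= 1) ->
  (forall s s', a <= s -> s < s' -> s' <= b -> y s <= y s' /\ k * (s' - s) <= (y s' - y s) ^+ 2) ->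
  False.
Proof.
move=> k0 ab y01 hy.
have c0 : 0 < k * (b - a) by rewrite mulr_gt0// subr_gt0.
pose n := (Num.truncn (k * (b - a))^-1).+1.
have hn : 1 < n%:R * (k * (b - a)).
  rewrite -ltr_pdivrMr// mul1r; exact: Num.Theory.truncnS_gt.
pose e := (b - a) / n%:R.
have n0 : 0 < n%:R :> R by rewrite ltr0n.
have e0 : 0 < e by rewrite divr_gt0// subr_gt0.
pose d := Num.sqrt (k * e).
have d0 : 0 <= d by exact: sqrtr_ge0.
have d2 : d ^+ 2 = k * e by rewrite sqr_sqrtr// ltW// mulr_gt0.
have step i : (i < n)%N -> d <= y (a + i.+1%:R * e) - y (a + i%:R * e).
  move=> ilt.
  have h1 : a + i%:R * e < a + i.+1%:R * e by rewrite ltrD2l ltr_pM2r// ltr_nat.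
  have h2 : a + i.+1%:R * e <= b.
    rewrite -lerBrDl /e mulrA ler_pdivrMr// mulrC ler_pM2l ?subr_gt0//.
    by rewrite ler_nat.
  have h0 : a <= a + i%:R * e by rewrite lerDl mulr_ge0// ltW.
  have [h3 h4] := hy _ _ h0 h1 h2.
  rewrite -(ler_pXn2r (n := 2))// ?nnegrE ?subr_ge0// d2 (le_trans _ h4)//.
  by rewrite ler_pM2l// -[i.+1]addn1 natrD; lra.
have tot i : (i <= n)%N -> i%:R * d <= y (a + i%:R * e) - y a.
  elim: i => [|i IH] ilt; first by rewrite !mul0r addr0 subrr.
  have := step i ilt; have := IH (ltnW ilt).
  rewrite -[i.+1]addn1 natrD; lra.
have := tot n (leqnn _).
rewrite (_ : a + n%:R * e = b); last by rewrite /e; field; rewrite gt_eqF.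
have := y01 b; have := y01 a; rewrite !lexx (ltW ab) => /(_ isT)/andP[h1 _] /(_ isT)/andP[_ h2] h3.
have h4 : n%:R * d <= 1 by lra.
have h5 : (n%:R * d) ^+ 2 <= 1 by rewrite expr_le1// mulr_ge0// ltW.
move: h5; rewrite exprMn d2 /e leNgt => /negP; apply.
rewrite (_ : _ ^+ 2 * _ = n%:R * (k * (b - a)))//.
by field; rewrite gt_eqF.
Qed.

Lemma lipschitz_within_continuous (R : realType) (g : R -> R) (a b L : R) : 0 <= L ->
  (forall x y, a <= x <= b -> a <= y <= b -> `|g x - g y| <= L * `|x - y|) ->
  {within `[a, b], continuous g}.
Proof.
move=> L0 hL; apply/subspace_continuousP => z; rewrite /= in_itv/= => zI.
have L1 : 0 < L + 1 by rewrite ltr_wpDl.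
apply/cvgrPdist_le => e e0; rewrite near_withinE; near=> y; rewrite /= in_itv/= => yI.
apply: (le_trans (hL _ _ zI yI)).
have : `|z - y| <= e / (L + 1).
  by near: y; apply: cvgr_dist_le; [exact: cvg_id|rewrite divr_gt0].
rewrite ler_pdivlMr//; have := normr_ge0 (z - y).
by clear; nra.
Unshelve. all: by end_near. Qed.

(** [u] is the supremum of the points at which [P] takes a nonpositive value on or below the
    diagonal. The first positivity condition keeps it away from 1, the second confines the bad [xi]
    to the compact [[x1, u]], where the uniform Lipschitz bound lets the signs pass to the limit
    from above and from below. *)
Lemma last_nonpositive (R : realType) (P : R -> R -> R) (u2 x1 b : R) :
  0 < x1 -> x1 < u2 -> u2 < b -> b < 1 ->
  (forall xi u, b <= u < 1 -> 0 < xi <= u -> 0 < P xi u) ->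
  (forall xi u, u2 <= u < 1 -> 0 < xi <= x1 -> 0 < P xi u) ->
  (forall a b, 0 < a -> a <= b -> b < 1 -> exists2 L, 0 <= L &
    forall xi u xi' u', a <= xi <= b -> a <= u <= b -> a <= xi' <= b -> a <= u' <= b ->
    `|P xi u - P xi' u'| <= L * (`|xi - xi'| + `|u - u'|)) ->
  (exists2 xi, 0 < xi <= u2 & P xi u2 < 0) ->
  exists u xi, [/\ u2 < u < 1, 0 < xi <= u, P xi u = 0,
    forall xi', 0 < xi' <= u -> 0 <= P xi' u &
    forall u' xi', u < u' < 1 -> 0 < xi' <= u' -> 0 < P xi' u'].
Proof.
move=> x10 x1u2 u2b b1 near1 near0 lip [xi2 /andP[xi20 xi22] neg].
pose B := [set u | u2 <= u < 1 /\ exists2 xi, 0 < xi <= u & P xi u <= 0].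
have Bu2 : B u2.
  by split; [rewrite lexx (lt_trans u2b)|exists xi2; [rewrite xi20|exact: ltW]].
have ubB : ubound B b.
  move=> u [/andP[u2u u1] [xi xiu Pn]]; rewrite leNgt; apply/negP => bu.
  by have := near1 xi u; rewrite (ltW bu) u1 => /(_ isT xiu); rewrite ltNge Pn.
have supB : has_sup B by split; [exists u2|exists b].
have [u [u2u ub uB adh]] : exists u, [/\ u2 <= u, u <= b,
    forall u', B u' -> u' <= u & forall m, 0 < m -> exists2 u', B u' & u - m < u'].
  exists (sup B); split.
  - by apply: ub_le_sup => //; exists b.
  - by apply: ge_sup => //; exists u2.
  - by move=> u' Bu'; apply: ub_le_sup => //; exists b.
  - by move=> m m0; have [u' ? ?] := sup_adherent m0 supB; exists u'.
have u1 : u < 1 by exact: le_lt_trans b1.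
have above u' xi' : u < u' < 1 -> 0 < xi' <= u' -> 0 < P xi' u'.
  move=> /andP[uu' u'1] xu; rewrite ltNge; apply/negP => neg'.
  have : B u' by split; [rewrite u'1 (le_trans u2u (ltW uu'))|exists xi'].
  by move=> /uB; rewrite leNgt uu'.
(* [b'] leaves room above [u] for the Lipschitz bound to apply at [u + m]. *)
pose b' := (b + 1) / 2.
have b'1 : b' < 1 by rewrite /b'; clear -b1; lra.
have bb' : b < b' by rewrite /b'; clear -b1; lra.
have x1b' : x1 <= b' by clear -x1u2 u2b bb'; lra.
have [L L0 hL] := lip _ _ x10 x1b' b'1.
have L1 : 0 < L + 1 by rewrite ltr_wpDl.
have nn xi' : 0 < xi' <= u -> 0 <= P xi' u.
  move=> /andP[h1 h2]; have [h3|h3] := leP xi' x1.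
    by apply/ltW/near0; rewrite ?h1 ?u2u.
  rewrite leNgt; apply/negP => h4.
  (* Moving from [u] to [u + m] with [m < k] cannot make this negative value positive, while above
     [u] all values are positive. *)
  pose k := - P xi' u / (L + 1).
  have k0 : 0 < k by rewrite divr_gt0// oppr_gt0.
  have hk : k * (L + 1) = - P xi' u by rewrite /k mulfVK// gt_eqF.
  have [m [m0 m1 m2]] : exists m, [/\ 0 < m, m <= k / 2 & m <= (b' - u) / 2].
    exists (Num.min (k / 2) ((b' - u) / 2)); split.
    - by rewrite lt_min; clear -ub bb' k0; apply/andP; split; lra.
    - by rewrite ge_min lexx.
    - by rewrite ge_min lexx orbT.
  have : 0 < P xi' (u + m) by apply: above; clear -h1 h2 m0 m2 b'1; apply/andP; split; lra.
  have H : `|P xi' (u + m) - P xi' u| <= L * m.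
    have e : L * m = L * (`|xi' - xi'| + `|u + m - u|).
      by rewrite subrr normr0 add0r addrAC subrr add0r gtr0_norm.
    by rewrite e; apply: hL; clear -h1 h2 h3 m0 m2 bb' ub x1u2 u2u; apply/andP; split; lra.
  have := le_trans (ler_norm _) H.
  have : L * m <= L * k by rewrite ler_wpM2l//; clear -m1 k0; lra.
  by clear -hk k0; nra.
(* The supremum is attained: otherwise the minimum over [[x1, u]] is positive and the Lipschitz
   bound carries positivity to the points of [B] close to [u]. *)
have [xi xiu Pxi] : exists2 xi, 0 < xi <= u & P xi u <= 0.
  apply: contrapT => nex.
  have pos xi : 0 < xi <= u -> 0 < P xi u.
    by move=> xiu; rewrite ltNge; apply/negP => h; apply: nex; exists xi.
  have cP : {within `[x1, u], continuous (fun xi => P xi u)}.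
    apply: (@lipschitz_within_continuous _ _ _ _ L L0) => y z /andP[y1 y2] /andP[z1 z2].
    have H : `|P y u - P z u| <= L * (`|y - z| + `|u - u|).
      by apply: hL; clear -y1 y2 z1 z2 ub bb' x1u2 u2u; apply/andP; split; lra.
    by rewrite subrr normr0 addr0 in H.
  have x1u : x1 <= u by rewrite ltW// (lt_le_trans x1u2).
  have [z zI hz] := EVT_min x1u cP.
  have z0 : 0 < P z u.
    by move: zI; rewrite in_itv/= => /andP[h1 h2]; apply: pos; rewrite h2 (lt_le_trans x10).
  pose m := P z u / (L + 1).
  have m0 : 0 < m by rewrite divr_gt0.
  have hm : m * (L + 1) = P z u by rewrite /m mulfVK// gt_eqF.
  have [u' Bu' u'm] := adh _ m0.
  have u'u : u' <= u by exact: uB.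
  have [/andP[u2u' u'1] [xi /andP[xi0 xiu'] neg']] := Bu'.
  have [h3|h3] := leP xi x1.
    by have := near0 xi u'; rewrite u2u' u'1 xi0 h3 => /(_ isT isT); rewrite ltNge neg'.
  have h4 : P z u <= P xi u by apply: hz; rewrite in_itv/= (ltW h3) (le_trans xiu').
  have H : `|P xi u - P xi u'| <= L * (`|xi - xi| + `|u - u'|).
    by apply: hL; clear -h3 xiu' u'u ub bb' u2u x1u2 u2u'; apply/andP; split; lra.
  have := le_trans (ler_norm _) H.
  rewrite subrr normr0 add0r ger0_norm ?subr_ge0//.
  by clear -h4 neg' hm m0 u'm L0; nra.
exists u, xi; split => //.
- rewrite u1 andbT lt_neqAle u2u andbT; apply/eqP => e.
  by have := nn xi2; rewrite -e xi20 xi22 => /(_ isT); rewrite leNgt neg.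
- by apply/eqP; rewrite eq_le Pxi nn.
Qed.

Section trailing.
Context {R : realType}.
Context (f : R -> R).
Hypothesis hf_smooth : smooth_on (@I01 R) f.
Hypothesis hf_neg : forall u : R, 0 < u < 1 -> derive1 f u < 0.
Hypothesis hf_0 : f u @[u --> 0^'+] --> +oo.
Hypothesis hf_1 : f u @[u --> 1^'-] --> -oo.

(** The mean value theorem on an interval of length less than 1 along which [f] drops by more than
    [|M|]. *)
Lemma steep1 (c M : R) : 0 < c < 1 -> exists2 d, c < d < 1 & derive1 f d < M.
Proof.
move=> /andP[c0 c1]; have [b /andP[b0 b1] hb] := profile_small hf_1 (f c - `|M|).
pose b' := Num.max b ((c + 1) / 2).
have b'1 : b' < 1 by rewrite gt_max b1/=; lra.
have bb' : b <= b' by rewrite le_max lexx.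
have cb' : c < b' by rewrite lt_max; apply/orP; right; lra.
have := hb b'; rewrite bb' b'1 => /(_ isT) h.
have [d] := MVT_profile hf_smooth 0 c0 cb' b'1.
rewrite in_itv/= => /andP[cd db] e; exists d; first by apply/andP; split; lra.
have := ler_norm (- M); have := normr_ge0 M; rewrite normrN => M0 M1.
have h2 : derive1 f d * (b' - c) < - `|M| by rewrite -e /=; lra.
rewrite ltNge; apply/negP => Md.
have : - `|M| <= derive1 f d by lra.
have : derive1 f d < 0 by apply: hf_neg; apply/andP; split; lra.
by move: (derive1 f d) h2 => D; nra.
Qed.

Lemma steep0 (c M : R) : 0 < c < 1 -> exists2 d, 0 < d < c & derive1 f d < M.
Proof.
move=> /andP[c0 c1]; have [b /andP[b0 b1] hb] := profile_large hf_0 (f c + `|M|).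
pose b' := Num.min b (c / 2).
have b'1 : 0 < b' by rewrite lt_min b0/=; lra.
have bb' : b' <= b by rewrite ge_min lexx.
have cb' : b' < c by rewrite gt_min; apply/orP; right; lra.
have := hb b'; rewrite bb' b'1 => /(_ isT) h.
have [d] := MVT_profile hf_smooth 0 b'1 cb' c1.
rewrite in_itv/= => /andP[cd db] e; exists d; first by apply/andP; split; lra.
have := ler_norm (- M); have := normr_ge0 M; rewrite normrN => M0 M1.
have h2 : derive1 f d * (c - b') < - `|M| by rewrite -e /=; lra.
rewrite ltNge; apply/negP => Md.
have : - `|M| <= derive1 f d by lra.
have : derive1 f d < 0 by apply: hf_neg; apply/andP; split; lra.
by move: (derive1 f d) h2 => D; nra.
Qed.

(** The derivative of [Hprime] in time is [- 60 u], between [-60] and 0 on [(0, 1)]. *)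
Lemma Phi0_anti (s t xi v : R) : s <= t -> xi \in `]0, 1[ -> v \in `]0, 1[ ->
  Phi0 f t xi v <= Phi0 f s xi v <= Phi0 f t xi v + 60 * (t - s).
Proof.
move=> st x01 v01.
have c1 : {in `]0, 1[, continuous (fun _ : R => 60 * (t - s))} by move=> y _; exact: cvg_cst.
have cH (r : R) : {in `]0, 1[, continuous (Hprime f r)} by exact: continuous_Hprime.
have hx : 0 <= xi <= 1 by move: x01; rewrite in_itv/= => /andP[? ?]; rewrite !ltW.
have hv : 0 <= v <= 1 by move: v01; rewrite in_itv/= => /andP[? ?]; rewrite !ltW.
apply/andP; split.
  apply: (avg_op_le (cH t) (cH s) x01 v01 hx hv).
  by move=> y; rewrite in_itv/= /Hprime => /andP[y0 y1] _; nra.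
have c2 : {in `]0, 1[, continuous (fun y => Hprime f t y + 1 * (60 * (t - s)))}.
  by move=> y y01; apply: cvgD; [exact: cH|exact: cvg_cst].
have -> : Phi0 f t xi v + 60 * (t - s) = avg_op (fun y => Hprime f t y + 1 * (60 * (t - s))) xi v.
  by rewrite (avg_op_lin 1 (cH t) c1 x01 v01) avg_op_cst mul1r.
apply: (avg_op_le (cH s) c2 x01 v01 hx hv).
by move=> y; rewrite in_itv/= /Hprime => /andP[y0 y1] _; nra.
Qed.

Lemma Phi0_diag (t v : R) : Phi0 f t v v = Hprime f t v.
Proof. exact: avg_op_diag. Qed.

Hypothesis hf3 : exists eps : R, 0 < eps /\
     forall u : R, 0 < u < 1 -> (u < eps \/ 1 - eps < u) -> derive1n 3 f u < 0.

(** Since [f] tends to minus infinity at 1, [f'] takes arbitrarily negative values there, so [f'']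
    is negative at some [c] in the region where [f''' < 0]. Hence beyond [c] the second derivative
    stays negative and [f'] decreases below any bound. *)
Lemma derive1_small1 (M : R) : exists2 a, 0 < a < 1 & forall y, a <= y < 1 -> derive1 f y < M.
Proof.
have [eps [eps0 h3]] := hf3.
pose c0 := Num.max (1 - eps / 2) 2^-1.
have c00 : 0 < c0 < 1 by rewrite lt_max gt_max; apply/andP; split; [apply/orP; right|apply/andP; split]; lra.
have c0e : 1 - eps < c0 by rewrite lt_max; apply/orP; left; lra.
have [d /andP[cd d1] hd] := steep1 (derive1 f c0) c00.
have c0' : 0 < c0 by case/andP: c00.
have [c] := MVT_profile hf_smooth 1 c0' cd d1.
rewrite in_itv/= => /andP[cc cd'] e.
have f2c : derive1n 2 f c < 0.
  have h : derive1n 2 f c * (d - c0) < 0 by rewrite -e subr_lt0.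
  by move: h; rewrite pmulr_llt0// subr_gt0.
have c1 : 0 < c < 1 by apply/andP; split; lra.
have f2 y : c <= y < 1 -> derive1n 2 f y < 0.
  move=> /andP[]; rewrite le_eqVlt => /predU1P[<-//|cy y1].
  have [|z] := MVT_profile hf_smooth 2 _ cy y1; first by lra.
  rewrite in_itv/= => /andP[z1 z2].
  have z01 : 0 < z < 1 by apply/andP; split; lra.
  have ze : 1 - eps < z by lra.
  have := h3 z z01 (or_intror ze).
  rewrite -[(derive1 _)^`()%classic z]/(derive1n 3 f z).
  move: (derive1n 3 f z) => D D0 e2.
  apply: lt_trans f2c; rewrite -subr_lt0 e2 pmulr_llt0// subr_gt0//.
have [a /andP[ca a1] ha] := steep1 M c1.
exists a; first by apply/andP; split; lra.
move=> y /andP[]; rewrite le_eqVlt => /predU1P[<-//|ay y1].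
have [|z] := MVT_profile hf_smooth 1 _ ay y1; first by lra.
rewrite in_itv/= => /andP[z1 z2].
have zI : c <= z < 1 by apply/andP; split; lra.
have := f2 z zI.
rewrite -[(derive1 _)^`()%classic z]/(derive1n 2 f z).
move: (derive1n 2 f z) => D D0 e2.
apply: lt_trans ha; rewrite -subr_lt0 e2 pmulr_llt0// subr_gt0//.
Qed.

(** For [xi] at some distance from 1 the drop of [f] between [xi] and [u] is large enough for
    [Phi0_pos]; for [xi] close to 1 the function [Hprime] is itself positive between [xi] and
    [u]. *)
Lemma Phi0_pos_near1 (t : R) : 0 < t -> exists2 b, 0 < b < 1 &
  forall xi u, b <= u < 1 -> 0 < xi <= u -> 0 < Phi0 f t xi u.
Proof.
move=> t0.
have [a /andP[a0 a1] ha] := derive1_small1 (- (60 * t)).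
have [b /andP[b0 b1] hb] := profile_small hf_1 (f a - 120 * t).
exists (Num.max a b); first by rewrite lt_max gt_max a0 a1 b1.
move=> xi u /andP[]; rewrite ge_max => /andP[au bu] u1 /andP[x0 xu].
have u01 : u \in `]0, 1[ by rewrite in_itv/=; apply/andP; split; lra.
have x01 : xi \in `]0, 1[ by rewrite in_itv/=; apply/andP; split; lra.
have [xa|ax] := leP xi a.
  apply: Phi0_pos => //.
  have h1 := profile_nincr hf_smooth hf_neg x0 xa a1.
  have h2 : f u < f a - 120 * t by apply: hb; rewrite bu.
  by rewrite (lt_le_trans _ (ler_norm _))//; lra.
apply: (@avg_op_gt0 _ _ _ _ a u) => //.
- exact: continuous_Hprime.
- by apply/andP; split; lra.
- by apply/andP; split; lra.
- move=> y; rewrite in_itv/= => /andP[y0 y1] /andP[ay yu].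
  have : derive1 f y < - (60 * t) by apply: ha; rewrite ay.
  by rewrite /Hprime; nra.
Qed.

Lemma Phi0_lip (t a b : R) : 0 < a -> a <= b -> b < 1 -> exists2 L, 0 <= L &
  forall xi u xi' u', a <= xi <= b -> a <= u <= b -> a <= xi' <= b -> a <= u' <= b ->
  `|Phi0 f t xi u - Phi0 f t xi' u'| <= L * (`|xi - xi'| + `|u - u'|).
Proof.
move=> a0 ab b1; have [L L0 hL] := Hprime_lip hf_smooth t a0 ab b1.
exists L => // xi u xi' u' *; apply: (@avg_op_lip _ _ _ a b) => //.
exact: continuous_Hprime.
Qed.

(** An instance of [last_nonpositive]; near [xi = 0] positivity holds because [f xi] exceeds [f u]
    by more than [120 s]. *)
Lemma worst_point (s u2 : R) : 0 < s -> 0 < u2 < 1 ->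
  (exists2 xi, 0 < xi <= u2 & Phi0 f s xi u2 < 0) ->
  exists u xi, [/\ u2 < u < 1, 0 < xi <= u, Phi0 f s xi u = 0,
    forall xi', 0 < xi' <= u -> 0 <= Phi0 f s xi' u &
    forall u' xi', u < u' < 1 -> 0 < xi' <= u' -> 0 < Phi0 f s xi' u'].
Proof.
move=> s0 /andP[u20 u21] neg.
have [b /andP[b0 b1] hb] := Phi0_pos_near1 s0.
have [x0 /andP[x00 x01'] hx0] := profile_large hf_0 (120 * s + f u2).
have b'1 : Num.max b ((u2 + 1) / 2) < 1 by rewrite gt_max b1/=; lra.
have u2b' : u2 < Num.max b ((u2 + 1) / 2) by rewrite lt_max; apply/orP; right; lra.
have x10 : 0 < Num.min x0 (u2 / 2) by rewrite lt_min x00/= divr_gt0.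
have x1u2 : Num.min x0 (u2 / 2) < u2 by rewrite gt_min; apply/orP; right; lra.
apply: (@last_nonpositive _ (fun xi u => Phi0 f s xi u) u2 _ _ x10 x1u2 u2b' b'1) => //.
- by move=> xi u; rewrite ge_max => /andP[/andP[h1 _] h2]; apply: hb; rewrite h1.
- move=> xi u' /andP[h1 h2] /andP[h3]; rewrite le_min => /andP[h4 h4'].
  have h5 : 120 * s + f u2 < f xi by apply: hx0; rewrite h3.
  have h6 := profile_nincr hf_smooth hf_neg u20 h1 h2.
  apply: Phi0_pos => //.
  - by rewrite in_itv/=; apply/andP; split=> //; lra.
  - by rewrite in_itv/=; apply/andP; split=> //; lra.
  - by rewrite (lt_le_trans _ (ler_norm _))//; lra.
- by move=> *; exact: Phi0_lip.
Qed.

End trailing.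

Lemma exists_pos_lt2 (R : realFieldType) (a b : R) : 0 < a -> 0 < b ->
  exists m, [/\ 0 < m, m < a & m < b].
Proof.
move=> a0 b0; exists (Num.min a b / 2).
have m0 : 0 < Num.min a b by rewrite lt_min a0.
have m1 : Num.min a b <= a by rewrite ge_min lexx.
have m2 : Num.min a b <= b by rewrite ge_min lexx orbT.
by move: (Num.min a b) m0 m1 m2 => m m0 m1 m2; split; lra.
Qed.

(** Strict positivity is asked only near [xi], the end where the weight is singular, because in the
    applications [G] may vanish at [v]. The Abel integrals from [xi] to [c] and from [xi] to [v]
    have the same kernel and can be compared. *)
Lemma avg_op_gt0_left (R : realType) (G : R -> R) (xi c v : R) :
  {in `]0, 1[, continuous G} -> 0 < xi -> xi < c -> c < v -> v < 1 ->
  (forall y, xi <= y <= c -> 0 < G y) -> (forall y, xi <= y <= v -> 0 <= G y) ->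
  0 < avg_op G xi v.
Proof.
move=> cG x0 xc cv v1 Gpos Gnn.
have x01 : xi \in `]0, 1[ by rewrite in_itv/= x0 (lt_trans xc (lt_trans cv v1)).
have c01 : c \in `]0, 1[ by rewrite in_itv/= (lt_trans x0) ?(lt_trans cv).
have v01 : v \in `]0, 1[ by rewrite in_itv/= v1 (lt_trans x0 (lt_trans xc cv)).
have p0 : 0 < avg_op G xi c.
  apply: (avg_op_gt0 cG x01 c01 (c := xi) (d := c)); rewrite ?lexx ?(ltW xc)//.
  by move=> y _; exact: Gpos.
have h : (\int[@lebesgue_measure R]_(b in `]xi, c[) (G b * abk b xi)%:E <=
          \int[@lebesgue_measure R]_(b in `]xi, v[) (G b * abk b xi)%:E)%E.
  apply: ge0_subset_integral => //.
  - apply/measurable_EFinP; apply: measurable_funM; last exact: measurable_abk.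
    apply: (continuous_measurable_oo cG) => // y /=; rewrite !in_itv/= => /andP[h1 h2].
    by rewrite (lt_trans x0 h1) (lt_trans h2).
  - move=> y /=; rewrite in_itv/= => /andP[h1 h2].
    by rewrite lee_fin mulr_ge0 ?abk_ge0// Gnn// !ltW.
  - by move=> y /=; rewrite !in_itv/= => /andP[-> h2]; exact: lt_trans h2 cv.
rewrite (avg_kernel_r cG x01 c01 xc) in h; last first.
  by move=> b; rewrite in_itv/= => /andP[h1 h2]; apply/ltW/Gpos; rewrite !ltW.
rewrite (avg_kernel_r cG x01 v01 (lt_trans xc cv)) in h; last first.
  by move=> b; rewrite in_itv/= => /andP[h1 h2]; apply/Gnn; rewrite !ltW.
have s1 : 0 < Num.sqrt (c - xi) by rewrite sqrtr_gt0 subr_gt0.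
have s2 : 0 < Num.sqrt (v - xi) by rewrite sqrtr_gt0 subr_gt0 (lt_trans xc).
have : 0 < 2 * Num.sqrt (v - xi) * avg_op G xi v.
  by rewrite lee_fin in h; apply: (lt_le_trans _ h); rewrite mulr_gt0// mulr_gt0.
by rewrite pmulr_rgt0// mulr_gt0.
Qed.

(** Here [D] and [D'] are the values of [f'] at [y] and [y'], [D2] is [f''] at an intermediate point
    [z], and [D3] is [f'''] between [y] and [z]. The second hypothesis includes [f''(y) = - 60 s];
    the last two say that [Hprime] vanishes at [y] at time [s] and at [y'] at time [s']. *)
Lemma second_order_identity (R : realFieldType) (s s' y y' z D D' D2 D3 : R) :
  D' - D = D2 * (y' - y) -> D2 - - (60 * s) = D3 * (z - y) ->
  - (60 * s * y) - D = 0 -> - (60 * s' * y') - D' = 0 ->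
  60 * (s' - s) * y' = - D3 * ((z - y) * (y' - y)).
Proof.
move=> h1 h2 h3 h4.
have {}h2 : D2 = D3 * (z - y) - 60 * s by lra.
by rewrite h2 in h1; lra.
Qed.

(** * Nonnegativity of [Phi0] for [u >= u1m t] *)

Section trailing_edge.
Context {R : realType}.
Context (f : R -> R).
Hypothesis hf_smooth : smooth_on (@I01 R) f.
Hypothesis hf_neg : forall u : R, 0 < u < 1 -> derive1 f u < 0.
Hypothesis hf_0 : f u @[u --> 0^'+] --> +oo.
Hypothesis hf_1 : f u @[u --> 1^'-] --> -oo.
Hypothesis hf3 : exists eps : R, 0 < eps /\
     forall u : R, 0 < u < 1 -> (u < eps \/ 1 - eps < u) -> derive1n 3 f u < 0.

(** A negative derivative of [Hprime] at [u] makes [Hprime], which is [Phi0] on the diagonal,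
    negative just above [u]. A positive one makes [Hprime] negative just below [u], hence also
    [Phi0 f s a u] for [a] just below [u]. *)
Lemma Hprime_double_zero (s u : R) : 0 < u < 1 ->
  (forall xi, 0 < xi <= u -> 0 <= Phi0 f s xi u) -> Hprime f s u = 0 ->
  (forall u' xi, u < u' < 1 -> 0 < xi <= u' -> 0 < Phi0 f s xi u') ->
  derive1n 2 f u = - (60 * s).
Proof.
move=> /andP[u0 u1] hpos Hu0 habove.
have u01 : u \in `]0, 1[ by rewrite in_itv/= u0.
have dH := is_derive_Hprime hf_smooth s u01.
have dH' : derivable (Hprime f s) u 1 by exact: (@ex_derive _ _ _ _ _ _ _ dH).
have eH : derive1 (Hprime f s) u = - (60 * s) - derive1n 2 f u.
  by rewrite derive1E (@derive_val _ _ _ _ _ _ _ dH).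
suff : derive1 (Hprime f s) u = 0.
  by rewrite eH => /eqP; rewrite subr_eq0 => /eqP.
apply/eqP/negP => /negP; rewrite neq_lt => /orP[l0|l0].
- have dN := derivableN dH'.
  have eN : derive1 (- Hprime f s) u = - derive1 (Hprime f s) u.
    by rewrite !derive1E deriveN.
  have [||k k0 hk] := derive1_pos_sign dN.
  + by rewrite /= fctE Hu0 oppr0.
  + by rewrite eN oppr_gt0.
  have u10 : 0 < 1 - u by rewrite subr_gt0.
  have [m [m0 mk mu]] := exists_pos_lt2 k0 u10.
  have mu1 : u + m < 1 by rewrite addrC -ltrBrDr.
  have := hk (u + m); rewrite addrAC subrr add0r gtr0_norm// mk gt_eqF ?ltrDl// => /(_ isT isT).
  rewrite pmulr_rgt0// fctE oppr_gt0 ltNge => /negP; apply.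
  have := habove (u + m) (u + m); rewrite ltrDl m0 mu1 lexx addr_gt0// => /(_ isT isT).
  by rewrite Phi0_diag => /ltW.
- have [k k0 hk] := derive1_pos_sign dH' Hu0 l0.
  have [m [m0 mk mu]] := exists_pos_lt2 k0 u0.
  pose a := u - m.
  have a0 : 0 < a by rewrite subr_gt0.
  have au : a < u by rewrite ltrBlDr ltrDl.
  have Hneg y : a <= y < u -> Hprime f s y < 0.
    move=> /andP[h1 h2]; have := hk y; rewrite lt_eqF// => /(_ isT).
    rewrite distrC gtr0_norm ?subr_gt0// => h.
    have : 0 < (y - u) * Hprime f s y.
      by apply: h; rewrite (le_lt_trans _ mk)// lerBlDr -lerBlDl.
    by rewrite nmulr_rgt0// subr_lt0.
  have cH : {in `]0, 1[, continuous (Hprime f s)} by exact: continuous_Hprime.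
  have c0 : {in `]0, 1[, continuous (fun _ : R => 0 : R)} by move=> y _; exact: cvg_cst.
  have cN : {in `]0, 1[, continuous (fun y => 0 + -1 * Hprime f s y)}.
    by move=> y y01; apply: cvgD; [exact: cvg_cst|apply: cvgMr; exact: cH].
  have a01 : a \in `]0, 1[ by rewrite in_itv/= a0 (lt_trans au).
  have : 0 < avg_op (fun y => 0 + -1 * Hprime f s y) a u.
    have am : a < a + m / 2 by rewrite ltrDl divr_gt0.
    have mu' : a + m / 2 < u by rewrite /a -addrA gtrDl addrC subr_lt0 ltr_pdivrMr// ltr_pMr// ltr1n.
    apply: (avg_op_gt0_left cN a0 am mu' u1) => y /andP[h1 h2].
      by rewrite add0r mulN1r oppr_gt0 Hneg// h1 (le_lt_trans h2).
    rewrite add0r mulN1r oppr_ge0; move: h2; rewrite le_eqVlt => /predU1P[->|h2].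
      by rewrite Hu0.
    by apply/ltW/Hneg; rewrite h1.
  rewrite (avg_op_lin _ c0 cH a01 u01) avg_op_cst add0r mulN1r oppr_gt0 ltNge.
  by move=> /negP; apply; apply: hpos; rewrite a0 ltW.
Qed.

Context (Tm : R) (u1m u3m xm : R -> R).
Hypothesis hTm : 0 < Tm.
Hypothesis hm_sol : forall t : R, Tm < t ->
     0 < u3m t /\ u3m t < u1m t /\ u1m t < 1 /\
     trailing_sys f t (u1m t) (u3m t) (xm t).
Hypothesis hm_uniq : forall t u1 u3 x : R, Tm < t -> 0 < u3 -> u3 < u1 -> u1 < 1 ->
     trailing_sys f t u1 u3 x -> u1 = u1m t /\ u3 = u3m t /\ x = xm t.
Hypothesis hm_incr : forall s t : R, Tm < s -> s < t -> u1m s < u1m t.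

(** An interior zero of a nonnegative function is a minimum, so the derivative vanishes there too.
    The third equation defines [x]. *)
Lemma trailing_sys_min (t u xi : R) : 0 < xi -> xi < u -> u < 1 ->
  (forall xi', 0 < xi' <= u -> 0 <= Phi0 f t xi' u) -> Phi0 f t xi u = 0 ->
  trailing_sys f t u xi (30 * t * u ^+ 2 + f u).
Proof.
move=> x0 xu u1 hpos hz; split => //; last by ring.
have u0 : 0 < u by exact: lt_trans xu.
have : is_derive xi 1 (fun xi => Phi0 f t xi u) 0.
  apply: (@derive1_at_min _ _ 0 u).
  - exact: ltW.
  - move=> y; rewrite in_itv/= => /andP[y0 yu]; apply: Phi0_derivable => //.
      by rewrite in_itv/= y0 (lt_trans yu).
    by rewrite in_itv/= u0.
  - by rewrite in_itv/= x0.
  - by move=> y; rewrite in_itv/= => /andP[y0 yu]; rewrite hz hpos// y0 ltW.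
by move=> d; rewrite derive1E (@derive_val _ _ _ _ _ _ _ d).
Qed.

(** Taylor expansion at the double zero [y]: the first-order terms cancel, so a time step [s' - s]
    costs a square of [y' - y]. *)
Lemma degenerate_growth (y y' s s' M u2 : R) : 0 < u2 -> u2 <= y -> y <= y' -> y' < 1 -> s < s' -> 0 <= M ->
  (forall c, y <= c <= y' -> `|derive1n 3 f c| <= M) ->
  Hprime f s y = 0 -> Hprime f s' y' = 0 -> derive1n 2 f y = - (60 * s) ->
  60 * u2 / (M + 1) * (s' - s) <= (y' - y) ^+ 2.
Proof.
move=> u20 u2y yy' y'1 ss' M0 hM e1 e2 e3.
have y0 : 0 < y by exact: lt_le_trans u2y.
have M1 : 0 < M + 1 by rewrite ltr_wpDl.
have {}yy' : y < y'.
  rewrite lt_neqAle yy' andbT; apply/eqP => e; move: e1 e2; rewrite -e /Hprime => h1 h2.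
  have : 60 * (s' - s) * y = 0 by lra.
  by apply/eqP; rewrite gt_eqF// !mulr_gt0// subr_gt0.
have [z] := MVT_profile hf_smooth 1 y0 yy' y'1.
rewrite in_itv/= => /andP[yz zy'] h1.
have z1 : z < 1 by exact: lt_trans y'1.
have [w] := MVT_profile hf_smooth 2 y0 yz z1.
rewrite in_itv/= => /andP[yw wz] h2.
have hw : `|derive1n 3 f w| <= M by apply: hM; rewrite !ltW// (lt_trans wz).
have h1' : derive1 f y' - derive1 f y = derive1n 2 f z * (y' - y) by exact: h1.
have h2' : derive1n 2 f z - derive1n 2 f y = derive1n 3 f w * (z - y) by exact: h2.
rewrite e3 in h2'; move: e1 e2; rewrite /Hprime => e1 e2.
have e := second_order_identity h1' h2' e1 e2.
set D3 := derive1n 3 f w in hw e.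
have h3 : - D3 * ((z - y) * (y' - y)) <= M * ((y' - y) * (y' - y)).
  apply: (@le_trans _ _ (M * ((z - y) * (y' - y)))).
    rewrite ler_wpM2r//; first by rewrite mulr_ge0// subr_ge0 ltW.
    by rewrite (le_trans _ hw)// -normrN; exact: ler_norm.
  by rewrite ler_wpM2l// ler_wpM2r ?subr_ge0 ?(ltW yy')// lerD2r ltW.
have h4 : 60 * u2 * (s' - s) <= 60 * (s' - s) * y'.
  rewrite mulrAC ler_wpM2l ?mulr_ge0 ?subr_ge0 ?(ltW ss')//.
  by rewrite (le_trans u2y)// ltW.
rewrite mulrAC ler_pdivrMr// expr2.
have h5 : 0 <= (y' - y) * (y' - y) by rewrite mulr_ge0// subr_ge0 ltW.
by apply: (le_trans h4); rewrite e; apply: (le_trans h3); rewrite mulrC ler_wpM2l// lerDl.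
Qed.

(* Otherwise, for every [s] in some interval [[t - m, t]], let [y s] be the largest [u] for which
   [Phi0 f s (.) u] takes a nonpositive value.  Its minimum there is [0]; a zero off the
   diagonal would solve the trailing edge system with [u1m s < y s], so the zero is on the
   diagonal, [Hprime f s] has a double zero at [y s], and [y] increases too steeply to stay
   in [(0, 1)]. *)
Lemma Phi0_ge0_trailing (t u xi : R) : Tm < t -> u1m t <= u -> u < 1 -> 0 < xi -> xi <= u ->
  0 <= Phi0 f t xi u.
Proof.
move=> Tt u1u u1 x0 xu; rewrite leNgt; apply/negP => neg.
have u0 : 0 < u by exact: lt_le_trans xu.
have u01 : u \in `]0, 1[ by rewrite in_itv/= u0.
have x01 : xi \in `]0, 1[ by rewrite in_itv/= x0 (le_lt_trans xu).
have p0 : 0 < - Phi0 f t xi u / 60 by rewrite divr_gt0// oppr_gt0.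
have Tt0 : 0 < t - Tm by rewrite subr_gt0.
(* [Phi0] grows by at most [60 m] when time goes back by [m], so the negative value at [(xi, u)]
   survives on [[t - m, t]], all of it beyond [Tm]. *)
have [m [m0 mP mT]] := exists_pos_lt2 p0 Tt0.
have neg' s : t - m <= s <= t -> exists2 xi, 0 < xi <= u & Phi0 f s xi u < 0.
  move=> /andP[ts st]; exists xi; first by rewrite x0.
  have /andP[_ h] := Phi0_anti hf_smooth st x01 u01.
  apply: (le_lt_trans h).
  rewrite -[ltRHS](subrr (Phi0 f t xi u)) ltrD2l mulrC -ltr_pdivlMr//.
  by rewrite (le_lt_trans _ mP)// lerBlDr -lerBlDl.
have pos s : t - m <= s <= t -> 0 < s /\ Tm < s.
  move=> /andP[ts _]; have : Tm < s by rewrite (lt_le_trans _ ts)// ltrBrDl -ltrBrDr.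
  by move=> h; split => //; exact: lt_trans h.
pose good s y := [/\ u < y < 1, Hprime f s y = 0, derive1n 2 f y = - (60 * s),
  (exists2 z, 0 < z <= y & Phi0 f s z y <= 0) &
  (forall u' xi', y < u' < 1 -> 0 < xi' <= u' -> 0 < Phi0 f s xi' u')].
have /choice[y hy] : forall s, exists y, t - m <= s <= t -> good s y.
  move=> s; have [sI|?] := boolP (t - m <= s <= t); last by exists 0.
  have [s0 Ts] := pos s sI.
  have uu : 0 < u < 1 by rewrite u0.
  have [y [z [/andP[uy y1] /andP[z0 zy] Pz Pn Pp]]] := worst_point hf_smooth hf_neg hf_0 hf_1 hf3 s0 uu (neg' s sI).
  exists y => _.
  have y0 : 0 < y by exact: lt_trans uy.
  have zE : z = y.
    apply/eqP; rewrite eq_le zy/= leNgt; apply/negP => zy'.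
    have [h1 _] := hm_uniq Ts z0 zy' y1 (trailing_sys_min z0 zy' y1 Pn Pz).
    move: uy; rewrite ltNge => /negP; apply; rewrite h1 (le_trans _ u1u)//.
    have /andP[_] := sI; rewrite le_eqVlt => /predU1P[->//|st].
    exact/ltW/hm_incr.
  have H0 : Hprime f s y = 0 by rewrite -Phi0_diag -[X in Phi0 f s X y]zE.
  split => //; first by rewrite uy.
  - by apply: Hprime_double_zero => //; rewrite y0.
  - by exists z; [rewrite z0|rewrite Pz].
have tI : t - m <= t <= t by rewrite lexx andbT lerBlDr lerDl ltW.
(* [Phi0] is nonincreasing in time, so the nonpositive value at level [y s] is still there at time
   [s'], and above [y s'] there is none. *)
have mono s s' : t - m <= s -> s <= s' -> s' <= t -> y s <= y s'.
  move=> h1 h2 h3.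
  have sI : t - m <= s <= t by rewrite h1 (le_trans h2).
  have s'I : t - m <= s' <= t by rewrite h3 (le_trans h1).
  have [/andP[uy y1] _ _ [z /andP[z0 zy] Pz] _] := hy s sI.
  have [_ _ _ _ Pp] := hy s' s'I.
  rewrite leNgt; apply/negP => lt.
  have := Pp (y s) z; rewrite lt y1 z0 zy => /(_ isT isT); rewrite ltNge => /negP; apply.
  have z01 : z \in `]0, 1[ by rewrite in_itv/= z0 (le_lt_trans zy).
  have y01 : y s \in `]0, 1[ by rewrite in_itv/= y1 andbT (lt_trans u0).
  by have /andP[h _] := Phi0_anti hf_smooth h2 z01 y01; exact: le_trans h Pz.
have [/andP[uyt yt1] _ _ _ _] := hy t tI.
have c3 : {within `[u, y t], continuous (derive1n 3 f)} by exact: within_continuous_profile.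
have /compact_bounded [M [_ hM]] := continuous_compact c3 (@segment_compact _ _ _).
have {}hM c : u <= c <= y t -> `|derive1n 3 f c| <= `|M| + 1.
  move=> cI; apply: hM; first by rewrite (le_lt_trans (ler_norm _))// ltrDl.
  by exists c => //=; rewrite in_itv.
have M0 : 0 <= `|M| + 1 by rewrite addr_ge0.
have k0 : 0 < 60 * u / (`|M| + 1 + 1) by rewrite divr_gt0 ?mulr_gt0// ltr_wpDl.
have tm : t - m < t by rewrite ltrBlDr ltrDl.
apply: (no_square_growth k0 tm (y := y)).
- move=> s sI; have [/andP[uy y1] _ _ _ _] := hy s sI.
  by rewrite (ltW y1) ltW// (lt_trans u0).
- move=> s s' h1 h2 h3.
  have sI : t - m <= s <= t by rewrite h1 (le_trans (ltW h2)).
  have s'I : t - m <= s' <= t by rewrite h3 (le_trans h1 (ltW h2)).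
  have yy := mono _ _ h1 (ltW h2) h3; split => //.
  have [/andP[uy y1] H1 D1 _ _] := hy s sI.
  have [/andP[uy' y1'] H1' _ _ _] := hy s' s'I.
  apply: degenerate_growth => //; first exact: ltW.
  move=> c /andP[c1 c2]; apply: hM; rewrite (le_trans (ltW uy) c1) (le_trans c2)//.
  by apply: mono => //; rewrite (le_trans h1 (ltW h2)).
Qed.

(** [30 t u^2 + f u] equals [xm t >= x] at [u1m t] and tends to minus infinity at 1, so it takes the
    value [x]. A zero of [Phi0] below the diagonal solves the trailing edge system, which leaves
    [u3m t] as the only possible exception [z]. *)
Lemma good_trailing (t x : R) : Tm < t -> x <= xm t -> exists u, [/\ 0 < u < 1,
  x - 30 * t * u ^+ 2 - f u = 0,
  forall xi, 0 < xi < u -> 0 <= Phi0 f t xi u,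
  exists z, forall xi, 0 < xi < u -> xi != z -> 0 < Phi0 f t xi u &
  forall c, u <= c < 1 -> 0 <= Hprime f t c].
Proof.
move=> Tt xxm.
have t0 : 0 < t by exact: lt_trans Tt.
have [h1 [h2 [h3 [_ _ h4]]]] := hm_sol Tt.
have u1m0 : 0 < u1m t by exact: lt_trans h2.
have [b /andP[b0 b1] hb] := profile_small hf_1 (x - 30 * t).
pose c := Num.max b (u1m t).
have c1 : c < 1 by rewrite gt_max b1.
have uc : u1m t <= c by rewrite le_max lexx orbT.
have c0 : 0 < c by exact: lt_le_trans uc.
pose g u := 30 * t * u ^+ 2 + f u.
have cg : {within `[u1m t, c], continuous g}.
  apply: continuous_in_subspaceT => u; rewrite inE/= in_itv/= => /andP[k1 k2].
  apply: cvgD; first by apply: cvgMr; exact: exprn_continuous.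
  by apply: (@continuous_profile _ _ hf_smooth 0); rewrite in_itv/= (lt_le_trans u1m0)// (le_lt_trans k2).
have gc : g c <= x.
  have : f c < x - 30 * t by apply: hb; rewrite c1 le_max lexx.
  have : 30 * t * c ^+ 2 <= 30 * t.
    by rewrite ger_pMr ?mulr_gt0// expr_le1// ltW.
  by rewrite /g; lra.
have gu : x <= g (u1m t) by rewrite /g; lra.
have gx : Num.min (g (u1m t)) (g c) <= x <= Num.max (g (u1m t)) (g c).
  by rewrite ge_min le_max gc gu orbT.
have [u] := IVT uc cg gx.
rewrite in_itv/= => /andP[k1 k2] gu'.
have u0 : 0 < u by exact: lt_le_trans k1.
have u1 : u < 1 by exact: le_lt_trans c1.
have nn xi : 0 < xi <= u -> 0 <= Phi0 f t xi u.
  by move=> /andP[x0 xu]; exact: Phi0_ge0_trailing.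
exists u; split.
- by rewrite u0.
- by rewrite -gu' /g; ring.
- by move=> xi /andP[x0 xu]; apply: nn; rewrite x0 ltW.
- exists (u3m t) => xi /andP[x0 xu] xz; rewrite lt_neqAle nn ?x0 ?(ltW xu)// andbT.
  apply/eqP => e; have [_ [e3 _]] := hm_uniq Tt x0 xu u1 (trailing_sys_min x0 xu u1 nn (esym e)).
  by rewrite e3 eqxx in xz.
- move=> y /andP[uy y1]; rewrite -Phi0_diag; apply: Phi0_ge0_trailing => //.
    exact: le_trans uy.
  exact: lt_le_trans uy.
Qed.

End trailing_edge.

(** * The leading edge *)

Section abel_double.
Context {R : realType}.
Local Notation mu := (@lebesgue_measure R).

Lemma integral_shrink (D E : set R) (g : R -> \bar R) : E `<=` D ->
  (forall x, D x -> ~ E x -> g x = 0%E) ->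
  (\int[mu]_(x in D) g x = \int[mu]_(x in E) g x)%E.
Proof.
move=> ED g0; rewrite integral_mkcond [RHS]integral_mkcond.
apply: eq_integral => x _; rewrite !patchE.
case: ifPn => [/set_mem xD|/negP xD]; case: ifPn => [/set_mem xE|/negP xE] //.
- by apply: g0 => // /mem_set.
- by case: xD; apply/mem_set/ED.
Qed.

Lemma EFin_Rintegral (D : set R) (h : R -> R) : measurable D ->
  mu.-integrable D (EFin \o h) ->
  ((\int[mu]_(x in D) h x)%R%:E = \int[mu]_(x in D) (h x)%:E)%E.
Proof. by move=> mD ih; rewrite /Rintegral fineK//; exact: integrable_fin_num. Qed.

(** Tonelli: the kernel integrated over [y] in [(b, v)] gives [2 sqrt (v - b)]. *)
Lemma int_abel_avg (G : R -> R) (u v : R) : u < v ->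
  measurable_fun (`]u, v[ : set R) G -> (forall b, b \in `]u, v[ -> 0 <= G b) ->
  (\int[mu]_(y in `]u, v[) \int[mu]_(b in `]u, y[) (G b * abk y b)%:E =
   \int[mu]_(b in `]u, v[) (G b * (2 * Num.sqrt (v - b)))%:E)%E.
Proof.
move=> uv mG G0.
pose F (z : R * R) : \bar R := (G z.2 * abk z.1 z.2)%:E.
have mF : measurable_fun (`]u, v[ `*` `]u, v[) F.
  apply/measurable_EFinP; apply: measurable_funM; last first.
    by apply: measurable_abk; apply: measurable_funTS.
  apply: (measurable_comp (F := `]u, v[%classic)) => //.
    by move=> _ [z [z1 z2] <-].
  by apply: measurable_funTS.
have F0 z : (`]u, v[ `*` `]u, v[) z -> (0 <= F z)%E.
  by move=> [z1 z2]; rewrite lee_fin mulr_ge0 ?abk_ge0// G0.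
transitivity (\int[mu]_(y in `]u, v[) \int[mu]_(b in `]u, v[) F (y, b))%E.
  apply: eq_integral => y; rewrite inE/= in_itv/= => /andP[uy yv].
  apply/esym/integral_shrink => [b|b].
    by rewrite /= !in_itv/= => /andP[-> h]; exact: lt_trans yv.
  rewrite /= !in_itv/= => /andP[-> bv] /= /negP; rewrite -leNgt => yb.
  by rewrite /F/= abk_le0// mulr0.
rewrite (tonelli_set _ _ mF F0)//.
apply: eq_integral => b; rewrite inE/= in_itv/= => /andP[ub bv].
rewrite (@integral_shrink _ `]b, v[%classic); last 2 first.
- by move=> y; rewrite /= !in_itv/= => /andP[h ->]; rewrite (lt_trans ub).
- move=> y; rewrite /= !in_itv/= => /andP[uy ->]; rewrite andbT => /negP; rewrite -leNgt => yb.
  by rewrite /F/= abk_le0// mulr0.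
rewrite EFinM -int_abk_l// -ge0_integralZl//.
- by apply/measurable_EFinP; exact: measurable_abk.
- by move=> y _; rewrite lee_fin abk_ge0.
- by rewrite lee_fin G0// in_itv/= ub.
Qed.

(** The kernel integrated in its other variable gives the same [2 sqrt (v - b)] as in
    [int_abel_avg]. The common right-hand side links the function of the leading edge system to the
    Abel integral of the hodograph function. *)
Lemma int_abel_primitive (G : R -> R) (u v : R) : u < v ->
  measurable_fun (`]u, v[ : set R) G -> (forall b, b \in `]u, v[ -> 0 <= G b) ->
  (\int[mu]_(c in `]u, v[) ((\int[mu]_(b in `]u, c[) (G b)%:E) * (abk v c)%:E) =
   \int[mu]_(b in `]u, v[) (G b * (2 * Num.sqrt (v - b)))%:E)%E.
Proof.
move=> uv mG G0.
pose F (z : R * R) : \bar R := (G z.2 * ((z.2 < z.1)%R%:R * abk v z.1))%:E.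
have mF : measurable_fun (`]u, v[ `*` `]u, v[) F.
  apply/measurable_EFinP; apply: measurable_funM.
    apply: (measurable_comp (F := `]u, v[%classic)) => //.
      by move=> _ [z [z1 z2] <-].
    by apply: measurable_funTS.
  apply: measurable_funTS; apply: measurable_funM; last exact: measurable_abk.
  rewrite (_ : (fun z : R * R => _) = (fun z => if (z.2 < z.1)%R then 1 else 0)); last first.
    by apply/funext => z; case: ifP.
  apply: measurable_fun_ifT => //.
  by apply: measurable_fun_ltr.
have F0 z : (`]u, v[ `*` `]u, v[) z -> (0 <= F z)%E.
  by move=> [z1 z2]; rewrite lee_fin !mulr_ge0 ?abk_ge0// G0.
transitivity (\int[mu]_(y in `]u, v[) \int[mu]_(b in `]u, v[) F (y, b))%E.
  apply: eq_integral => y; rewrite inE/= in_itv/= => /andP[uy yv].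
  rewrite [RHS](@integral_shrink _ `]u, y[%classic); last 2 first.
  - by move=> b; rewrite /= !in_itv/= => /andP[-> h]; exact: lt_trans yv.
  - move=> b; rewrite /= !in_itv/= => /andP[-> bv] /= /negP; rewrite -leNgt => yb.
    by rewrite /F/= ltNge yb mul0r mulr0.
  rewrite -ge0_integralZr//.
  - apply: eq_integral => b; rewrite inE/= in_itv/= => /andP[ub b_y].
    by rewrite /F/= b_y mul1r EFinM.
  - apply/measurable_EFinP; apply: measurable_funS mG => //.
    by move=> b; rewrite /= !in_itv/= => /andP[-> h]; exact: lt_trans yv.
  - move=> b; rewrite /= in_itv/= => /andP[ub b_y]; rewrite lee_fin G0//.
    by rewrite in_itv/= ub (lt_trans b_y).
  - by rewrite lee_fin abk_ge0.
rewrite (tonelli_set _ _ mF F0)//.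
apply: eq_integral => b; rewrite inE/= in_itv/= => /andP[ub bv].
rewrite (@integral_shrink _ `]b, v[%classic); last 2 first.
- by move=> y; rewrite /= !in_itv/= => /andP[h ->]; rewrite (lt_trans ub).
- move=> y; rewrite /= !in_itv/= => /andP[uy ->]; rewrite andbT => /negP; rewrite -leNgt => yb.
  by rewrite /F/= ltNge yb mul0r mulr0.
rewrite EFinM -int_abk_r// -ge0_integralZl//.
- apply: eq_integral => y; rewrite inE/= in_itv/= => /andP[b_y _].
  by rewrite /F/= b_y mul1r EFinM.
- by apply/measurable_EFinP; exact: measurable_abk.
- by move=> y _; rewrite lee_fin abk_ge0.
- by rewrite lee_fin G0// in_itv/= ub.
Qed.

End abel_double.

(* [u] is the supremum of the points below which [j (.) u] is nonnegative: there the minimum of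
   [j (.) u] over [v] is still nonnegative, and it vanishes. *)
Lemma first_negative (R : realType) (j : R -> R -> R) (Hp : R -> R) (a u2 vb d2 M : R) :
  0 < a -> a < u2 -> u2 < vb -> vb < 1 -> u2 < d2 -> d2 <= 1 -> 0 <= M ->
  (forall u v, 0 < u -> u <= a -> u < v -> v < 1 -> 0 <= j v u) ->
  (forall u v, 0 < u -> u <= u2 -> vb <= v -> v < 1 -> j vb u <= j v u) ->
  (forall u u' v, a <= u -> u <= u' -> u' <= u2 -> u' < v -> v < 1 ->
     `|j v u - j v u'| <= M * (u' - u)) ->
  (forall u c, 0 < u -> u < c -> {within `[c, vb], continuous (j ^~ u)}) ->
  (forall u v, 0 < u -> u <= u2 -> u < v -> v < 1 -> (forall b, u < b < v -> 0 < Hp b) -> 0 <= j v u) ->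
  (forall u v, 0 < u -> u <= u2 -> u < v -> v < 1 -> (forall b, u < b <= v -> Hp b < 0) -> j v u < 0) ->
  (forall b b', 0 < b -> b < b' -> b' < d2 -> Hp b' < Hp b) ->
  (forall b, 0 < b < 1 -> {for b, continuous Hp}) ->
  (exists2 v, u2 < v < 1 & j v u2 < 0) ->
  exists u v, [/\ 0 < u < u2, u < v < 1, j v u = 0 & forall v', u < v' < 1 -> 0 <= j v' u].
Proof.
move=> a0 au2 u2vb vb1 u2d d21 M0 small mono lip cont pos neg decr cHp [v2 /andP[u2v2 v21] bad].
pose S := [set u | 0 < u <= u2 /\ forall u' v, 0 < u' <= u -> u' < v < 1 -> 0 <= j v u'].
have Sa : S a.
  split; first by rewrite a0 ltW.
  by move=> u' v /andP[u'0 u'a] /andP[uv v1]; exact: small.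
have ubS : ubound S u2 by move=> u [/andP[_ ->]].
have supS : has_sup S by split; [exists a|exists u2].
have [u [au uu2 uS adh]] : exists u, [/\ a <= u, u <= u2,
    forall u', S u' -> u' <= u & forall m, 0 < m -> exists2 u', S u' & u - m < u'].
  exists (sup S); split.
  - by apply: ub_le_sup => //; exists u2.
  - by apply: ge_sup => //; exists a.
  - by move=> u' Su'; apply: ub_le_sup => //; exists u2.
  - by move=> m m0; have [u' ? ?] := sup_adherent m0 supS; exists u'.
have u0 : 0 < u by exact: lt_le_trans au.
have M1 : 0 < M + 1 by rewrite ltr_wpDl.
have nn v : u < v < 1 -> 0 <= j v u.
  move=> /andP[uv v1]; rewrite leNgt; apply/negP => jn.
  have k0 : 0 < - j v u / (M + 1) by rewrite divr_gt0// oppr_gt0.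
  have ka : 0 < a by [].
  have [m [m0 mk ma]] := exists_pos_lt2 k0 ka.
  have [u' [/andP[u'0 u'u2] hS] u'm] := adh _ m0.
  have u'u : u' <= u by apply: uS; split => //; rewrite u'0.
  pose w := Num.max u' a.
  have wu : w <= u by rewrite ge_max u'u.
  have aw : a <= w by rewrite le_max lexx orbT.
  have w0 : 0 < w by exact: lt_le_trans aw.
  have u'w : u' <= w by rewrite le_max lexx.
  have jw : 0 <= j v w.
    have [h|h] := leP u' a.
      have -> : w = a by rewrite /w max_r.
      by apply: small => //; exact: le_lt_trans uv.
    have -> : w = u' by rewrite /w max_l// ltW.
    by apply: hS; [rewrite u'0 lexx|rewrite v1 (le_lt_trans u'u)].
  have H := lip w u v aw wu uu2 uv v1.
  have h1 := le_trans (ler_norm _) H.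
  have h2 : M * (u - w) <= M * m.
    by rewrite ler_wpM2l//; clear -u'm u'w; lra.
  move: mk; rewrite ltr_pdivlMr// => mk.
  clear -jw jn h1 h2 mk m0 M0; nra.
have ultu2 : u < u2.
  rewrite lt_neqAle uu2 andbT; apply/eqP => e.
  by have := nn v2; rewrite e u2v2 v21 => /(_ isT); rewrite leNgt bad.
(* Otherwise [Hp], decreasing below [d2], is negative on [(u, u2]], and so is [j u2 u]. *)
have Hu : 0 < Hp u.
  rewrite ltNge; apply/negP => Hu.
  have : j u2 u < 0.
    apply: neg => //; first exact: lt_trans vb1.
    move=> b /andP[ub bu2]; apply: lt_le_trans Hu; apply: decr => //.
    exact: le_lt_trans u2d.
  by rewrite ltNge nn// ultu2 (lt_trans u2vb).
have u1 : u < 1 by exact: lt_trans (lt_trans u2vb vb1).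
have [k k0 hk] : exists2 k, 0 < k & forall b, u <= b < u + k -> 0 < Hp b.
  have /cHp c : 0 < u < 1 by rewrite u0.
  have /cvgrPdist_lt /(_ _ Hu)[k /= k0 hk] := c.
  exists k => // b /andP[ub bk].
  have := hk b; rewrite /= ler0_norm ?subr_le0// opprB ltrBlDl => /(_ bk).
  by move=> h; have := le_lt_trans (ler_norm _) h; rewrite gtrBl.
have uu20 : 0 < u2 - u by rewrite subr_gt0.
have [l [l0 lk lu]] := exists_pos_lt2 k0 uu20.
have lvb : u + l < vb by apply: lt_trans u2vb; rewrite -ltrBrDl.
have [v [/andP[uv v1] jv]] : exists v, u < v < 1 /\ j v u <= 0.
  (* If [j (.) u] had no zero, [u + m] would still belong to [S]: close to the diagonal [j >= 0]
     because [Hp > 0], on [[u + l, vb]] by the minimum and the Lipschitz bound, and beyond [vb] by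
     comparison with [vb]. *)
  apply: contrapT => nex.
  have jpos v : u < v < 1 -> 0 < j v u.
    by move=> uv; rewrite ltNge; apply/negP => h; apply: nex; exists v.
  have ul : u < u + l by rewrite ltrDl.
  have [z zI hz] := EVT_min (ltW lvb) (cont _ _ u0 ul).
  have z0 : 0 < j z u.
    move: zI; rewrite in_itv/= => /andP[z1 z2]; apply: jpos.
    by rewrite (lt_le_trans ul) ?(le_lt_trans z2).
  have mm0 : 0 < j z u / (M + 1) by rewrite divr_gt0.
  have [m [m0 mM ml]] := exists_pos_lt2 mm0 l0.
  have : S (u + m).
    split; first by rewrite addr_gt0//= -lerBrDl ltW// (lt_trans ml).
    move=> u' v /andP[u'0 u'um] /andP[u'v v1].
    have [u'u|uu'] := leP u' u.
      have [u'u2|] := ltP u' u; last first.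
        move=> h; have e : u' = u by apply/eqP; rewrite eq_le u'u h.
        by rewrite e; apply: nn; rewrite -e u'v.
      have m0' : 0 < u - u' by rewrite subr_gt0.
      have [u'' [_ hS]] := adh _ m0'.
      by rewrite opprB addrC subrK => /ltW h; apply: hS; rewrite ?u'0 ?h// u'v.
    have u'u2 : u' <= u2.
      by rewrite (le_trans u'um)// -lerBrDl ltW// (lt_trans ml).
    have inner v' : u + l <= v' <= vb -> 0 <= j v' u'.
      move=> /andP[h1 h2].
      have h3 : u' < v' by apply: le_lt_trans u'um _; rewrite (lt_le_trans _ h1)// ltrD2l.
      have H := lip u u' v' au (ltW uu') u'u2 h3 (le_lt_trans h2 vb1).
      have H2 : j z u <= j v' u by apply: hz; rewrite in_itv/= h1.
      have h4 := le_trans (ler_norm _) H.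
      move: mM; rewrite ltr_pdivlMr// => mM.
      have h5 : M * (u' - u) <= M * m by rewrite ler_wpM2l// lerBlDl.
      by clear -h4 h5 mM H2 m0; nra.
    have [v_l|l_v] := ltP v (u + l).
      apply: pos => // b /andP[ub bv]; apply: hk.
      by rewrite (ltW (lt_trans uu' ub)) (lt_trans bv)// (lt_trans v_l)// ltrD2l.
    have [v_b|b_v] := leP v vb; first by apply: inner; rewrite l_v.
    apply: le_trans (mono _ _ u'0 u'u2 (ltW b_v) v1).
    by apply: inner; rewrite lexx andbT ltW.
  by move=> /uS; rewrite gerDl leNgt m0.
exists u, v; split => //.
- by rewrite u0.
- by rewrite uv.
- by apply/eqP; rewrite eq_le jv nn// uv.
Qed.

Section Rintegral_linear.
Context d (T : measurableType d) (R : realType) (mu : {measure set T -> \bar R}).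

Lemma integral_scale (D : set T) (k : T -> R) (C : R) : measurable D ->
  mu.-integrable D (EFin \o k) ->
  (\int[mu]_(y in D) (C * k y)%:E = (C * \int[mu]_(y in D) k y)%R%:E)%E.
Proof.
move=> mD ik; rewrite -RintegralZl// /Rintegral fineK//.
by apply: integrable_fin_num => //; exact: (integrableZl mD C ik).
Qed.

Lemma integral_lin2 (D : set T) (h k : T -> R) (C : R) : measurable D ->
  mu.-integrable D (EFin \o h) -> mu.-integrable D (EFin \o k) ->
  (\int[mu]_(y in D) (2 * (h y + C * k y))%:E =
   (2 * (\int[mu]_(y in D) h y + C * \int[mu]_(y in D) k y))%R%:E)%E.
Proof.
move=> mD ih ik.
have ick : mu.-integrable D (EFin \o (fun y => C * k y)) by exact: (integrableZl mD C ik).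
have ihk : mu.-integrable D (EFin \o (fun y => h y + C * k y)).
  exact: (integrableD mD ih ick).
by rewrite integral_scale// RintegralD// RintegralZl.
Qed.

End Rintegral_linear.

(** Mirror image of [avg_op_gt0_left]: now [v < xi], again with strict positivity near the singular
    end [xi]. *)
Lemma avg_op_gt0_right (R : realType) (G : R -> R) (v c xi : R) :
  {in `]0, 1[, continuous G} -> 0 < v -> v < c -> c < xi -> xi < 1 ->
  (forall y, c <= y <= xi -> 0 < G y) -> (forall y, v < y <= xi -> 0 <= G y) ->
  0 < avg_op G xi v.
Proof.
move=> cG v0 vc cx x1 Gpos Gnn.
have x01 : xi \in `]0, 1[ by rewrite in_itv/= x1 (lt_trans v0 (lt_trans vc cx)).
have c01 : c \in `]0, 1[ by rewrite in_itv/= (lt_trans v0) ?(lt_trans cx).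
have v01 : v \in `]0, 1[ by rewrite in_itv/= v0 (lt_trans vc (lt_trans cx x1)).
have p0 : 0 < avg_op G xi c.
  apply: (avg_op_gt0 cG x01 c01 (c := c) (d := xi)); rewrite ?lexx ?(ltW cx)//.
  by move=> y _; exact: Gpos.
have h : (\int[@lebesgue_measure R]_(b in `]c, xi[) (G b * abk xi b)%:E <=
          \int[@lebesgue_measure R]_(b in `]v, xi[) (G b * abk xi b)%:E)%E.
  apply: ge0_subset_integral => //.
  - apply/measurable_EFinP; apply: measurable_funM; last exact: measurable_abk.
    apply: (continuous_measurable_oo cG) => // y /=; rewrite !in_itv/= => /andP[h1 h2].
    by rewrite (lt_trans v0 h1) (lt_trans h2).
  - move=> y /=; rewrite in_itv/= => /andP[h1 h2].
    by rewrite lee_fin mulr_ge0 ?abk_ge0// Gnn// h1 ltW.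
  - by move=> y /=; rewrite !in_itv/= => /andP[h1 ->]; rewrite (lt_trans vc).
rewrite (avg_kernel_l cG c01 x01 cx) in h; last first.
  by move=> b; rewrite in_itv/= => /andP[h1 h2]; apply/ltW/Gpos; rewrite !ltW.
rewrite (avg_kernel_l cG v01 x01 (lt_trans vc cx)) in h; last first.
  by move=> b; rewrite in_itv/= => /andP[h1 h2]; apply/Gnn; rewrite h1 ltW.
have s1 : 0 < Num.sqrt (xi - c) by rewrite sqrtr_gt0 subr_gt0.
have s2 : 0 < Num.sqrt (xi - v) by rewrite sqrtr_gt0 subr_gt0 (lt_trans vc).
have : 0 < 2 * Num.sqrt (xi - v) * avg_op G xi v.
  by rewrite lee_fin in h; apply: (lt_le_trans _ h); rewrite mulr_gt0// mulr_gt0.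
by rewrite pmulr_rgt0// mulr_gt0.
Qed.

(** * The function of the leading edge system *)

Section leading_function.
Context {R : realType}.
Local Notation mu := (@lebesgue_measure R).
Context (f : R -> R).
Hypothesis hf_smooth : smooth_on (@I01 R) f.
Hypothesis hf_neg : forall u : R, 0 < u < 1 -> derive1 f u < 0.
Context (t : R).

(* the function of the leading edge system, with [u] in the role of [u3] *)
Definition Jlead (v u : R) : R :=
  \int[mu]_(xi in `[u, v]) (Phi0 f t xi u * Num.sqrt (xi - u)).

Let phi u xi := Phi0 f t xi u * Num.sqrt (xi - u).

Let phi_cont (u xi : R) : 0 < u < 1 -> 0 < xi < 1 -> {for xi, continuous (phi u)}.
Proof.
move=> u01 x01; apply: cvgM.
  have : derivable (fun x => Phi0 f t x u) xi 1 by apply: Phi0_derivable.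
  by move=> /derivable1_diffP/differentiable_continuous.
apply: (continuous_comp (f := fun p => p - u) (g := @Num.sqrt R)).
  by apply: continuousB; [exact: cvg_id|exact: cvg_cst].
exact: sqrt_continuous.
Qed.

Let phi_within (u v : R) : 0 < u -> v < 1 -> {within `[u, v], continuous (phi u)}.
Proof.
move=> u0 v1; apply: continuous_in_subspaceT => y; rewrite inE/= in_itv/= => /andP[uy yv].
by apply: phi_cont; apply/andP; split => //;
  [exact: le_lt_trans (le_trans uy yv) v1|exact: lt_le_trans uy|exact: le_lt_trans v1].
Qed.

Lemma integrable_within_cc (h : R -> R) (u v : R) :
  {within `[u, v], continuous h} -> mu.-integrable `[u, v] (EFin \o h).
Proof. by move=> ch; apply: continuous_compact_integrable => //; exact: segment_compact. Qed.

Lemma integrable_within_oo (h : R -> R) (u v : R) :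
  {within `[u, v], continuous h} -> mu.-integrable `]u, v[ (EFin \o h).
Proof.
move=> /integrable_within_cc; apply: integrableS => //; exact: subset_itv_oo_cc.
Qed.

Lemma Rintegral_oo_cc (h : R -> R) (u v : R) : {within `[u, v], continuous h} ->
  \int[mu]_(x in `]u, v[) h x = \int[mu]_(x in `[u, v]) h x.
Proof.
move=> ch; have ih := integrable_within_cc ch.
rewrite Rintegral_itv_bndo_bndc; last exact: integrable_within_oo.
rewrite Rintegral_itv_obnd_cbnd//.
by apply: integrableS ih => //; exact: subset_itv_oc_cc.
Qed.

Lemma is_derive_Jlead (u v : R) : 0 < u -> u < v -> v < 1 ->
  is_derive v 1 (Jlead ^~ u) (phi u v).
Proof.
move=> u0 uv v1.
have vw : v < (v + 1) / 2 by lra.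
have w1 : (v + 1) / 2 < 1 by lra.
have u1 : u < 1 by exact: lt_trans v1.
have [||d e] := @continuous_FTC1_closed _ (phi u) u v _ vw _ uv.
- exact/integrable_within_cc/phi_within.
- by apply: phi_cont; rewrite ?u0 ?u1 ?v1 ?(lt_trans u0).
- by rewrite -e derive1E; exact/derivableP.
Qed.

Lemma Jlead_MVT (u v w : R) : 0 < u -> u <= v -> v < w -> w < 1 ->
  exists2 c, v < c < w & Jlead w u - Jlead v u = Phi0 f t c u * Num.sqrt (c - u) * (w - v).
Proof.
move=> u0 uv vw w1.
have [||c] := @MVT _ (Jlead ^~ u) (phi u) v w vw.
- move=> c; rewrite in_itv/= => /andP[vc cw]; apply: is_derive_Jlead => //.
    exact: le_lt_trans vc.
  exact: lt_trans w1.
- have uw : u <= w by rewrite (le_trans uv)// ltW.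
  have := parameterized_integral_continuous uw (integrable_within_cc (phi_within u0 w1)).
  by apply: continuous_subspaceW; exact: subset_itvr.
- by rewrite in_itv/= => cI e; exists c.
Qed.

Lemma Jlead_continuous (u a b : R) : 0 < u -> u < a -> b < 1 ->
  {within `[a, b], continuous (Jlead ^~ u)}.
Proof.
move=> u0 ua b1; apply: derivable_within_continuous => v; rewrite in_itv/= => /andP[av vb].
by apply: (@ex_derive _ _ _ _ _ _ _ (is_derive_Jlead u0 _ _));
  [exact: lt_le_trans av|exact: le_lt_trans b1].
Qed.

Let sqrt_within (u v : R) : {within `[u, v], continuous (fun b => Num.sqrt (v - b))}.
Proof. by apply: continuous_subspaceT => b; exact: sqrt_sub_continuous. Qed.

Let Hs_within (u v : R) : 0 < u -> v < 1 ->
  {within `[u, v], continuous (fun b => Hprime f t b * Num.sqrt (v - b))}.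
Proof.
move=> u0 v1; apply: continuous_in_subspaceT => y; rewrite inE/= in_itv/= => /andP[uy yv].
apply: cvgM; last exact: sqrt_sub_continuous.
by apply: continuous_Hprime => //; rewrite in_itv/= (lt_le_trans u0)//= (le_lt_trans yv).
Qed.

Lemma Hprime_bounded (a b : R) : 0 < a -> b < 1 -> exists2 C, 0 <= C &
  forall y, a <= y <= b -> `|Hprime f t y| <= C.
Proof.
move=> a0 b1.
have c : {within `[a, b], continuous (Hprime f t)}.
  apply: continuous_in_subspaceT => y; rewrite inE/= in_itv/= => /andP[uy yv].
  by apply: continuous_Hprime => //; rewrite in_itv/= (lt_le_trans a0)//= (le_lt_trans yv).
have /compact_bounded [M [_ hM]] := continuous_compact c (@segment_compact _ _ _).
exists (`|M| + 1); first by rewrite addr_ge0.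
move=> y yI; apply: hM; first by rewrite (le_lt_trans (ler_norm _))// ltrDl.
by exists y => //=; rewrite in_itv.
Qed.

Lemma integrable_sqrt_l (u v : R) : mu.-integrable `]u, v[ (EFin \o (fun y => Num.sqrt (y - u))).
Proof.
apply: integrable_within_oo; apply: continuous_subspaceT => y.
apply: (continuous_comp (f := fun p => p - u) (g := @Num.sqrt R)).
  by apply: continuousB; [exact: cvg_id|exact: cvg_cst].
exact: sqrt_continuous.
Qed.

(** [Phi0 f t y u] times [sqrt (y - u)] is half the Abel integral of [Hprime] over [(u, y)], so
    [int_abel_avg] applies. In the new form [u] occurs only as a limit of integration. *)
Lemma JleadE (u v : R) : 0 < u -> u < v -> v < 1 ->
  Jlead v u = \int[mu]_(b in `]u, v[) (Hprime f t b * Num.sqrt (v - b)).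
Proof.
move=> u0 uv v1.
have u1 : u < 1 by exact: lt_trans v1.
have u01 : u \in `]0, 1[ by rewrite in_itv/= u0.
(* the kernel identities are for nonnegative integrands: shift [Hprime] by a constant *)
have [C C0 hC] := Hprime_bounded u0 v1.
have cH : {in `]0, 1[, continuous (Hprime f t)} by exact: continuous_Hprime.
have c1 : {in `]0, 1[, continuous (fun _ : R => 1 : R)} by move=> y _; exact: cvg_cst.
pose G y := Hprime f t y + C * 1.
have cG : {in `]0, 1[, continuous G} by move=> y y01; apply: cvgD; [exact: cH|exact: cvg_cst].
have G0 b : b \in `]u, v[ -> 0 <= G b.
  rewrite in_itv/= => /andP[ub bv]; rewrite /G mulr1 -lerBlDr sub0r.
  have : `|Hprime f t b| <= C by apply: hC; rewrite !ltW.
  by rewrite ler_norml => /andP[].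
have sub : `]u, v[ `<=` `]0, 1[.
  by move=> y; rewrite /= !in_itv/= => /andP[h1 h2]; rewrite (lt_trans u0)//= (lt_trans h2).
have mG : measurable_fun (`]u, v[ : set R) G by apply: (continuous_measurable_oo cG).
have e := int_abel_avg uv mG G0.
have e1 := @int_abel_avg _ (fun=> 1) u v uv (measurable_cst _) (fun _ _ => ler01).
pose s y := Num.sqrt (y - u); pose r b := Num.sqrt (v - b).
have iphi : mu.-integrable `]u, v[ (EFin \o phi u) by exact/integrable_within_oo/phi_within.
have is_ : mu.-integrable `]u, v[ (EFin \o s) by exact: integrable_sqrt_l.
have ir : mu.-integrable `]u, v[ (EFin \o r) by exact/integrable_within_oo/sqrt_within.
have iH : mu.-integrable `]u, v[ (EFin \o (fun b => Hprime f t b * r b)).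
  exact/integrable_within_oo/Hs_within.
have L : (\int[mu]_(y in `]u, v[) \int[mu]_(b in `]u, y[) (G b * abk y b)%:E =
    (2 * (\int[mu]_(y in `]u, v[) phi u y + C * \int[mu]_(y in `]u, v[) s y))%R%:E)%E.
  rewrite -integral_lin2//; apply: eq_integral => y; rewrite inE/= in_itv/= => /andP[uy yv].
  have y01 : y \in `]0, 1[ by rewrite in_itv/= (lt_trans u0)//= (lt_trans yv).
  rewrite (avg_kernel_l cG u01 y01 uy); last first.
    by move=> b; rewrite in_itv/= => /andP[h1 h2]; apply: G0; rewrite in_itv/= h1 (lt_trans h2).
  rewrite (avg_op_lin C cH c1 y01 u01) avg_op_cst; congr EFin.
  by rewrite /phi /s /Phi0; ring.
have L1 : (\int[mu]_(y in `]u, v[) \int[mu]_(b in `]u, y[) (1 * abk y b)%:E =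
    (2 * \int[mu]_(y in `]u, v[) s y)%R%:E)%E.
  rewrite -integral_scale//; apply: eq_integral => y; rewrite inE/= in_itv/= => /andP[uy yv].
  by under eq_integral do rewrite mul1r; rewrite int_abk_r.
have M1 : (\int[mu]_(b in `]u, v[) (1 * (2 * r b))%:E =
    (2 * \int[mu]_(b in `]u, v[) r b)%R%:E)%E.
  by under eq_integral do rewrite mul1r; rewrite integral_scale.
have M : (\int[mu]_(b in `]u, v[) (G b * (2 * r b))%:E =
    (2 * (\int[mu]_(b in `]u, v[) (Hprime f t b * r b) + C * \int[mu]_(b in `]u, v[) r b))%R%:E)%E.
  rewrite -integral_lin2//; apply: eq_integral => b _; congr EFin.
  by rewrite /G; ring.
rewrite L M in e; rewrite L1 M1 in e1.
rewrite /Jlead -Rintegral_oo_cc; last exact: phi_within.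
move: e e1 => [e] [e1].
have n2 : (2 : R) != 0 by [].
have {}e1 := mulfI n2 e1; have {}e := mulfI n2 e.
by rewrite e1 in e; exact: addIr e.
Qed.

End leading_function.

(** * Sign of [Jlead] for [u <= u3p t] *)

Section leading_edge.
Context {R : realType}.
Local Notation mu := (@lebesgue_measure R).
Context (f : R -> R).
Hypothesis hf_smooth : smooth_on (@I01 R) f.
Hypothesis hf_neg : forall u : R, 0 < u < 1 -> derive1 f u < 0.
Hypothesis hf_0 : f u @[u --> 0^'+] --> +oo.
Hypothesis hf_1 : f u @[u --> 1^'-] --> -oo.
Context (delta2 : R).
Hypothesis hdelta2 : 0 < delta2.
Hypothesis hf2 : forall u : R, 0 < u < delta2 -> 0 < derive1n 2 f u.
Context (t : R).
Hypothesis t0 : 0 < t.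

Lemma Hprime_decr (b b' : R) : 0 < b -> b < b' -> b' < delta2 -> b' < 1 ->
  Hprime f t b' < Hprime f t b.
Proof.
move=> b0 bb' b'd b'1.
have [c cI e] := MVT_profile hf_smooth 1 b0 bb' b'1.
move: cI; rewrite in_itv/= => /andP[bc cb'].
have c2 : 0 < derive1n 2 f c by apply: hf2; rewrite (lt_trans b0)//= (lt_trans cb').
have h : 0 < derive1n 1 f b' - derive1n 1 f b by rewrite e mulr_gt0// subr_gt0.
rewrite subr_gt0 in h; rewrite /Hprime; apply: ltrD; last by rewrite ltrN2.
by rewrite ltrN2 ltr_pM2l// mulr_gt0.
Qed.

(** [Hprime] is positive up to some [d] at which [f] is steep, and for small [u] the drop of [f]
    from [u] to any [xi > d] exceeds [120 t]. So [Phi0] is positive in both ranges of [xi]. *)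
Lemma Jlead_small : exists2 a, 0 < a < 1 & forall u v, 0 < u -> u <= a -> u < v -> v < 1 ->
  0 <= Jlead f t v u.
Proof.
have [c [c0 cd c1]] := exists_pos_lt2 hdelta2 (ltr01 : 0 < 1 :> R).
have [d /andP[d0 dc] hd] := steep0 hf_smooth hf_neg hf_0 (- (60 * t)) (introT andP (conj c0 c1)).
have d1 : d < 1 by exact: lt_trans c1.
have pos b : 0 < b -> b <= d -> 0 < Hprime f t b.
  move=> b0 bd.
  have hd' : 0 < Hprime f t d.
    rewrite /Hprime; set p := derive1 f d in hd *.
    have : t * d < t * 1 by rewrite ltr_pM2l.
    by move: hd; move: (p) (d) => q e hq h; lra.
  have [->//|ne] := eqVneq b d.
  have bd' : b < d by rewrite lt_neqAle ne.
  exact: lt_trans hd' (Hprime_decr b0 bd' (lt_trans dc cd) d1).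
have [a /andP[a0 a1] ha] := profile_large hf_0 (120 * t + f d).
have [e [e0 ea ed]] := exists_pos_lt2 a0 d0.
exists e; first by rewrite e0 (lt_trans ea).
move=> u v u0 ue uv v1; apply: Rintegral_ge0 => xi; rewrite /= in_itv/= => /andP[uxi xiv].
have u01 : u \in `]0, 1[ by rewrite in_itv/= u0 (lt_trans uv).
have xi0 : 0 < xi by exact: lt_le_trans uxi.
have xi1 : xi < 1 by exact: le_lt_trans v1.
have xi01 : xi \in `]0, 1[ by rewrite in_itv/= xi0.
apply: mulr_ge0; last exact: sqrtr_ge0.
have cG : {in `]0, 1[, continuous (Hprime f t)} by exact: continuous_Hprime.
have [xid|dxi] := leP xi d.
  rewrite /Phi0; apply/ltW; apply: (avg_op_gt0 cG xi01 u01 (c := u) (d := xi)); rewrite ?lexx ?uxi//.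
  by move=> y _ /andP[uy yxi]; apply: pos; [exact: lt_le_trans uy|exact: le_trans xid].
apply/ltW/Phi0_pos => //.
have h1 : 120 * t + f d < f u by apply: ha; rewrite u0 (le_trans ue)// ltW.
have h2 : f xi < f d by exact: profile_decr.
rewrite distrC; apply: lt_le_trans (ler_norm _).
by rewrite ltrBrDr (lt_trans _ h1)// ltrD2l.
Qed.

Let Hs u v : 0 < u -> v < 1 -> mu.-integrable `]u, v[ (EFin \o (fun b => Hprime f t b * Num.sqrt (v - b))).
Proof.
move=> u0 v1; apply: integrable_within_oo.
apply: continuous_in_subspaceT => y; rewrite inE/= in_itv/= => /andP[uy yv].
apply: cvgM; last exact: sqrt_sub_continuous.
by apply: continuous_Hprime => //; rewrite in_itv/= (lt_le_trans u0)//= (le_lt_trans yv).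
Qed.

(** By [JleadE] the difference is the integral over [(u, u')] of [Hprime] times a factor at most 1,
    whence a bound uniform in [v]. *)
Lemma Jlead_lip (a u2 : R) : 0 < a -> u2 < 1 -> exists2 M, 0 <= M &
  forall u u' v, a <= u -> u <= u' -> u' <= u2 -> u' < v -> v < 1 ->
     `|Jlead f t v u - Jlead f t v u'| <= M * (u' - u).
Proof.
move=> a0 u21; have [M M0 hM] := Hprime_bounded hf_smooth t a0 u21.
exists M => // u u' v au uu' u'u2 u'v v1.
have [->|ne] := eqVneq u u'; first by rewrite !subrr normr0 mulr0.
have {ne uu'} uu' : u < u' by rewrite lt_neqAle ne.
have u0 : 0 < u by exact: lt_le_trans au.
have u'0 : 0 < u' by exact: lt_trans uu'.
have uv : u < v by exact: lt_trans u'v.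
pose h b := Hprime f t b * Num.sqrt (v - b).
have i1 : mu.-integrable `]u, u'] (EFin \o h).
  apply: integrableS (Hs u0 v1) => //.
  by move=> b; rewrite /= !in_itv/= => /andP[-> h1]; exact: le_lt_trans u'v.
have -> : Jlead f t v u - Jlead f t v u' = \int[mu]_(b in `]u, u']) h b.
  rewrite !JleadE//.
  rewrite -(@Rintegral_itvB _ h (BRight u) (BLeft v) u') ?bnd_simp ?(ltW uu')//.
    by rewrite opprB addrC subrK.
  exact: Hs.
apply: (le_trans (le_normr_Rintegral _ i1)) => //.
have i2 : mu.-integrable `]u, u'] (EFin \o (fun=> M)).
  apply: (@integrableS _ _ _ mu `[u, u']) => //; first exact: subset_itv_oc_cc.
  by apply: integrable_within_cc; apply: continuous_subspaceT => y; exact: cvg_cst.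
apply: (@le_trans _ _ (\int[mu]_(b in `]u, u']) M)).
  apply: le_Rintegral => //; first exact: integrable_norm.
  move=> b; rewrite /= in_itv/= => /andP[ub bu'].
  rewrite /h normrM -[leRHS]mulr1; apply: ler_pM => //.
    by apply: hM; rewrite (le_trans au (ltW ub)) (le_trans bu').
  rewrite ger0_norm ?sqrtr_ge0// -[leRHS]sqrtr1; apply: ler_wsqrtr.
  by rewrite lerBlDr (le_trans (ltW v1))// lerDl (ltW (lt_trans u0 ub)).
rewrite Rintegral_cst//.
rewrite [X in fine X](_ : _ = (u' - u)%:E)//.
by rewrite [LHS]lebesgue_measure_itv/= lte_fin uu' -EFinB.
Qed.

(** The derivative in [v] has the sign of [Phi0 f t v u], which is positive as soon as [f v] is
    below [f u2 - 120 t]. *)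
Lemma Jlead_mono (u2 : R) : 0 < u2 -> u2 < 1 -> exists2 vb, u2 < vb < 1 &
  forall u v, 0 < u -> u <= u2 -> vb <= v -> v < 1 -> Jlead f t vb u <= Jlead f t v u.
Proof.
move=> u20 u21.
have [b /andP[b0 b1] hb] := profile_small hf_1 (f u2 - 120 * t).
have [vb [vb1 vbb vbu]] : exists vb, [/\ vb < 1, b <= vb & u2 < vb].
  exists (Num.max b ((u2 + 1) / 2)); split; rewrite ?gt_max ?le_max ?lt_max ?b1 ?lexx//=.
  - by lra.
  - by apply/orP; right; lra.
exists vb; first by rewrite vbu.
move=> u v u0 uu2 vbv v1.
have [<-//|ne] := eqVneq vb v.
have {ne} vbv' : vb < v by rewrite lt_neqAle ne.
have uvb : u <= vb by exact: le_trans (ltW vbu).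
have [c /andP[vbc cv] e] := Jlead_MVT hf_smooth t u0 uvb vbv' v1.
have uc : u < c by exact: le_lt_trans vbc.
rewrite -subr_ge0 e; apply: mulr_ge0; last by rewrite subr_ge0.
apply: mulr_ge0; last exact: sqrtr_ge0.
have u01 : u \in `]0, 1[ by rewrite in_itv/= u0 (le_lt_trans uu2).
have c01 : c \in `]0, 1[ by rewrite in_itv/= (lt_trans u0)//= (lt_trans cv).
apply/ltW/Phi0_pos => //.
have h1 : f c < f u2 - 120 * t.
  by apply: hb; rewrite (le_trans vbb (ltW vbc)) (lt_trans cv).
have h2 : f u2 <= f u by exact: profile_nincr.
rewrite distrC; apply: lt_le_trans (ler_norm _).
by move: h1 h2; move: (f c) (f u) (f u2) => x y z h1 h2; lra.
Qed.

Lemma Jlead_pos (u v : R) : 0 < u -> u < v -> v < 1 ->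
  (forall b, u < b < v -> 0 < Hprime f t b) -> 0 <= Jlead f t v u.
Proof.
move=> u0 uv v1 hb; rewrite JleadE//; apply: Rintegral_ge0 => b; rewrite /= in_itv/= => bI.
by rewrite mulr_ge0 ?sqrtr_ge0// ltW// hb.
Qed.

Lemma Jlead_diag (u : R) : Jlead f t u u = 0.
Proof. by rewrite /Jlead set_itv1 Rintegral_set1. Qed.

Lemma Jlead_neg (u v : R) : 0 < u -> u < v -> v < 1 ->
  (forall b, u < b <= v -> Hprime f t b < 0) -> Jlead f t v u < 0.
Proof.
move=> u0 uv v1 hb.
have [c /andP[uc cv]] := Jlead_MVT hf_smooth t u0 (lexx u) uv v1.
rewrite Jlead_diag subr0 => ->.
have u01 : u \in `]0, 1[ by rewrite in_itv/= u0 (lt_trans uv).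
have c01 : c \in `]0, 1[ by rewrite in_itv/= (lt_trans u0)//= (lt_trans cv).
have cG : {in `]0, 1[, continuous (Hprime f t)} by exact: continuous_Hprime.
have c0 : {in `]0, 1[, continuous (fun _ : R => 0 : R)} by move=> y _; exact: cvg_cst.
have P : 0 < avg_op (fun y => 0 + -1 * Hprime f t y) c u.
  apply: (avg_op_gt0_right (c := (u + c) / 2)) => //; try lra.
  - move=> y y01; apply: cvgD; first exact: cvg_cst.
    by apply: cvgM; [exact: cvg_cst|exact: cG].
  - move=> y /andP[y1 y2]; rewrite add0r mulN1r oppr_gt0 hb//.
    by rewrite (le_trans y2 (ltW cv)) andbT; move: (u) (c) uc y1 => a b ab h; lra.
  - move=> y /andP[y1 y2]; rewrite add0r mulN1r oppr_ge0 ltW// hb// y1.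
    exact: le_trans (ltW cv).
rewrite (avg_op_lin _ c0 cG c01 u01) avg_op_cst add0r mulN1r oppr_gt0 in P.
rewrite -mulrA pmulr_llt0// mulr_gt0 ?subr_gt0// sqrtr_gt0 subr_gt0//.
Qed.

Context (Tp : R) (u1p u3p xp : R -> R).
Hypothesis hp_sol : forall t : R, Tp < t ->
     0 < u3p t /\ u3p t < u1p t /\ u1p t < 1 /\
     leading_sys f t (u1p t) (u3p t) (xp t).
Hypothesis hp_uniq : forall t u1 u3 x : R, Tp < t -> 0 < u3 -> u3 < u1 -> u1 < 1 ->
     leading_sys f t u1 u3 x -> u1 = u1p t /\ u3 = u3p t /\ x = xp t.
Hypothesis u3d : u3p t < delta2.
Hypothesis Tpt : Tp < t.

(** [first_negative] provides some [w < u] and an interior zero [z] of the nonnegative function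
    [Jlead f t (.) w]. There the derivative vanishes, so [Phi0 f t z w = 0] as well: a solution of
    the leading edge system with [u3 = w < u3p t], against uniqueness. *)
Lemma Jlead_ge0 (u v : R) : 0 < u -> u <= u3p t -> u < v -> v < 1 -> 0 <= Jlead f t v u.
Proof.
move=> u0 uu3 uv v1; rewrite leNgt; apply/negP => bad.
have u1 : u < 1 by exact: lt_trans v1.
have [a1 /andP[a10 a11] ha1] := Jlead_small.
have [a [a0 aa1 au]] := exists_pos_lt2 a10 u0.
have [vb /andP[uvb vb1] hvb] := Jlead_mono u0 u1.
have [M M0 hM] := Jlead_lip a0 u1.
pose d2 := Num.min delta2 1.
have ud2 : u < d2 by rewrite lt_min u1 (le_lt_trans uu3).
have d21 : d2 <= 1 by rewrite ge_min lexx orbT.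
have [|||||||w [z [/andP[w0 wu] /andP[wz z1] J0 Jge]]] :=
  @first_negative _ (Jlead f t) (Hprime f t) a u vb d2 M a0 au uvb vb1 ud2 d21 M0 _ hvb hM.
- by move=> u' v' u'0 u'a; apply: ha1 => //; rewrite (le_trans u'a)// ltW.
- by move=> u' c u'0 u'c; exact: Jlead_continuous.
- by move=> u' v' u'0 _; exact: Jlead_pos.
- by move=> u' v' u'0 _; exact: Jlead_neg.
- move=> b b' b0 bb'; rewrite lt_min => /andP[h1 h2]; exact: Hprime_decr.
- by move=> b b01; apply: continuous_Hprime => //; rewrite in_itv.
- by exists v; rewrite ?uv.
have wz0 : 0 < z - w by rewrite subr_gt0.
have P0 : Phi0 f t z w = 0.
  have d1 c : w < c -> c < 1 -> is_derive c 1 (Jlead f t ^~ w) (Phi0 f t c w * Num.sqrt (c - w)).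
    by move=> wc c1; exact: is_derive_Jlead.
  have d0 : is_derive z 1 (Jlead f t ^~ w) 0.
    apply: (@derive1_at_min _ _ w 1) => //.
    - exact: ltW (lt_trans wz z1).
    - by move=> c; rewrite in_itv/= => /andP[c1 c2]; apply: (@ex_derive _ _ _ _ _ _ _ (d1 _ c1 c2)).
    - by rewrite in_itv/= wz.
    - by move=> c; rewrite in_itv/= => cI; rewrite J0 Jge.
  have := @derive_val _ _ _ _ _ _ _ d0.
  rewrite (@derive_val _ _ _ _ _ _ _ (d1 _ wz z1)) => /eqP.
  by rewrite mulf_eq0 (gt_eqF (_ : 0 < Num.sqrt _)) ?sqrtr_gt0// orbF => /eqP.
have [|_ [e _]] := @hp_uniq t z w (30 * t * w ^+ 2 + f w) Tpt w0 wz z1.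
  by split => //; rewrite addrAC addrK subrr.
by move: wu; rewrite e ltNge uu3.
Qed.

(** As [Hprime] decreases, a negative value would persist just beyond [u] and make [Jlead]
    negative. *)
Lemma Hprime_ge0_leading (u : R) : 0 < u -> u <= u3p t -> u < 1 -> 0 <= Hprime f t u.
Proof.
move=> u0 uu3 u1; rewrite leNgt; apply/negP => bad.
have d1 : 0 < delta2 - u by rewrite subr_gt0 (le_lt_trans uu3).
have d2 : 0 < 1 - u by rewrite subr_gt0.
have [m [m0 md m1]] := exists_pos_lt2 d1 d2.
have uv : u < u + m by rewrite ltrDl.
have vd : u + m < delta2 by rewrite addrC -ltrBrDr.
have v1 : u + m < 1 by rewrite addrC -ltrBrDr.
have : Jlead f t (u + m) u < 0.
  apply: Jlead_neg => // b /andP[ub bv]; apply: lt_trans bad.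
  apply: Hprime_decr => //; [exact: le_lt_trans vd|exact: le_lt_trans v1].
by rewrite ltNge Jlead_ge0.
Qed.

End leading_edge.

Lemma ereal_le_cancel (R : realDomainType) (p m c j : \bar R) : c \is a fin_num ->
  (0 <= j -> p + c = m + (j + c) -> m <= p)%E.
Proof. by move=> fc j0; rewrite addeA => e; rewrite -(leeD2rE _ _ fc) e leeD2rE// leeDl. Qed.

(** * The hodograph function beyond the end point *)

Section leading_edge2.
Context {R : realType}.
Local Notation mu := (@lebesgue_measure R).
Context (f : R -> R).
Hypothesis hf_smooth : smooth_on (@I01 R) f.
Hypothesis hf_neg : forall u : R, 0 < u < 1 -> derive1 f u < 0.
Hypothesis hf_0 : f u @[u --> 0^'+] --> +oo.
Hypothesis hf_1 : f u @[u --> 1^'-] --> -oo.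

(* The hodograph equation is [hodo f t x u = 0], and [Hprime f t] is the derivative of [hodo f t x]. *)
Definition hodo (f : R -> R) (t x c : R) : R := x - 30 * t * c ^+ 2 - f c.

Context (t : R).

Lemma is_derive_hodo (x c : R) : c \in `]0, 1[ -> is_derive c 1 (hodo f t x) (Hprime f t c).
Proof.
move=> c01.
have d1 := is_derive_profile hf_smooth 0 c01.
have d3 := is_deriveZ (30 * t) (is_deriveX 2 (is_derive_id c (1:R))).
move: (is_deriveB (is_deriveB (is_derive_cst x c (1:R)) d3) d1).
rewrite (_ : _ - _ - _ = Hprime f t c); first exact.
by rewrite derive1n1 /Hprime /GRing.scale/= expr1; ring.
Qed.

Lemma continuous_hodo (x : R) : {in `]0, 1[, continuous (hodo f t x)}.
Proof.
move=> c c01; apply/differentiable_continuous/derivable1_diffP.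
exact: (@ex_derive _ _ _ _ _ _ _ (is_derive_hodo x c01)).
Qed.

Lemma int_Hprime (x C a b : R) : 0 < a -> a < b -> b < 1 ->
  (forall y, a <= y <= b -> 0 <= Hprime f t y + C) ->
  (\int[mu]_(y in `]a, b[) (Hprime f t y + C)%:E =
   (hodo f t x b - hodo f t x a + C * (b - a))%:E)%E.
Proof.
move=> a0 ab b1 G0.
have i01 y : a <= y -> y <= b -> y \in `]0, 1[.
  by move=> h1 h2; rewrite in_itv/= (lt_le_trans a0 h1) (le_lt_trans h2).
rewrite (_ : _ + C * _ = (hodo f t x b + C * b) - (hodo f t x a + C * a)); last by ring.
apply: (@ge0_FTC2_oo _ _ (fun c => hodo f t x c + C * c)); first exact: ab.
- move=> y; rewrite in_itv/= => /andP[h1 h2].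
  by apply: cvgD; [apply: continuous_Hprime => //; apply: i01; exact: ltW|exact: cvg_cst].
- by move=> y; rewrite in_itv/= => /andP[h1 h2]; apply: G0; rewrite !ltW.
- apply: continuous_in_subspaceT => y; rewrite inE/= in_itv/= => /andP[h1 h2].
  apply: cvgD; first by apply: continuous_hodo => //; exact: i01.
  by apply: cvgM; [exact: cvg_cst|exact: cvg_id].
move=> y; rewrite in_itv/= => /andP[h1 h2].
have d3 : is_derive y 1 (fun c : R => C * c) (C *: 1) by apply: is_deriveZ.
move: (is_deriveD (is_derive_hodo x (i01 _ (ltW h1) (ltW h2))) d3).
by rewrite (_ : _ + _ = Hprime f t y + C)// /GRing.scale/= mulr1.
Qed.

(** As [hodo] vanishes at [u], it is the integral of [Hprime] from [u], and by [int_abel_primitive]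
    its Abel integral over [(u, v)] is [2 Jlead]. The sign of [Jlead] therefore compares the
    positive and negative parts of [hodo]. *)
Lemma Jlead_outer (u v x : R) : 0 < u -> u < v -> v < 1 -> hodo f t x u = 0 ->
  0 <= Jlead f t v u ->
  (\int[mu]_(c in `]u, v[) (Num.max (- hodo f t x c) 0 * abk v c)%:E <=
   \int[mu]_(c in `]u, v[) (Num.max (hodo f t x c) 0 * abk v c)%:E)%E.
Proof.
pose H := hodo f t x.
move=> u0 uv v1 Hu J0.
have [C C0 hC] := Hprime_bounded hf_smooth t u0 v1.
have cH : {in `]0, 1[, continuous H} by exact: continuous_hodo.
have sub : `]u, v[ `<=` `]0, 1[.
  by move=> y; rewrite /= !in_itv/= => /andP[h1 h2]; rewrite (lt_trans u0)//= (lt_trans h2).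
have mH : measurable_fun (`]u, v[ : set R) H by apply: (continuous_measurable_oo cH).
have cHp : {in `]0, 1[, continuous (Hprime f t)} by exact: continuous_Hprime.
pose G y := Hprime f t y + C.
have cG : {in `]0, 1[, continuous G} by move=> y y01; apply: cvgD; [exact: cHp|exact: cvg_cst].
have G0 b : b \in `]u, v[ -> 0 <= G b.
  rewrite in_itv/= => /andP[ub bv]; rewrite /G -lerBlDr sub0r.
  have : `|Hprime f t b| <= C by apply: hC; rewrite !ltW.
  by rewrite ler_norml => /andP[].
have mG : measurable_fun (`]u, v[ : set R) G by apply: (continuous_measurable_oo cG).
have e := int_abel_primitive uv mG G0.
have e1 := @int_abel_primitive _ (fun=> C) u v uv (measurable_cst _) (fun _ _ => C0).
have FTC c : u < c -> c < v -> (\int[mu]_(b in `]u, c[) (G b)%:E = (H c + C * (c - u))%:E)%E.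
  move=> uc cv.
  rewrite (@int_Hprime x) ?Hu ?subr0//; first exact: lt_trans cv v1.
  move=> y /andP[h1 h2]; have := hC y; rewrite h1 (le_trans h2 (ltW cv)) => /(_ isT).
  by rewrite ler_norml => /andP[h _]; rewrite -lerBlDr sub0r.
have iH : measurable_fun (`]u, v[ : set R) (fun c => Num.max (H c) 0 * abk v c).
  by apply: measurable_funM; [apply: measurable_maxr|exact: measurable_abk].
have iH' : measurable_fun (`]u, v[ : set R) (fun c => Num.max (- H c) 0 * abk v c).
  apply: measurable_funM; last exact: measurable_abk.
  by apply: measurable_maxr => //; exact: measurableT_comp.
have iC : measurable_fun (`]u, v[ : set R) (fun c => C * (c - u) * abk v c).
  apply: measurable_funM; last exact: measurable_abk.
  by apply: measurable_funM => //; exact: measurable_funB.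
have iHC : measurable_fun (`]u, v[ : set R) (fun c => (H c + C * (c - u)) * abk v c).
  apply: measurable_funM; last exact: measurable_abk.
  apply: measurable_funD => //.
  by apply: measurable_funM => //; exact: measurable_funB.
have Cc0 c : `]u, v[%classic c -> 0 <= C * (c - u).
  by rewrite /= in_itv/= => /andP[h _]; rewrite mulr_ge0// subr_ge0 ltW.
have HC0 c : `]u, v[%classic c -> 0 <= H c + C * (c - u).
  rewrite /= in_itv/= => /andP[uc cv]; rewrite -lee_fin -FTC//.
  apply: integral_ge0 => y; rewrite /= in_itv/= => /andP[h1 h2].
  by rewrite lee_fin G0// in_itv/= h1 (lt_trans h2).
have eC : (\int[mu]_(c in `]u, v[) (C * (c - u) * abk v c)%:E =
           \int[mu]_(b in `]u, v[) (C * (2 * Num.sqrt (v - b)))%:E)%E.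
  rewrite -e1; apply: eq_integral => c; rewrite inE/= in_itv/= => /andP[uc cv].
  rewrite integral_cst// [X in (_ * X * _)%E](_ : _ = (c - u)%:E)//.
  by rewrite [LHS]lebesgue_measure_itv/= lte_fin uc -EFinB.
have is_ : mu.-integrable `]u, v[ (EFin \o (fun b => 2 * Num.sqrt (v - b))).
  apply: integrable_within_oo; apply: continuous_subspaceT => y.
  by apply: cvgM; [exact: cvg_cst|exact: sqrt_sub_continuous].
have iGs : mu.-integrable `]u, v[ (EFin \o (fun b => Hprime f t b * Num.sqrt (v - b))).
  apply: integrable_within_oo.
  apply: continuous_in_subspaceT => y; rewrite inE/= in_itv/= => /andP[uy yv].
  apply: cvgM; last exact: sqrt_sub_continuous.
  by apply: cHp; rewrite in_itv/= (lt_le_trans u0)//= (le_lt_trans yv).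
have eG : (\int[mu]_(c in `]u, v[) ((H c + C * (c - u)) * abk v c)%:E =
           (2 * Jlead f t v u)%:E + \int[mu]_(b in `]u, v[) (C * (2 * Num.sqrt (v - b)))%:E)%E.
  transitivity (\int[mu]_(b in `]u, v[) (G b * (2 * Num.sqrt (v - b)))%:E)%E.
    rewrite -e; apply: eq_integral => c; rewrite inE/= in_itv/= => /andP[uc cv].
    by rewrite FTC// EFinM.
  rewrite JleadE// -integral_scale// -integralD//; last 2 first.
  - exact: (integrableZl _ 2 iGs).
  - exact: (integrableZl _ C is_).
  by apply: eq_integral => b _; rewrite -EFinD; congr EFin; rewrite /G; ring.
have fC : (\int[mu]_(b in `]u, v[) (C * (2 * Num.sqrt (v - b)))%:E \is a fin_num)%E.
  by apply: integrable_fin_num => //; exact: (integrableZl _ C is_).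
have key : (\int[mu]_(c in `]u, v[) (Num.max (H c) 0 * abk v c)%:E +
            \int[mu]_(c in `]u, v[) (C * (c - u) * abk v c)%:E =
            \int[mu]_(c in `]u, v[) (Num.max (- H c) 0 * abk v c)%:E +
            \int[mu]_(c in `]u, v[) ((H c + C * (c - u)) * abk v c)%:E)%E.
  have m0 (y : R) : 0 <= Num.max y 0 by rewrite le_max lexx orbT.
  have n1 c : `]u, v[%classic c -> (0 <= (Num.max (H c) 0 * abk v c)%:E)%E.
    by move=> _; rewrite lee_fin mulr_ge0 ?m0 ?abk_ge0.
  have n2 c : `]u, v[%classic c -> (0 <= (Num.max (- H c) 0 * abk v c)%:E)%E.
    by move=> _; rewrite lee_fin mulr_ge0 ?m0 ?abk_ge0.
  have n3 c : `]u, v[%classic c -> (0 <= (C * (c - u) * abk v c)%:E)%E.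
    by move=> cI; rewrite lee_fin; apply: mulr_ge0; [exact: Cc0|exact: abk_ge0].
  have n4 c : `]u, v[%classic c -> (0 <= ((H c + C * (c - u)) * abk v c)%:E)%E.
    by move=> cI; rewrite lee_fin; apply: mulr_ge0; [exact: HC0|exact: abk_ge0].
  move/measurable_EFinP in iH; move/measurable_EFinP in iH'.
  move/measurable_EFinP in iC; move/measurable_EFinP in iHC.
  rewrite -[LHS]ge0_integralD// -[RHS]ge0_integralD//.
  apply: eq_integral => c _; rewrite -!EFinD; congr EFin.
  rewrite -!mulrDl; congr (_ * _).
  rewrite !maxEle; case: ifPn => h1; case: ifPn => h2; move: h1 h2; move: (H c) (C * _) => a b; lra.
rewrite eC eG in key; apply: (ereal_le_cancel fC _ key).
by rewrite lee_fin mulr_ge0.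
Qed.

End leading_edge2.

(** * End points provided by the two edges *)

Section good_points.
Context {R : realType}.
Local Notation mu := (@lebesgue_measure R).
Context (f : R -> R).

(* The support of the minimizer will be [[0, sqrt u]].  At the end point [u] the
   hodograph equation holds, the candidate density is nonnegative on the support, and
   the last item says that no mass can be gained beyond it. *)
Definition good_endpoint (t x u : R) : Prop :=
  [/\ 0 < u < 1, hodo f t x u = 0,
   forall xi, 0 < xi < u -> 0 <= Phi0 f t xi u,
   exists z, forall xi, 0 < xi < u -> xi != z -> 0 < Phi0 f t xi u &
   forall v, u < v < 1 ->
     (\int[mu]_(c in `]u, v[) (Num.max (- hodo f t x c) 0 * abk v c)%:E <=
      \int[mu]_(c in `]u, v[) (Num.max (hodo f t x c) 0 * abk v c)%:E)%E].

Hypothesis hf_smooth : smooth_on (@I01 R) f.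
Hypothesis hf_neg : forall u : R, 0 < u < 1 -> derive1 f u < 0.
Hypothesis hf_0 : f u @[u --> 0^'+] --> +oo.
Hypothesis hf_1 : f u @[u --> 1^'-] --> -oo.

(** Here [Hprime >= 0] beyond [u], so [hodo] is nonnegative there and its negative part is 0. *)
Lemma good_endpoint_trailing (Tm : R) (u1m u3m xm : R -> R) (t x : R) :
  (exists eps : R, 0 < eps /\
     forall u : R, 0 < u < 1 -> (u < eps \/ 1 - eps < u) -> derive1n 3 f u < 0) ->
  0 < Tm ->
  (forall t : R, Tm < t ->
     0 < u3m t /\ u3m t < u1m t /\ u1m t < 1 /\
     trailing_sys f t (u1m t) (u3m t) (xm t)) ->
  (forall t u1 u3 x : R, Tm < t -> 0 < u3 -> u3 < u1 -> u1 < 1 ->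
     trailing_sys f t u1 u3 x -> u1 = u1m t /\ u3 = u3m t /\ x = xm t) ->
  (forall s t : R, Tm < s -> s < t -> u1m s < u1m t) ->
  Tm < t -> x <= xm t -> exists u, good_endpoint t x u.
Proof.
move=> hf3 hTm hsol huniq hincr Tt xx.
have [u [u01 Hu P0 P1 Hp]] := good_trailing hf_smooth hf_neg hf_0 hf_1 hf3 hTm hsol huniq hincr Tt xx.
exists u; split => // v /andP[uv v1].
have [u0 _] := andP u01.
have cH : {in `]0, 1[, continuous (hodo f t x)} by exact: continuous_hodo.
have in01 y : u <= y -> y < v -> y \in `]0, 1[.
  by move=> h1 h2; rewrite in_itv/= (lt_le_trans u0 h1) (lt_trans h2).
have sub : `]u, v[ `<=` `]0, 1[.
  by move=> y; rewrite /= in_itv/= => /andP[h1 h2]; apply: in01; rewrite ?ltW.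
have mH : measurable_fun (`]u, v[ : set R) (hodo f t x) by apply: (continuous_measurable_oo cH).
apply: ge0_le_integral => //.
- by move=> c _; rewrite lee_fin mulr_ge0 ?abk_ge0// le_max lexx orbT.
- apply/measurable_EFinP; apply: measurable_funM; last exact: measurable_abk.
  by apply: measurable_maxr => //; exact: measurableT_comp.
- apply/measurable_EFinP; apply: measurable_funM; last exact: measurable_abk.
  exact: measurable_maxr.
move=> c; rewrite /= in_itv/= => /andP[uc cv]; rewrite lee_fin.
apply: ler_wpM2r; first exact: abk_ge0.
have [||z] := @MVT _ (hodo f t x) (Hprime f t) u c uc.
- move=> y; rewrite in_itv/= => /andP[h1 h2]; apply: is_derive_hodo => //.
  by apply: in01; rewrite ?ltW// (lt_trans h2).
- apply: continuous_in_subspaceT => y; rewrite inE/= in_itv/= => /andP[h1 h2].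
  by apply: cH; apply: in01 => //; exact: le_lt_trans cv.
rewrite in_itv/= => /andP[uz zc]; rewrite [hodo f t x u]Hu subr0 => e.
have H0 : 0 <= hodo f t x c.
  rewrite e; apply: mulr_ge0; last by rewrite subr_ge0 ltW.
  by apply: Hp; rewrite (ltW uz) (lt_trans zc (lt_trans cv v1)).
by rewrite (max_r (_ : - _ <= 0)) ?oppr_le0// le_max lexx orbT.
Qed.

(** [hodo] is negative near 0 and nonnegative at [u3p t], which gives a zero [u]. There [Hprime] is
    nonnegative, and it is decreasing, so it is positive on [(0, u)]; hence [Phi0 > 0] with no
    exceptional point. *)
Lemma good_endpoint_leading (delta2 Tp : R) (u1p u3p xp : R -> R) (t x : R) :
  0 < delta2 ->
  (forall u : R, 0 < u < delta2 -> 0 < derive1n 2 f u) ->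
  0 < t ->
  (forall t : R, Tp < t ->
     0 < u3p t /\ u3p t < u1p t /\ u1p t < 1 /\
     leading_sys f t (u1p t) (u3p t) (xp t)) ->
  (forall t u1 u3 x : R, Tp < t -> 0 < u3 -> u3 < u1 -> u1 < 1 ->
     leading_sys f t u1 u3 x -> u1 = u1p t /\ u3 = u3p t /\ x = xp t) ->
  u3p t < delta2 ->
  Tp < t -> xp t <= x -> exists u, good_endpoint t x u.
Proof.
move=> hd hf2 t0 hsol huniq u3d Tt xx.
have [u30 [u3u1 [u11 [_ _ e3]]]] := hsol _ Tt.
have u31 := lt_trans u3u1 u11.
set u3 := u3p t in u30 u3u1 u31 e3 u3d.
have [a1 /andP[a10 a11] ha1] := profile_large hf_0 (`|x|).
have [a [a0 aa1 au3]] := exists_pos_lt2 a10 u30.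
have cg : {within `[a, u3], continuous (hodo f t x)}.
  apply: continuous_in_subspaceT => y; rewrite inE/= in_itv/= => /andP[h1 h2].
  by apply: continuous_hodo => //; rewrite in_itv/= (lt_le_trans a0)//= (le_lt_trans h2).
have [u uI Hu] : exists2 u, u \in `[a, u3] & hodo f t x u = 0.
  apply: IVT => //; first exact: ltW.
  rewrite ge_min le_max; apply/andP; split; apply/orP.
    left; rewrite /hodo.
    have : `|x| < f a by apply: ha1; rewrite a0 ltW.
    have := ler_norm x.
    have : 0 <= t * a ^+ 2 by rewrite mulr_ge0 ?sqr_ge0// ltW.
    by move: (f a) (`|x|) => p q; lra.
  by right; rewrite /hodo; move: e3 xx; move: (f u3) (xp t) (u3 ^+ 2) => p q r; lra.
move: uI; rewrite in_itv/= => /andP[au uu3].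
have u0 : 0 < u by exact: lt_le_trans au.
have u1 : u < 1 by exact: le_lt_trans u31.
have Hu0 : 0 <= Hprime f t u by apply: (@Hprime_ge0_leading _ f _ _ _ _ delta2 _ _ t _ Tp u1p u3p xp).
have P xi : 0 < xi < u -> 0 < Phi0 f t xi u.
  move=> /andP[xi0 xiu]; rewrite /Phi0.
  have cG : {in `]0, 1[, continuous (Hprime f t)} by exact: continuous_Hprime.
  have ud : u < delta2 by exact: le_lt_trans u3d.
  have pos y : 0 < y -> y < u -> 0 < Hprime f t y.
    by move=> y0 yu; apply: (le_lt_trans Hu0); apply: Hprime_decr ud u1.
  apply: (@avg_op_gt0_left _ _ _ ((xi + u) / 2)) => //; try lra.
  - by move=> y /andP[h1 h2]; apply: pos; lra.
  - move=> y /andP[h1 h2]; have [->//|ne] := eqVneq y u.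
    by apply/ltW/pos; [exact: lt_le_trans h1|rewrite lt_neqAle ne].
exists u; split.
- by rewrite u0.
- by [].
- by move=> xi /P/ltW.
- by exists 0 => xi /P.
- move=> v /andP[uv v1]; apply: Jlead_outer => //.
  by apply: (@Jlead_ge0 _ f _ _ _ _ delta2 _ _ t _ Tp u1p u3p xp).
Qed.

End good_points.

(** * The energy in terms of the Abel transform *)

Section abel_transform.
Context {R : realType}.
Local Notation mu := (@lebesgue_measure R).
Local Notation I01 := (@I01 R).
Implicit Types (psi : R -> R) (K : R -> \bar R) (D : set R).

Definition abel psi (c : R) : \bar R := (\int[mu]_(eta in I01) (psi eta * abk (eta ^+ 2) c)%:E)%E.

Lemma measurable_I01 : measurable I01.
Proof. by rewrite /Defs.I01. Qed.
Let mI := measurable_I01.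

Let measurable_ker (D : set R) psi : measurable D -> measurable_fun I01 psi ->
  measurable_fun (I01 `*` D) (fun z : R * R => (psi z.1 * abk (z.1 ^+ 2) z.2)%:E).
Proof.
move=> mD mpsi; apply/measurable_EFinP; apply: measurable_funM; last first.
  by apply: measurable_abk; apply: measurable_funTS => //; apply: measurable_funX.
apply: (measurable_comp (F := I01)) => //; first by move=> _ [z [z1 z2] <-].
exact: measurable_funTS.
Qed.

Lemma abel_ge0 psi c : (forall eta, I01 eta -> 0 <= psi eta) -> (0 <= abel psi c)%E.
Proof. by move=> p0; apply: integral_ge0 => eta /p0 h; rewrite lee_fin mulr_ge0 ?abk_ge0. Qed.

Lemma measurable_abel D psi : measurable D -> measurable_fun I01 psi ->
  (forall eta, I01 eta -> 0 <= psi eta) -> measurable_fun D (abel psi).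
Proof.
move=> mD mpsi p0.
apply: (measurable_int_fst (f := fun z => (psi z.1 * abk (z.1 ^+ 2) z.2)%:E)) => //.
  exact: measurable_ker.
by move=> z [/p0 z1 z2]; rewrite lee_fin mulr_ge0 ?abk_ge0.
Qed.

(** Tonelli, in the form of an adjoint relation: the kernel is moved from [psi] to the weight
    [K]. *)
Lemma int_abel_transform D K psi : measurable D -> measurable_fun I01 psi ->
  (forall eta, I01 eta -> 0 <= psi eta) -> measurable_fun D K -> (forall c, D c -> (0 <= K c)%E) ->
  (\int[mu]_(c in D) (K c * abel psi c) =
   \int[mu]_(eta in I01) ((psi eta)%:E * \int[mu]_(c in D) (K c * (abk (eta ^+ 2) c)%:E)))%E.
Proof.
move=> mD mpsi p0 mK K0.
pose F (z : R * R) : \bar R := (K z.2 * (psi z.1 * abk (z.1 ^+ 2) z.2)%:E)%E.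
have mF : measurable_fun (I01 `*` D) F.
  apply: emeasurable_funM; last exact: measurable_ker.
  apply: (measurable_comp (F := D)) => //; first by move=> _ [z [z1 z2] <-].
  exact: measurable_funTS.
have F0 z : (I01 `*` D) z -> (0 <= F z)%E.
  by move=> [z1 z2]; rewrite mule_ge0 ?K0// lee_fin mulr_ge0 ?abk_ge0 ?p0.
transitivity (\int[mu]_(c in D) \int[mu]_(eta in I01) F (eta, c))%E.
  apply: eq_integral => c /[1!inE] Dc; rewrite /F/= ge0_integralZl//.
  - apply/measurable_EFinP; apply: measurable_funM => //.
    by apply: measurable_abk => //; apply: measurable_funTS; apply: measurable_funX.
  - by move=> eta /p0 h; rewrite lee_fin mulr_ge0 ?abk_ge0.
  - exact: K0.
rewrite -(tonelli_set mI mD mF F0).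
apply: eq_integral => eta /[1!inE] Ie; rewrite /F/= -ge0_integralZl//.
- by apply: eq_integral => c _; rewrite EFinM muleCA.
- apply: emeasurable_funM => //; apply/measurable_EFinP.
  by apply: measurable_abk.
- by move=> c Dc; rewrite mule_ge0 ?K0// lee_fin abk_ge0.
- by rewrite lee_fin p0.
Qed.

Lemma int_abk_abk (eta m : R) : I01 eta -> I01 m -> eta != m ->
  (\int[mu]_(c in I01) ((abk (eta ^+ 2) c)%:E * (abk (m ^+ 2) c)%:E) =
   (ln ((eta + m) / `|eta - m|))%:E)%E.
Proof.
wlog em : eta m / eta < m.
  move=> wl I1 I2 ne; have [em|me] := ltP eta m; first exact: wl.
  under eq_integral do rewrite muleC.
  by rewrite wl// 1?eq_sym// ?lt_neqAle 1?eq_sym ?ne// addrC distrC.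
rewrite /Defs.I01/= !in_itv/= => /andP[e0 e1] /andP[m0 m1] _.
rewrite (@integral_shrink _ _ `]0, (eta ^+ 2)%R[%classic); last 2 first.
- move=> c; rewrite /= !in_itv/= => /andP[-> h]; apply: (lt_trans h).
  by rewrite expr_lt1// ltW.
- move=> c; rewrite /= !in_itv/= => /andP[-> _] /= /negP; rewrite -leNgt => h.
  by rewrite abk_le0// mul0e.
rewrite ltr0_norm ?subr_lt0// opprB -(int_abk_log e0 em).
by under eq_integral do rewrite -EFinM.
Qed.

(* the logarithmic kernel is the square of the Abel kernel: see [int_abk_log] *)
Lemma quad_energyE psi : measurable_fun I01 psi -> (forall eta, I01 eta -> 0 <= psi eta) ->
  quad_energy psi = ((2 * pi)^-1%:E * \int[mu]_(c in I01) (abel psi c * abel psi c))%E.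
Proof.
move=> mpsi p0.
have k0 : 0 <= (2 * pi)^-1 :> R by rewrite invr_ge0 mulr_ge0// pi_ge0.
have mA : measurable_fun I01 (abel psi) by exact: measurable_abel.
have A0 c : I01 c -> (0 <= abel psi c)%E by move=> _; exact: abel_ge0.
have mab (eta : R) : measurable_fun I01 (fun c => (abk (eta ^+ 2) c)%:E).
  by apply/measurable_EFinP; apply: measurable_abk.
have ab0 (eta c : R) : (0 <= (abk (eta ^+ 2) c)%:E)%E by rewrite lee_fin abk_ge0.
rewrite (int_abel_transform mI mpsi p0 mA A0) -ge0_integralZl//; last 2 first.
- apply: emeasurable_funM; first exact/measurable_EFinP.
  under eq_fun do under eq_integral do rewrite muleC.
  apply: (measurable_int_snd (f := fun z => ((abk (z.1 ^+ 2) z.2)%:E * abel psi z.2)%E)) => //.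
    apply: emeasurable_funM.
      apply/measurable_EFinP; apply: measurable_abk; apply: measurable_funTS => //.
      exact: measurable_funX.
    apply: (measurable_comp (F := I01)) => //; first by move=> _ [z [z1 z2] <-].
    exact: measurable_funTS.
  by move=> z [z1 z2]; rewrite mule_ge0 ?A0 ?ab0.
- move=> eta Ie; rewrite mule_ge0 ?lee_fin ?p0//; apply: integral_ge0 => c Ic.
  by rewrite mule_ge0 ?A0 ?ab0.
apply: eq_integral => eta /[1!inE] Ie.
under [in RHS]eq_integral do rewrite muleC.
rewrite (int_abel_transform mI mpsi p0 (mab eta) (fun c _ => ab0 eta c)).
rewrite muleA -EFinM -ge0_integralZl//; last 3 first.
- apply: emeasurable_funM; first exact/measurable_EFinP.
  apply: (measurable_int_snd
    (f := fun z => ((abk (eta ^+ 2) z.2)%:E * (abk (z.1 ^+ 2) z.2)%:E)%E)) => //.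
    apply: emeasurable_funM; apply/measurable_EFinP; apply: measurable_abk;
      apply: measurable_funTS => //; exact: measurable_funX.
  by move=> z _; rewrite mule_ge0.
- move=> m Im; rewrite mule_ge0 ?lee_fin ?p0//; apply: integral_ge0 => c Ic.
  by rewrite mule_ge0.
- by rewrite lee_fin mulr_ge0 ?p0.
(* The diagonal [m = eta] is left out as a null set: there the Abel integral is infinite, whereas
   [ln] takes its default value at 0. *)
have eqk m : (I01 `\ eta) m ->
   ((- (2 * pi)^-1 * ln (`|eta - m| / `|eta + m|)) * psi eta * psi m)%:E =
   (((2 * pi)^-1 * psi eta)%:E * ((psi m)%:E *
      \int[mu]_(c in I01) ((abk (eta ^+ 2) c)%:E * (abk (m ^+ 2) c)%:E)))%E.
  move=> [Im /= /eqP ne]; rewrite int_abk_abk// 1?eq_sym// -!EFinM; congr EFin.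
  move: Ie Im; rewrite /Defs.I01/= !in_itv/= => /andP[e0 _] /andP[m0 _].
  have d0 : 0 < `|eta - m| by rewrite normr_gt0 subr_eq0 eq_sym.
  rewrite (gtr0_norm (addr_gt0 e0 m0)) -invf_div lnV ?posrE ?divr_gt0 ?addr_gt0//; ring.
have mk : measurable_fun (I01 `\ eta) (fun m =>
   ((- (2 * pi)^-1 * ln (`|eta - m| / `|eta + m|)) * psi eta * psi m)%:E).
  apply/measurable_EFinP; apply: measurable_funM; last first.
    exact: measurable_funS mpsi.
  apply: measurable_funTS; do 2 apply: measurable_funM => //.
  apply: (measurableT_comp (@measurable_ln R)); apply: measurable_funM.
    by apply: (measurableT_comp (@normr_measurable R setT)); exact: measurable_funB.
  apply: (measurableT_comp (@measurable_inv R)).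
  by apply: (measurableT_comp (@normr_measurable R setT)); exact: measurable_funD.
have mIe : measurable (I01 `\ eta) by exact: measurableD.
rewrite -[LHS](integral_setD1 mIe mk) -[RHS](@integral_setD1 _ _ eta)//.
  by apply: eq_integral => m /[1!inE] /eqk.
by apply: eq_measurable_fun mk => m /[1!inE] /eqk.
Qed.

End abel_transform.

(** * Integrals with a real value *)

Section has_integral.
Context d (T : measurableType d) (R : realType) (mu : {measure set T -> \bar R}).
Implicit Types (D : set T) (g h : T -> R) (r s : R).

(** Integrability and value travel together, so that identities for signed functions follow from
    nonnegative ones by linear combination, without indeterminate sums. *)
Definition has_int D g r := [/\ measurable D, mu.-integrable D (EFin \o g) &
  (\int[mu]_(x in D) (g x)%:E = r%:E)%E].

Lemma has_int_ge0 D g r : measurable D -> measurable_fun D g -> (forall x, D x -> 0 <= g x) ->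
  (\int[mu]_(x in D) (g x)%:E = r%:E)%E -> has_int D g r.
Proof.
move=> mD mg g0 e; split => //; apply/integrableP; split; first exact/measurable_EFinP.
rewrite (_ : (\int[mu]_(x in D) _)%E = r%:E) ?ltry// -e.
by apply: eq_integral => x /[1!inE] /g0 h; rewrite /= ger0_norm.
Qed.

Lemma has_intD D g h r s : has_int D g r -> has_int D h s ->
  has_int D (fun x => g x + h x) (r + s).
Proof.
move=> [mD ig eg] [_ ih eh]; split => //; first exact: (integrableD mD ig ih).
by rewrite EFinD -eg -eh -integralD.
Qed.

Lemma has_intZ D g r k : has_int D g r -> has_int D (fun x => k * g x) (k * r).
Proof.
move=> [mD ig eg]; split => //; first exact: (integrableZl mD k ig).
by rewrite EFinM -eg -integralZl.
Qed.

Lemma eq_has_int D g h r : (forall x, D x -> g x = h x) -> has_int D g r -> has_int D h r.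
Proof.
move=> gh [mD ig eg]; split => //.
  by apply: eq_integrable ig => // x /[1!inE] /gh /= ->.
by rewrite -eg; apply: eq_integral => x /[1!inE] /gh ->.
Qed.

Lemma has_int_fine D g : measurable D -> mu.-integrable D (EFin \o g) ->
  has_int D g (\int[mu]_(x in D) g x).
Proof. by move=> mD ig; split => //; rewrite /Rintegral fineK//; exact: integrable_fin_num. Qed.

End has_integral.

(** * Abel representation of the external field *)

Section potential.
Context {R : realType}.
Local Notation mu := (@lebesgue_measure R).
Local Notation I01 := (@I01 R).
Context (u0 f : R -> R).
Hypothesis hu0_range : forall y : R, 0 < u0 y < 1.
Hypothesis hu0_smooth : smooth u0.
Hypothesis hu0_decr : forall y z : R, y < z -> u0 z < u0 y.
Hypothesis hf_inv1 : forall y : R, f (u0 y) = y.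
Hypothesis hf_inv2 : forall u : R, 0 < u < 1 -> u0 (f u) = u.
Hypothesis hf_smooth : smooth_on I01 f.
Hypothesis hf_neg : forall u : R, 0 < u < 1 -> derive1 f u < 0.

Lemma int_abk_0 (p s : R) : 0 < s -> s <= p ->
  (\int[mu]_(c in `]0%R, s[) (abk p c)%:E = (2 * (Num.sqrt p - Num.sqrt (p - s)))%:E)%E.
Proof.
move=> s0 sp.
rewrite (_ : 2 * _ = -2 * Num.sqrt (p - s) - (-2 * Num.sqrt (p - 0))); last first.
  by rewrite subr0; ring.
apply: (@ge0_FTC2_oo _ (abk p) (fun c => -2 * Num.sqrt (p - c))); first exact: s0.
- by move=> c; rewrite in_itv/= => /andP[_ cs]; apply: abk_continuous_r; exact: lt_le_trans sp.
- by move=> c _; exact: abk_ge0.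
- apply: continuous_subspaceT => c; apply: cvgM; first exact: cvg_cst.
  exact: sqrt_sub_continuous.
- move=> c; rewrite in_itv/= => /andP[_ cs].
  have := is_deriveZ (-2) (is_derive_sqrt_sub (lt_le_trans cs sp)).
  rewrite (_ : _ *: _ = abk p c); first exact.
  by rewrite /GRing.scale/=; field.
Qed.

Lemma lt_u0 (c y : R) : 0 < c < 1 -> (c < u0 y) = (y < f c).
Proof.
move=> c01; have [yc|cy] := ltP y (f c).
  by rewrite -(hf_inv2 c01) hu0_decr.
apply/negbTE; rewrite -leNgt -(hf_inv2 c01).
by move: cy; rewrite le_eqVlt => /predU1P[->//|/hu0_decr/ltW].
Qed.

Lemma measurable_u0 : measurable_fun setT u0.
Proof.
have du (y : R) : derivable u0 y 1 := @hu0_smooth 0%N y.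
apply: continuous_measurable_fun => y.
by have /derivable1_diffP/differentiable_continuous := du y.
Qed.

Lemma measurable_f : measurable_fun I01 f.
Proof.
have cf : {in `]0, 1[, continuous f}.
  by move=> y y01; have /derivable1_diffP/differentiable_continuous := @ex_derive _ _ _ _ _ _ _ (is_derive_profile hf_smooth 0 y01).
by apply: (@continuous_measurable_oo _ f 0 1 _ cf) => //; exact: measurable_I01.
Qed.

Lemma f_diff_ge0 (p c : R) : I01 p -> I01 c -> 0 <= (f c - f p) * abk p c.
Proof.
rewrite /Defs.I01/= !in_itv/= => /andP[p0 p1] /andP[c0 c1].
have [cp|pc] := ltP c p; last by rewrite abk_le0// mulr0.
by rewrite mulr_ge0 ?abk_ge0// subr_ge0 ltW// profile_decr.
Qed.

(** Write [eta - sqrt (eta^2 - u0 y)] as half the integral of the Abel kernel over [(0, u0 y)] and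
    exchange the integrals: [c < u0 y] means [y < f c], so [y] ranges over an interval of length
    [f c - f (eta^2)]. *)
Lemma theta_tail (eta : R) : I01 eta ->
  (\int[mu]_(y in `[(f (eta ^+ 2))%R, +oo[) (eta - Num.sqrt (eta ^+ 2 - u0 y))%:E =
   (2^-1)%:E * \int[mu]_(c in I01) ((f c - f (eta ^+ 2)) * abk (eta ^+ 2) c)%:E)%E.
Proof.
move=> Ie; have := Ie; rewrite /Defs.I01/= in_itv/= => /andP[e0 e1].
set p := eta ^+ 2.
have p0 : 0 < p by rewrite exprn_gt0.
have p1 : p < 1 by rewrite expr_lt1// ltW.
have p01 : 0 < p < 1 by rewrite p0.
have ep : eta = Num.sqrt p by rewrite /p sqrtr_sqr gtr0_norm.
pose F (z : R * R) : \bar R := ((z.2 < u0 z.1)%R%:R * abk p z.2)%:E.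
pose D : set R := `[f p, +oo[%classic.
have mF : measurable_fun (D `*` `]0%R, p[) F.
  apply/measurable_EFinP; apply: measurable_funTS; apply: measurable_funM; last exact: measurable_abk.
  rewrite (_ : (fun z : R * R => _) = (fun z => if (z.2 < u0 z.1)%R then 1 else 0)); last first.
    by apply/funext => z; case: ifP.
  apply: measurable_fun_ifT => //; apply: measurable_fun_ltr => //.
  by apply: (measurableT_comp measurable_u0).
have F0 z : (D `*` `]0%R, p[) z -> (0 <= F z)%E by move=> _; rewrite lee_fin mulr_ge0 ?abk_ge0.
have E1 y : D y -> (\int[mu]_(c in `]0%R, p[) F (y, c) = (2 * (eta - Num.sqrt (p - u0 y)))%:E)%E.
  rewrite /D/= in_itv/= andbT => fy.
  have up : u0 y <= p.
    rewrite -(hf_inv2 p01); move: fy; rewrite le_eqVlt => /predU1P[->//|/hu0_decr/ltW//].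
  have /andP[uy0 _] := hu0_range y.
  rewrite ep -int_abk_0// [LHS](@integral_shrink _ _ `]0, (u0 y)%R[%classic).
  - by apply: eq_integral => c; rewrite inE/= in_itv/= => /andP[_ h]; rewrite /F/= h mul1r.
  - by move=> c; rewrite /= !in_itv/= => /andP[-> h]; exact: lt_le_trans up.
  - move=> c; rewrite /= !in_itv/= => /andP[-> _] /= /negP/negbTE h.
    by rewrite /F/= h mul0r.
have E2 c : `]0, p[%classic c -> (\int[mu]_(y in D) F (y, c) = ((f c - f p) * abk p c)%:E)%E.
  rewrite /= in_itv/= => /andP[c0 cp].
  have c01 : 0 < c < 1 by rewrite c0 (lt_trans cp).
  rewrite [LHS](@integral_shrink _ _ `[(f p), (f c)%R[%classic).
  - transitivity (\int[mu]_(y in `[f p, f c[) (cst (abk p c)%:E y))%E.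
      by apply: eq_integral => y; rewrite inE/= in_itv/= => /andP[_ h]; rewrite /F/= lt_u0// h mul1r.
    rewrite integral_cst// [X in (_ * X)%E](_ : _ = (f c - f p)%:E); first by rewrite -EFinM mulrC.
    by rewrite [LHS]lebesgue_measure_itv/= lte_fin profile_decr// -EFinB.
  - by move=> y; rewrite /D/= !in_itv/= => /andP[-> _].
  - move=> y; rewrite /D/= !in_itv/= andbT => -> /= /negP/negbTE h.
    by rewrite /F/= lt_u0// h mul0r.
have mD : measurable D by rewrite /D.
have mg : measurable_fun D (fun y => (eta - Num.sqrt (p - u0 y))%:E).
  apply/measurable_EFinP; apply: measurable_funTS; apply: measurable_funB => //.
  apply: (measurableT_comp (f := @Num.sqrt R)); last exact: measurable_funB measurable_u0.
  by apply: continuous_measurable_fun => y; exact: sqrt_continuous.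
have e := tonelli_set mD (measurable_itv _) mF F0.
rewrite (@integral_shrink _ I01 `]0, p[%classic); last 2 first.
- by move=> c; rewrite /Defs.I01/= !in_itv/= => /andP[-> h]; exact: lt_trans p1.
- move=> c; rewrite /Defs.I01/= !in_itv/= => /andP[-> _] /= /negP; rewrite -leNgt => h.
  by rewrite (abk_le0 h) mulr0.
have <- : (\int[mu]_(c in `]0%R, p[) \int[mu]_(y in D) F (y, c) =
   \int[mu]_(c in `]0%R, p[) ((f c - f p) * abk p c)%:E)%E.
  by apply: eq_integral => c /[1!inE] /E2.
rewrite -e.
transitivity ((2^-1)%:E * \int[mu]_(y in D) (2%:E * (eta - Num.sqrt (p - u0 y))%:E))%E; last first.
  by congr (_ * _)%E; apply: eq_integral => y /[1!inE] /E1 ->; rewrite EFinM.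
have g0 y : D y -> (0 <= (eta - Num.sqrt (p - u0 y))%:E)%E.
  move=> _; have /andP[uy0 _] := hu0_range y.
  by rewrite lee_fin subr_ge0 ep; apply: ler_wsqrtr; rewrite gerBl ltW.
have -> : (\int[mu]_(y in D) (2%:E * (eta - Num.sqrt (p - u0 y))%:E) =
           2%:E * \int[mu]_(y in D) (eta - Num.sqrt (p - u0 y))%:E)%E.
  exact: ge0_integralZl.
rewrite muleA -EFinM mulVf; last by [].
by rewrite mul1e.
Qed.

Lemma measurable_fsqr : measurable_fun I01 (fun eta : R => f (eta ^+ 2)).
Proof.
apply: (measurable_comp (F := I01) (f := f)) => //.
- by rewrite /Defs.I01.
- move=> _ [y + <-]; rewrite /Defs.I01/= !in_itv/= => /andP[y0 y1].
  by rewrite exprn_gt0// expr_lt1// ltW.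
- exact: measurable_f.
Qed.

Lemma sqr_I01 (eta : R) : I01 eta -> I01 (eta ^+ 2).
Proof.
by rewrite /Defs.I01/= !in_itv/= => /andP[y0 y1]; rewrite exprn_gt0// expr_lt1// ltW.
Qed.

(** [Rintegral] is the finite part of an extended integral, with value 0 if that is infinite, so the
    tail of [theta] is measurable without any growth bound on [f]. *)
Lemma measurable_a_fun (x t : R) : measurable_fun I01 (fun eta => a_fun u0 f eta x t).
Proof.
pose T (eta : R) := (\int[mu]_(c in I01) ((f c - f (eta ^+ 2)) * abk (eta ^+ 2) c)%:E)%E.
have mI : measurable I01 by rewrite /Defs.I01.
have mT : measurable_fun I01 T.
  apply: (measurable_int_snd
    (f := fun z => ((f z.2 - f (z.1 ^+ 2)) * abk (z.1 ^+ 2) z.2)%:E)) => //; last first.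
    by move=> z [/sqr_I01 z1 z2]; rewrite lee_fin f_diff_ge0.
  apply/measurable_EFinP; apply: measurable_funM; last first.
    by apply: measurable_abk; apply: measurable_funTS => //; exact: measurable_funX.
  apply: measurable_funB.
    apply: (measurable_comp (F := I01) (f := f)) => //; first by move=> _ [z [z1 z2] <-].
      exact: measurable_f.
    exact: measurable_funTS.
  apply: (measurable_comp (F := I01) (f := fun eta => f (eta ^+ 2))) => //.
  - by move=> _ [z [z1 z2] <-].
  - exact: measurable_fsqr.
  - exact: measurable_funTS.
pose g (eta : R) : R := eta * x - 16 * eta ^+ 5 * t -
   (eta * f (eta ^+ 2) + fine ((2^-1)%:E * T eta)%E).
have mg : measurable_fun I01 g.
  apply: measurable_funB; last first.
    apply: measurable_funD; first exact: measurable_funM measurable_fsqr.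
    apply: (measurableT_comp (f := fine)) => //; exact: measurable_funeM.
  apply: measurable_funTS; apply: measurable_funB; apply: measurable_funM => //.
  by apply: measurable_funM => //; exact: measurable_funX.
apply: eq_measurable_fun mg => eta /[1!inE] Ie.
by rewrite /a_fun /theta /Rintegral theta_tail.
Qed.

Lemma theta_ge (eta : R) : I01 eta -> eta * f (eta ^+ 2) <= theta u0 f eta.
Proof.
move=> Ie; rewrite /theta lerDl /Rintegral theta_tail// fine_ge0// mule_ge0 ?lee_fin//.
by apply: integral_ge0 => c Ic; rewrite lee_fin f_diff_ge0//; exact: sqr_I01.
Qed.

Section bounded_growth.
Context (B : R).
Hypothesis hB : forall c, I01 c -> f c <= B * abk c 0.

(* Abel representation of the potential: [2 a(eta) = \int_0^{eta^2} H(c) (eta^2 - c)^{-1/2} dc],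
   with [C c^{-1/2}] added to [H] so that every integral is that of a nonnegative function *)
Lemma a_funE (x t C eta : R) : I01 eta ->
  (\int[mu]_(c in I01) ((hodo f t x c + C * abk c 0) * abk (eta ^+ 2) c)%:E =
   (2 * a_fun u0 f eta x t + C * pi)%:E)%E.
Proof.
move=> Ie; have := Ie; rewrite /Defs.I01/= in_itv/= => /andP[e0 e1].
set p := eta ^+ 2.
have p0 : 0 < p by rewrite exprn_gt0.
have p1 : p < 1 by rewrite expr_lt1// ltW.
have Ip : I01 p by exact: sqr_I01.
have ep : Num.sqrt p = eta by rewrite /p sqrtr_sqr gtr0_norm.
have sub : `]0, p[%classic `<=` I01.
  by move=> c; rewrite /Defs.I01/= !in_itv/= => /andP[-> h]; exact: lt_trans p1.
have shr g : (\int[mu]_(c in I01) (g c * abk p c)%:E = \int[mu]_(c in `]0%R, p[) (g c * abk p c)%:E)%E.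
  apply: integral_shrink => // c; rewrite /Defs.I01/= !in_itv/= => /andP[-> _] /= /negP.
  by rewrite -leNgt => h; rewrite (abk_le0 h) mulr0.
have mab : measurable_fun (`]0, p[ : set R) (abk p) by apply: measurable_abk.
have mab0 : measurable_fun (`]0, p[ : set R) (abk ^~ 0) by apply: measurable_abk.
have mf : measurable_fun (`]0, p[ : set R) f by apply: measurable_funS measurable_f; rewrite /Defs.I01.
pose D : set R := `]0, p[%classic.
have mD : measurable D by rewrite /D.
have h1 : has_int mu D (abk p) (2 * eta).
  apply: has_int_ge0 => //; first by move=> c _; exact: abk_ge0.
  by rewrite /D int_abk_r// subr0 ep.
have h2 : has_int mu D (fun c => c ^+ 2 * abk p c) (16 / 15 * p ^+ 2 * eta).
  apply: has_int_ge0 => //.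
  - by apply: measurable_funM => //; apply: measurable_funTS; exact: measurable_funX.
  - by move=> c _; rewrite mulr_ge0 ?abk_ge0 ?sqr_ge0.
  - by rewrite /D int_abk_sqr// ep.
have h3 : has_int mu D (fun c => abk p c * abk c 0) pi.
  apply: has_int_ge0 => //; first exact: measurable_funM.
  - by move=> c _; rewrite mulr_ge0 ?abk_ge0.
  - exact: int_abk_beta.
pose g c := (f c - f p) * abk p c.
have g0 c : D c -> 0 <= g c by move=> /sub Ic; exact: f_diff_ge0.
have mg : measurable_fun D g by apply: measurable_funM => //; exact: measurable_funB.
(* The growth bound on [f] enters here: [f c - f p] is at most [B c^(-1/2) - f p], whose Abel
   integral converges. *)
have ig : mu.-integrable D (EFin \o g).
  have [_ ib _] := has_intD (has_intZ B h3) (has_intZ (- f p) h1).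
  apply: le_integrable ib => //; first exact/measurable_EFinP.
  move=> c Dc /=; rewrite lee_fin ger0_norm ?g0//; apply: le_trans (ler_norm _).
  rewrite (_ : _ + _ = (B * abk c 0 - f p) * abk p c); last by ring.
  by rewrite /g ler_wpM2r ?abk_ge0// lerB//; exact/hB/sub.
have h4 : has_int mu D g (\int[mu]_(c in D) g c) by apply: has_int_fine.
have e4 : \int[mu]_(c in D) g c = 2 * (theta u0 f eta - eta * f p).
  have := theta_tail Ie; rewrite -/p (shr (fun c => f c - f p)) -/D => e.
  rewrite /theta -/p addrAC subrr add0r /Rintegral e fineM//; last exact: integrable_fin_num ig.
  by rewrite /= mulrA divff// mul1r.
rewrite shr.
have h5 := has_intD (has_intD (has_intD (has_intZ (x - f p) h1)
  (has_intZ (- (30 * t)) h2)) (has_intZ C h3)) (has_intZ (-1) h4).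
have [_ _ <-] : has_int mu D (fun c => (hodo f t x c + C * abk c 0) * abk p c)
    (2 * a_fun u0 f eta x t + C * pi) => //.
rewrite (_ : _ + C * pi = (x - f p) * (2 * eta) + - (30 * t) * (16 / 15 * p ^+ 2 * eta) + C * pi +
    -1 * \int[mu]_(c in D) g c); last first.
  by rewrite e4 /a_fun /p; field.
apply: eq_has_int h5 => // c _; rewrite /hodo /g; ring.
Qed.

End bounded_growth.
End potential.

(** * Abel inversion *)

Section abel_inversion.
Context {R : realType}.
Local Notation mu := (@lebesgue_measure R).
Local Notation I01 := (@I01 R).

(** Moving the transform onto the kernel [(c - beta^2)^(-1/2)] produces the beta integral, which is
    [pi] for [eta > beta] and 0 otherwise. Thus the transform determines the tails; for [beta = 0]
    this is the total mass. *)
Lemma abel_inversion (psi : R -> R) (beta : R) : 0 <= beta -> beta < 1 ->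
  measurable_fun I01 psi -> (forall eta, I01 eta -> 0 <= psi eta) ->
  (\int[mu]_(c in `](beta ^+ 2)%R, 1%R[) ((abk c (beta ^+ 2))%:E * abel psi c) =
   pi%:E * \int[mu]_(eta in `]beta, 1%R[) (psi eta)%:E)%E.
Proof.
move=> b0 b1 mpsi p0; set p := beta ^+ 2.
have mab : measurable_fun (`]p, 1[ : set R) (fun c => (abk c p)%:E).
  by apply/measurable_EFinP; apply: measurable_abk.
rewrite (int_abel_transform (measurable_itv _) mpsi p0 mab); last first.
  by move=> c _; rewrite lee_fin abk_ge0.
rewrite -ge0_integralZl//; last 3 first.
- apply/measurable_EFinP; apply: measurable_funS mpsi; first exact: measurable_I01.
  by move=> y; rewrite /Defs.I01/= !in_itv/= => /andP[h ->]; rewrite (le_lt_trans b0).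
- move=> y; rewrite /= in_itv/= => /andP[h1 h2]; rewrite lee_fin p0// /Defs.I01/= in_itv/= h2.
  by rewrite (le_lt_trans b0).
- by rewrite lee_fin pi_ge0.
rewrite (@integral_shrink _ _ `]beta, 1[%classic); last 2 first.
- by move=> y; rewrite /Defs.I01/= !in_itv/= => /andP[h ->]; rewrite (le_lt_trans b0).
- move=> y; rewrite /Defs.I01/= !in_itv/= => /andP[y0 ->]; rewrite andbT => /negP; rewrite -leNgt => yb.
  rewrite integral0_eq ?mule0// => c; rewrite /= in_itv/= => /andP[pc _].
  rewrite [X in (_ * X)%E](_ : _ = 0%E) ?mule0// abk_le0// (le_trans _ (ltW pc))//.
  by rewrite /p ler_sqr ?nnegrE// ltW.
apply: eq_integral => y; rewrite inE/= in_itv/= => /andP[yb y1].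
rewrite muleC; congr (_ * _)%E.
have y0 : 0 < y by exact: le_lt_trans yb.
have py : p < y ^+ 2 by rewrite /p ltr_sqr ?nnegrE// ltW.
rewrite (@integral_shrink _ _ `]p, (y ^+ 2)%R[%classic).
- by rewrite -(int_abk_beta py); apply: eq_integral => c _; rewrite -EFinM mulrC.
- move=> c; rewrite /= !in_itv/= => /andP[-> h]; apply: (lt_trans h).
  by rewrite expr_lt1// ltW.
- move=> c; rewrite /= !in_itv/= => /andP[-> _] /= /negP; rewrite -leNgt => h.
  by rewrite (abk_le0 h) mule0.
Qed.

(** The beta integral again, now in the variable [eta]: a second Abel kernel undoes the first and
    leaves the plain integral of [G]. *)
Lemma int_abel_double (G : R -> R) (c u : R) : 0 <= c -> c < u ->
  measurable_fun (`]c, u[ : set R) G -> (forall b, b \in `]c, u[ -> 0 <= G b) ->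
  (\int[mu]_(eta in `](Num.sqrt c), (Num.sqrt u)[)
     ((\int[mu]_(b in `](eta ^+ 2)%R, u[) (G b * abk b (eta ^+ 2))%:E) * (eta * abk (eta ^+ 2) c)%:E) =
   (pi / 2)%:E * \int[mu]_(b in `]c, u[) (G b)%:E)%E.
Proof.
move=> c0 cu mG G0.
have u0 : 0 < u by exact: le_lt_trans cu.
have pi20 : (0 <= (pi / 2 : R)%:E)%E by rewrite lee_fin divr_ge0// pi_ge0.
pose F (z : R * R) : \bar R := (G z.2 * (abk z.2 (z.1 ^+ 2) * (z.1 * abk (z.1 ^+ 2) c)))%:E.
pose D := `](Num.sqrt c), (Num.sqrt u)[%classic : set R.
have D0 y : D y -> [/\ 0 < y, c < y ^+ 2 & y ^+ 2 < u].
  rewrite /D/= in_itv/= => /andP[h1 h2].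
  have y0 : 0 < y by rewrite (le_lt_trans _ h1)// sqrtr_ge0.
  by rewrite (sqrt_ltE c0 (ltW y0)) in h1; rewrite (lt_sqrtE (ltW u0) (ltW y0)) in h2.
have E1 y : D y -> ((\int[mu]_(b in `](y ^+ 2)%R, u[) (G b * abk b (y ^+ 2))%:E) *
    (y * abk (y ^+ 2) c)%:E = \int[mu]_(b in `]c, u[) F (y, b))%E.
  move=> /D0[y0 cy yu].
  rewrite [RHS](@integral_shrink _ _ `](y ^+ 2)%R, u[%classic); last 2 first.
  - by move=> b; rewrite /= !in_itv/= => /andP[h ->]; rewrite (lt_trans cy).
  - move=> b; rewrite /= !in_itv/= => /andP[_ ->]; rewrite andbT => /negP; rewrite -leNgt => h.
    by rewrite /F/= (abk_le0 h) mul0r mulr0.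
  rewrite -ge0_integralZr; [|by []|..].
  - by apply: eq_integral => b _; rewrite -EFinM /F/= -[in LHS]mulrA.
  - apply/measurable_EFinP; apply: measurable_funM; last exact: measurable_abk.
    apply: (measurable_funS _ _ mG); first exact: measurable_itv.
    move=> b; rewrite /= !in_itv/= => /andP[h ->].
    by rewrite (lt_trans cy).
  - move=> b; rewrite /= in_itv/= => /andP[h1 h2]; rewrite lee_fin mulr_ge0 ?abk_ge0// G0//.
    by rewrite in_itv/= h2 (lt_trans cy).
  - by rewrite lee_fin mulr_ge0 ?abk_ge0// ltW.
have E2 b : `]c, u[%classic b -> (\int[mu]_(y in D) F (y, b) = (pi / 2)%:E * (G b)%:E)%E.
  rewrite /= in_itv/= => /andP[cb bu].
  have b0 : 0 < b by exact: le_lt_trans cb.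
  rewrite [LHS](@integral_shrink _ _ `](Num.sqrt c), (Num.sqrt b)[%classic); last 2 first.
  - by move=> y; rewrite /D/= !in_itv/= => /andP[-> h]; rewrite (lt_trans h)// ltr_sqrt.
  - move=> y Dy; have [y0 cy yu] := D0 _ Dy; move: Dy.
    rewrite /D/= !in_itv/= => /andP[-> _] /= /negP; rewrite -leNgt => h.
    have h' : b <= y ^+ 2 by rewrite leNgt -(lt_sqrtE (ltW b0) (ltW y0)) -leNgt.
    by rewrite /F/= (abk_le0 h') mul0r mulr0.
  rewrite muleC -(int_abk_beta_sq c0 cb) -ge0_integralZl; [|by []|..].
  - by apply: eq_integral => y _; rewrite -EFinM /F/=; congr EFin; ring.
  - apply/measurable_EFinP; apply: measurable_funTS.
    have msq : measurable_fun setT (fun z : R => z ^+ 2) by exact: measurable_funX.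
    by apply: measurable_funM; [apply: measurable_funM => //|]; exact: measurable_abk.
  - move=> y; rewrite /= in_itv/= => /andP[h1 h2].
    have y0 : 0 < y by rewrite (le_lt_trans _ h1)// sqrtr_ge0.
    by rewrite lee_fin mulr_ge0 ?abk_ge0// mulr_ge0 ?abk_ge0// ltW.
  - by rewrite lee_fin G0// in_itv/= cb.
have mF : measurable_fun (D `*` `]c, u[) F.
  have msq : measurable_fun setT (fun z : R * R => z.1 ^+ 2) by exact: measurable_funX.
  apply/measurable_EFinP; apply: measurable_funM.
    apply: (measurable_comp (F := `]c, u[%classic)) => //.
      by move=> _ [z [z1 z2] <-].
    exact: measurable_funTS.
  apply: measurable_funTS; apply: measurable_funM; first exact: measurable_abk.
  by apply: measurable_funM => //; exact: measurable_abk.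
have F0 z : (D `*` `]c, u[) z -> (0 <= F z)%E.
  move=> [/D0[z0 _ _] z2]; rewrite lee_fin mulr_ge0 ?G0//.
  by rewrite mulr_ge0 ?abk_ge0// mulr_ge0 ?abk_ge0// ltW.
have e := tonelli_set (measurable_itv _) (measurable_itv _) mF F0.
transitivity (\int[mu]_(y in D) \int[mu]_(b in `]c, u[) F (y, b))%E.
  by apply: eq_integral => y /[1!inE]; exact: E1.
rewrite e; transitivity (\int[mu]_(b in `]c, u[) ((pi / 2)%:E * (G b)%:E))%E.
  by apply: eq_integral => b /[1!inE]; exact: E2.
apply: ge0_integralZl.
- exact: measurable_itv.
- exact/measurable_EFinP.
- by move=> b bI; rewrite lee_fin; exact: G0.
- exact: pi20.
Qed.

End abel_inversion.

(** * The candidate density and its transform *)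

Section density.
Context {R : realType}.
Local Notation mu := (@lebesgue_measure R).
Local Notation I01 := (@I01 R).
Context (f : R -> R) (t x u : R).
Hypothesis hf_smooth : smooth_on I01 f.
Hypothesis u01 : 0 < u < 1.
Hypothesis Hu : hodo f t x u = 0.
Hypothesis P0 : forall xi, 0 < xi < u -> 0 <= Phi0 f t xi u.

(* The minimizing density, cut off at [sqrt e]: its Abel transform is [- (pi / 2) H] on [[e, u)]
   and [0] beyond [u]. *)
Definition density (e eta : R) : R :=
  if e < eta ^+ 2 < u then 2 * eta * Num.sqrt (u - eta ^+ 2) * Phi0 f t (eta ^+ 2) u else 0.

Lemma density_ge0 (e eta : R) : 0 <= e -> I01 eta -> 0 <= density e eta.
Proof.
rewrite /Defs.I01/= in_itv/= /density => e0 /andP[y0 _]; case: ifPn => // /andP[ey yu].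
rewrite mulr_ge0 ?P0 ?yu ?exprn_gt0//.
by rewrite mulr_ge0 ?sqrtr_ge0// mulr_ge0// ltW.
Qed.

Lemma measurable_Phi0_sqr : measurable_fun I01 (fun eta : R => Phi0 f t (eta ^+ 2) u).
Proof.
apply: (measurable_comp (F := I01) (f := fun z => Phi0 f t z u)).
- exact: measurable_I01.
- by move=> _ [y /sqr_I01 Iy <-].
- have c : {in `]0, 1[, continuous (fun z => Phi0 f t z u)}.
    move=> z z01; have d : derivable (fun z => Phi0 f t z u) z 1.
      by apply: Phi0_derivable => //; rewrite in_itv.
    by move: d => /derivable1_diffP/differentiable_continuous.
  apply: (continuous_measurable_oo c) => //; exact: measurable_I01.
- by apply: measurable_funTS; exact: measurable_funX.
Qed.

Lemma measurable_density (e : R) : measurable_fun I01 (density e).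
Proof.
have msq : measurable_fun setT (fun z : R => z ^+ 2) by exact: measurable_funX.
apply: measurable_fun_if.
- exact: measurable_I01.
- by apply: measurable_funTS; apply: measurable_and; exact: measurable_fun_ltr.
- apply: (measurable_funS measurable_I01); first exact: subIsetl.
  apply: measurable_funM; last exact: measurable_Phi0_sqr.
  apply: measurable_funTS; apply: measurable_funM; first exact: measurable_funM.
  apply: (measurableT_comp (f := @Num.sqrt R)); last exact: measurable_funB.
  by apply: continuous_measurable_fun => y; exact: sqrt_continuous.
- exact: measurable_cst.
Qed.

Let sqD (e y : R) : 0 <= e -> `](Num.sqrt e), (Num.sqrt u)[%classic y ->
  [/\ 0 < y, e < y ^+ 2, y ^+ 2 < u & I01 y].
Proof.
have /andP[u0 u1] := u01.
move=> e0; rewrite /= in_itv/= => /andP[h1 h2].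
have y0 : 0 < y by rewrite (le_lt_trans _ h1)// sqrtr_ge0.
rewrite (sqrt_ltE e0 (ltW y0)) in h1; rewrite (lt_sqrtE (ltW u0) (ltW y0)) in h2.
split => //; rewrite /Defs.I01/= in_itv/= y0/=.
by rewrite -(@expr_lt1 _ 2) ?ltW// (lt_trans h2).
Qed.

(** By [avg_kernel_r], [2 sqrt (u - eta^2) Phi0 f t (eta^2) u] is the Abel integral of [Hprime] over
    [(eta^2, u)]. Then [int_abel_double] gives [pi / 2] times the integral of [Hprime] over
    [(c, u)], and [hodo] vanishes at [u]. The constant [C] makes the integrands nonnegative and is
    subtracted at the end. *)
Lemma abel_density (e c : R) : 0 < e -> e <= c -> c < u ->
  abel (density e) c = (- (pi / 2) * hodo f t x c)%:E.
Proof.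
move=> e0 ec cu; have /andP[u0 u1] := u01.
have c0 : 0 < c by exact: lt_le_trans ec.
have [C C0 hC] := Hprime_bounded hf_smooth t c0 u1.
have G0 y : c <= y <= u -> 0 <= Hprime f t y + C.
  by move=> /hC; rewrite ler_norml => /andP[h _]; rewrite -lerBlDr sub0r.
pose D := `](Num.sqrt c), (Num.sqrt u)[%classic : set R.
have mD : measurable D by exact: measurable_itv.
have DI : D `<=` I01 by move=> y /(sqD (ltW c0))[].
have cH : {in `]0, 1[, continuous (Hprime f t)} by exact: continuous_Hprime.
have c1 : {in `]0, 1[, continuous (fun _ : R => 1 : R)} by move=> y _; exact: cvg_cst.
pose G y := Hprime f t y + C * 1.
have cG : {in `]0, 1[, continuous G} by move=> y y01; apply: cvgD; [exact: cH|exact: cvg_cst].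
have sub : `]c, u[ `<=` `]0, 1[.
  by move=> y; rewrite /= !in_itv/= => /andP[h1 h2]; rewrite (lt_trans c0)//= (lt_trans h2).
have mG : measurable_fun (`]c, u[ : set R) G by apply: (continuous_measurable_oo cG).
have Gge b : b \in `]c, u[ -> 0 <= G b.
  by rewrite in_itv/= => /andP[h1 h2]; rewrite /G mulr1; apply: G0; rewrite !ltW.
have uI : u \in `]0, 1[ by rewrite in_itv.
have msq : measurable_fun setT (fun z : R => z ^+ 2) by exact: measurable_funX.
have ms : measurable_fun D (fun y => 2 * Num.sqrt (u - y ^+ 2) * (y * abk (y ^+ 2) c)).
  apply: measurable_funTS; apply: measurable_funM; last first.
    by apply: measurable_funM => //; exact: measurable_abk.
  apply: measurable_funM => //; apply: (measurableT_comp (f := @Num.sqrt R)); last exact: measurable_funB.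
  by apply: continuous_measurable_fun => y; exact: sqrt_continuous.
have mP : measurable_fun D (fun y => Phi0 f t (y ^+ 2) u).
  by apply: measurable_funS measurable_Phi0_sqr => //; exact: measurable_I01.
have s0 y : D y -> 0 <= 2 * Num.sqrt (u - y ^+ 2) * (y * abk (y ^+ 2) c).
  move=> /(sqD (ltW c0))[y0 _ _ _].
  by rewrite mulr_ge0 ?mulr_ge0 ?sqrtr_ge0 ?abk_ge0// ltW.
have ker1 y : D y -> (\int[mu]_(b in `](y ^+ 2)%R, u[) (G b * abk b (y ^+ 2))%:E =
     (2 * Num.sqrt (u - y ^+ 2) * (Phi0 f t (y ^+ 2) u + C))%:E)%E.
  move=> /(sqD (ltW c0))[y0 cy yu Iy].
  have yI : y ^+ 2 \in `]0, 1[ by exact: sqr_I01.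
  rewrite (avg_kernel_r cG yI uI yu).
    by rewrite (avg_op_lin C cH c1 yI uI) avg_op_cst mulr1.
  by move=> b; rewrite in_itv/= => /andP[h1 h2]; apply: Gge; rewrite in_itv/= h2 (lt_trans cy).
have intG : (\int[mu]_(b in `]c, u[) (G b)%:E = (- hodo f t x c + C * (u - c))%:E)%E.
  under eq_integral do rewrite /G mulr1.
  by rewrite (@int_Hprime _ _ hf_smooth t x)// Hu sub0r.
have h1 : has_int mu D (fun y => 2 * Num.sqrt (u - y ^+ 2) * (y * abk (y ^+ 2) c) * (Phi0 f t (y ^+ 2) u + C))
    (pi / 2 * (- hodo f t x c + C * (u - c))).
  apply: has_int_ge0 => //.
  - by apply: measurable_funM => //; exact: measurable_funD.
  - move=> y Dy; apply: mulr_ge0; first exact: s0.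
    have [y0 cy yu Iy] := sqD (ltW c0) Dy.
    by rewrite addr_ge0// P0// yu (lt_trans c0 cy).
  - have := int_abel_double (ltW c0) cu mG Gge.
    rewrite intG -EFinM => <-.
    by apply: eq_integral => y /[1!inE] Dy; rewrite ker1// -EFinM; congr EFin; ring.
have h2 : has_int mu D (fun y => 2 * Num.sqrt (u - y ^+ 2) * (y * abk (y ^+ 2) c)) (pi / 2 * (u - c)).
  apply: has_int_ge0 => //.
  have := @int_abel_double _ (fun=> 1) c u (ltW c0) cu (measurable_cst _) (fun _ _ => ler01).
  rewrite integral_cst// [X in (_ * (_ * X))%E](_ : _ = (u - c)%:E); last first.
    by rewrite [LHS]lebesgue_measure_itv/= lte_fin cu -EFinB.
  rewrite mul1e -EFinM => <-.
  apply: eq_integral => y /[1!inE] /(sqD (ltW c0))[y0 cy yu Iy].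
  by under eq_integral do rewrite mul1r; rewrite int_abk_l// -EFinM.
rewrite /abel (@integral_shrink _ _ D)//; last first.
  move=> y Iy nDy; move: (Iy); rewrite /Defs.I01/= in_itv/= => /andP[y0 _].
  rewrite /density; case: ifPn => [/andP[ey yu]|_]; last by rewrite mul0r.
  rewrite abk_le0 ?mulr0// leNgt; apply/negP => cy; apply: nDy.
  rewrite /D/= in_itv/= (sqrt_ltE (ltW c0) (ltW y0)) cy.
  by rewrite (lt_sqrtE (ltW u0) (ltW y0)).
have h3 := has_intD h1 (has_intZ (- C) h2).
have [_ _ ->] // : has_int mu D (fun y => density e y * abk (y ^+ 2) c) (- (pi / 2) * hodo f t x c).
rewrite (_ : - (pi / 2) * _ = pi / 2 * (- hodo f t x c + C * (u - c)) + - C * (pi / 2 * (u - c))); last by ring.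
apply: eq_has_int h3 => y /(sqD (ltW c0))[y0 cy yu Iy].
by rewrite /density yu (le_lt_trans ec cy)/=; ring.
Qed.

Lemma abel_density_out (e c : R) : u <= c -> abel (density e) c = 0%E.
Proof.
move=> uc; apply: integral0_eq => y _; rewrite /density; case: ifPn => [/andP[_ yu]|_].
  by rewrite abk_le0 ?mulr0// ltW// (lt_le_trans yu).
by rewrite mul0r.
Qed.

(** On the support of the cut-off density the kernel [(eta^2 - c)^(-1/2)] increases with [c] up to
    [e], so the value at [e] is the largest. *)
Lemma abel_density_in (e c : R) : 0 < e -> e < u -> c <= e ->
  (abel (density e) c <= (- (pi / 2) * hodo f t x e)%:E)%E.
Proof.
move=> e0 eu ce; rewrite -(abel_density e0 (lexx e) eu).
have md := measurable_density e.
have mI : measurable I01 by exact: measurable_I01.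
have msq : measurable_fun setT (fun z : R => z ^+ 2) by exact: measurable_funX.
apply: ge0_le_integral => //.
- by move=> y Iy; rewrite lee_fin mulr_ge0 ?abk_ge0 ?density_ge0// ltW.
- apply/measurable_EFinP; apply: measurable_funM; first exact: md.
  by apply: measurable_funTS; exact: measurable_abk.
- apply/measurable_EFinP; apply: measurable_funM; first exact: md.
  by apply: measurable_funTS; exact: measurable_abk.
move=> y Iy; rewrite lee_fin /density; case: ifPn => [/andP[ey yu]|_]; last by rewrite !mul0r.
apply: ler_wpM2l.
  by have := density_ge0 (ltW e0) Iy; rewrite /density ey yu.
have h : 0 < y ^+ 2 - e by rewrite subr_gt0.
rewrite /abk lef_pV2 ?posrE ?sqrtr_gt0//; first by apply: ler_wsqrtr; rewrite lerD2l lerN2.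
by apply: (lt_le_trans h); rewrite lerD2l lerN2.
Qed.

End density.

Lemma ae_sub d (T : measurableType d) (R : realType) (mu : {measure set T -> \bar R})
    (P Q : T -> Prop) : (forall x, P x -> Q x) ->
  {ae mu, forall x, P x} -> {ae mu, forall x, Q x}.
Proof.
move=> PQ [N [mN N0 sN]]; exists N; split => // x nQ.
by apply: sN => Px; apply: nQ; exact: PQ.
Qed.

(** * A nonnegative representative of the minimizer *)

Section ae_representative.
Context {R : realType}.
Local Notation mu := (@lebesgue_measure R).
Local Notation I01 := (@I01 R).

(** A negative [r] is allowed because [psi] may be negative on a null set, and the integral of [g]
    may be infinite. *)
Lemma ge0_integral_scale (D : set R) (r : R) (g : R -> R) : measurable D ->
  measurable_fun D g -> (forall x, D x -> 0 <= g x) ->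
  (\int[mu]_(x in D) (r * g x)%:E = r%:E * \int[mu]_(x in D) (g x)%:E)%E.
Proof.
move=> mD mg g0.
have mg' : measurable_fun D (EFin \o g) by exact/measurable_EFinP.
have [r0|r0] := leP 0 r.
  by rewrite -ge0_integralZl// => x Dx; rewrite lee_fin g0.
transitivity (\int[mu]_(x in D) (- ((- r)%:E * (g x)%:E)))%E.
  by apply: eq_integral => x _; rewrite -EFinM -EFinN mulNr opprK.
rewrite integral_ge0N; last first.
  by move=> x Dx; rewrite -EFinM lee_fin mulr_ge0 ?g0// oppr_ge0 ltW.
rewrite ge0_integralZl//.
- by rewrite EFinN mulNe oppeK.
- by rewrite lee_fin oppr_ge0 ltW.
Qed.

(** A minimizer is nonnegative only almost everywhere, while the exchanges of integrals are stated
    for functions nonnegative at every point. *)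
Definition pos_part (psi : R -> R) (eta : R) : R := Num.max (psi eta) 0.

Context (psi : R -> R).
Hypothesis mpsi : measurable_fun I01 psi.
Hypothesis psi0 : {ae mu, forall eta, I01 eta -> 0 <= psi eta}.
Let mI : measurable I01 := @measurable_I01 R.

Lemma pos_part_ge0 eta : 0 <= pos_part psi eta.
Proof. by rewrite le_max lexx orbT. Qed.

Lemma measurable_pos_part : measurable_fun I01 (pos_part psi).
Proof. by apply: measurable_maxr => //; exact: measurable_cst. Qed.

Lemma pos_part_ae : {ae mu, forall eta, I01 eta -> psi eta = pos_part psi eta}.
Proof. apply: ae_sub psi0 => eta h Ie; by rewrite /pos_part max_l// h. Qed.

Lemma integral_pos_part (g : R -> \bar R) : measurable_fun I01 g ->
  (\int[mu]_(eta in I01) (g eta * (psi eta)%:E) =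
   \int[mu]_(eta in I01) (g eta * (pos_part psi eta)%:E))%E.
Proof.
move=> mg; apply: ae_eq_integral => //.
- by apply: emeasurable_funM => //; exact/measurable_EFinP.
- by apply: emeasurable_funM => //; apply/measurable_EFinP; exact: measurable_pos_part.
- by apply: ae_sub pos_part_ae => eta h Ie; rewrite h.
Qed.

Let k (eta m : R) : R := - (2 * pi)^-1 * ln (`|eta - m| / `|eta + m|).

Let k_ge0 eta m : I01 eta -> I01 m -> 0 <= k eta m.
Proof.
rewrite /Defs.I01/= !in_itv/= => /andP[e0 _] /andP[m0 _].
rewrite /k mulNr -mulrN mulr_ge0 ?invr_ge0 ?mulr_ge0 ?pi_ge0// oppr_ge0.
apply: ln_le0; rewrite ler_pdivrMr ?mul1r; last by rewrite gtr0_norm ?addr_gt0.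
rewrite (gtr0_norm (addr_gt0 e0 m0)) ler_norml; apply/andP; split; lra.
Qed.

Let measurable_k2 (D : set (R * R)) : measurable D -> measurable_fun D (fun z => k z.1 z.2).
Proof.
move=> mD; apply: measurable_funTS; apply: measurable_funM => //.
apply: (measurableT_comp (@measurable_ln R)); apply: measurable_funM.
  by apply: (measurableT_comp (@normr_measurable R setT)); exact: measurable_funB.
apply: (measurableT_comp (@measurable_inv R)).
by apply: (measurableT_comp (@normr_measurable R setT)); exact: measurable_funD.
Qed.

Let measurable_k eta : measurable_fun I01 (k eta).
Proof.
apply: measurable_funTS; apply: measurable_funM => //.
apply: (measurableT_comp (@measurable_ln R)); apply: measurable_funM.
  by apply: (measurableT_comp (@normr_measurable R setT)); exact: measurable_funB.
apply: (measurableT_comp (@measurable_inv R)).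
by apply: (measurableT_comp (@normr_measurable R setT)); exact: measurable_funD.
Qed.

Lemma quad_energy_pos_part : quad_energy psi = quad_energy (pos_part psi).
Proof.
pose I eta := (\int[mu]_(m in I01) (k eta m * pos_part psi m)%:E)%E.
have mI2 : measurable (I01 `*` I01) by exact: measurableX.
have mI1 : measurable_fun I01 I.
  apply: (measurable_int_snd (f := fun z => (k z.1 z.2 * pos_part psi z.2)%:E)) => //.
    apply/measurable_EFinP; apply: measurable_funM; first exact: measurable_k2.
    apply: (measurable_comp (F := I01) (f := pos_part psi)) => //.
    - by move=> _ [z [z1 z2] <-].
    - exact: measurable_pos_part.
    - exact: measurable_funTS.
  by move=> z [z1 z2]; rewrite lee_fin; apply: mulr_ge0; [exact: k_ge0|exact: pos_part_ge0].
have E r eta : I01 eta -> (\int[mu]_(m in I01) (k eta m * r * pos_part psi m)%:E = I eta * r%:E)%E.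
  move=> Ie; rewrite muleC -ge0_integral_scale//.
  - by apply: eq_integral => m _; congr EFin; ring.
  - by apply: measurable_funM; [exact: measurable_k|exact: measurable_pos_part].
  - by move=> m Im; apply: mulr_ge0; [exact: k_ge0|exact: pos_part_ge0].
transitivity (\int[mu]_(eta in I01) (I eta * (psi eta)%:E))%E.
  apply: eq_integral => eta /[1!inE] Ie; rewrite -E//.
  under eq_integral do rewrite EFinM.
  under [RHS]eq_integral do rewrite EFinM.
  apply: integral_pos_part; apply/measurable_EFinP.
  by apply: measurable_funM; [exact: measurable_k|exact: measurable_cst].
rewrite integral_pos_part//.
by apply: eq_integral => eta /[1!inE] Ie; rewrite -E.
Qed.

Context (u0 f : R -> R) (x t : R).
Hypothesis ma : measurable_fun I01 (fun eta => a_fun u0 f eta x t).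

Lemma energy_pos_part : energy u0 f x t psi = energy u0 f x t (pos_part psi).
Proof.
rewrite /energy quad_energy_pos_part; congr (_ + _)%E.
rewrite /lin_energy; under eq_integral do rewrite EFinM.
under [RHS]eq_integral do rewrite EFinM.
by apply: integral_pos_part; exact/measurable_EFinP.
Qed.

End ae_representative.

Lemma admissible_pos_part (R : realType) (u0 f psi : R -> R) (x t : R) :
  measurable_fun (@I01 R) (fun eta => a_fun u0 f eta x t) ->
  admissible u0 f x t psi -> admissible u0 f x t (pos_part psi).
Proof.
move=> ma [mpsi [ipsi [psi0 iapsi]]].
have mp := measurable_pos_part mpsi.
have mI := @measurable_I01 R.
have pp eta : `|pos_part psi eta| <= `|psi eta|.
  rewrite ger0_norm ?pos_part_ge0// /pos_part ge_max normr_ge0 andbT; exact: ler_norm.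
split => //; split; [|split].
- apply: le_integrable ipsi => //; first exact/measurable_EFinP.
  by move=> eta _; rewrite /= lee_fin.
- by apply: aeW => eta _; exact: pos_part_ge0.
- apply: le_integrable iapsi => //; first by apply/measurable_EFinP; exact: measurable_funM.
  by move=> eta _; rewrite /= lee_fin !normrM ler_wpM2l.
Qed.

(** * Unbounded growth of [f] at 0: energy unbounded below *)

Section unbounded_profile.
Context {R : realType}.
Local Notation mu := (@lebesgue_measure R).
Local Notation I01 := (@I01 R).
Context (u0 f : R -> R).
Hypothesis hu0_range : forall y : R, 0 < u0 y < 1.
Hypothesis hu0_smooth : smooth u0.
Hypothesis hu0_decr : forall y z : R, y < z -> u0 z < u0 y.
Hypothesis hf_inv2 : forall u : R, 0 < u < 1 -> u0 (f u) = u.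
Hypothesis hf_smooth : smooth_on I01 f.
Hypothesis hf_neg : forall u : R, 0 < u < 1 -> derive1 f u < 0.
Context (x t : R).
Hypothesis t0 : 0 < t.

Let mI : measurable I01 := @measurable_I01 R.

Lemma integrable_bounded_I01 (g : R -> R) (C : R) : measurable_fun I01 g ->
  (forall y, I01 y -> `|g y| <= C) -> mu.-integrable I01 (EFin \o g).
Proof.
move=> mg gC.
have ic : mu.-integrable I01 (EFin \o (fun=> C)).
  apply: (@integrableS _ _ _ mu `[0, 1]) => //; first exact: subset_itv_oo_cc.
  by apply: integrable_within_cc; apply: continuous_subspaceT => y; exact: cvg_cst.
apply: le_integrable ic => //; first exact/measurable_EFinP.
by move=> y Iy; rewrite /= lee_fin (le_trans (gC _ Iy))// ler_norm.
Qed.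

Lemma a_fun_le (b y : R) : 0 < b -> b < 1 -> 0 < y -> y ^+ 2 < b ->
  a_fun u0 f y x t <= `|x| - y * f b.
Proof.
move=> b0 b1 y0 yb.
have y1 : y < 1 by rewrite -(@expr_lt1 _ 2) ?ltW// (lt_trans yb).
have Iy : I01 y by rewrite /Defs.I01/= in_itv/= y0.
have h1 := theta_ge hu0_range hu0_smooth hu0_decr hf_inv2 hf_smooth hf_neg Iy.
have h2 : y * f b <= y * f (y ^+ 2).
  by rewrite ler_wpM2l ?ltW//; apply: profile_decr => //; rewrite exprn_gt0.
have h3 : 0 <= 16 * y ^+ 5 * t.
  by apply: mulr_ge0; [apply: mulr_ge0 => //; exact/exprn_ge0/ltW|exact: ltW].
have h4 : y * x <= `|x|.
  apply: (le_trans (ler_norm _)); rewrite normrM (gtr0_norm y0).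
  by rewrite ler_piMl// ltW.
rewrite /a_fun; move: h1 h2 h3 h4.
by move: (theta _ _ _) (y * f b) (y * _) (16 * _ * _) (y * x) => ? ? ? ? ?; lra.
Qed.

(* If [c^{1/2} f(c)] is unbounded then the external field is too negative near some
   point for its attraction to be balanced by the self-energy of the mass put there. *)
Lemma energy_unbounded_below (L : R) :
  ~ (exists B, forall c, I01 c -> f c <= B * abk c 0) ->
  exists2 phi, admissible u0 f x t phi & (energy u0 f x t phi < L%:E)%E.
Proof.
(* The quadratic energy of [phi] will be at most [pi / 2] and its linear energy [- M / 2]; this [M]
   makes the sum less than [L]. *)
move=> nB; pose M := pi + 2 * `|L| + 1.
have M0 : 0 < M by rewrite ltr_wpDl// addr_ge0 ?pi_ge0// mulr_ge0.
(* The factor 2 compensates [y > s / 2] on [J], so that [y f(b) > M + |x|] and the field is at most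
   [- M] there. *)
have [b Ib hb] : exists2 b, I01 b & 2 * (M + `|x|) * abk b 0 < f b.
  apply: contrapT => nb; apply: nB; exists (2 * (M + `|x|)) => c Ic.
  by rewrite leNgt; apply/negP => h; apply: nb; exists c.
have := Ib; rewrite /Defs.I01/= in_itv/= => /andP[b0 b1].
pose s := Num.sqrt b.
have s0 : 0 < s by rewrite sqrtr_gt0.
have hs : 2 * (M + `|x|) < s * f b.
  by move: hb; rewrite /abk subr0 -/s ltr_pdivrMr// [s * _]mulrC.
pose J := `](s / 2), s[%classic : set R.
have mJ : measurable J by exact: measurable_itv.
have J0 y : J y -> [/\ 0 < y, y ^+ 2 < b, I01 y & a_fun u0 f y x t <= - M].
  rewrite /J/= in_itv/= => /andP[h1 h2].
  have y0 : 0 < y by rewrite (lt_trans _ h1)// divr_gt0.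
  have yb : y ^+ 2 < b by rewrite -(lt_sqrtE (ltW b0) (ltW y0)).
  have y1 : y < 1 by rewrite -(@expr_lt1 _ 2) ?ltW// (lt_trans yb).
  split => //; first by rewrite /Defs.I01/= in_itv/= y0.
  apply: (le_trans (a_fun_le b0 b1 y0 yb)).
  have fb : 0 < f b.
    rewrite -(pmulr_rgt0 _ s0); apply: le_lt_trans hs.
    by rewrite mulr_ge0// addr_ge0// ltW.
  have : s / 2 * f b <= y * f b by rewrite ler_wpM2r// ltW.
  have : s / 2 * f b = s * f b / 2 by rewrite mulrAC.
  by move: hs; move: (s * f b) (y * f b) (s / 2 * f b) (`|x|) => ? ? ? ?; lra.
have ma := measurable_a_fun hu0_range hu0_smooth hu0_decr hf_inv2 hf_smooth hf_neg x t.
(* Dividing by the field makes its product with [phi] constant on [J], so that the linear energy is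
   explicit; and [phi <= 1 / s] because the field is at most [- M]. *)
pose phi y := if s / 2 < y < s then M / s * (- a_fun u0 f y x t)^-1 else 0.
have phiJ y : J y -> phi y = M / s * (- a_fun u0 f y x t)^-1.
  by rewrite /J/= in_itv/= /phi => ->.
have phiN y : ~ J y -> phi y = 0.
  by rewrite /J/= in_itv/= /phi => /negP/negbTE ->.
have mphi : measurable_fun I01 phi.
  apply: measurable_fun_if => //.
  - by apply: measurable_funTS; apply: measurable_and; exact: measurable_fun_ltr.
  - apply: (measurable_funS mI); first exact: subIsetl.
    apply: measurable_funM => //; apply: (measurableT_comp (@measurable_inv R)).
    exact: measurableT_comp.
have phi0 y : 0 <= phi y.
  have [Jy|nJ] := pselect (J y); last by rewrite phiN.
  have [_ _ _ ay] := J0 _ Jy; rewrite phiJ// mulr_ge0 ?divr_ge0 ?ltW//.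
  by rewrite invr_gt0 oppr_gt0 (le_lt_trans ay)// oppr_lt0.
have phi_le y : phi y <= s^-1.
  have [Jy|nJ] := pselect (J y); last by rewrite phiN// invr_ge0 ltW.
  have [_ _ _ ay] := J0 _ Jy; rewrite phiJ//.
  have h : M <= - a_fun u0 f y x t by rewrite lerNr.
  rewrite mulrAC -[leRHS]mul1r; apply: ler_wpM2r; first by rewrite invr_ge0 ltW.
  by rewrite ler_pdivrMr ?mul1r// (lt_le_trans M0).
have aphi y : a_fun u0 f y x t * phi y = if s / 2 < y < s then - (M / s) else 0.
  have [Jy|nJ] := pselect (J y).
    have [_ _ _ ay] := J0 _ Jy; rewrite phiJ//; move: (Jy); rewrite /J/= in_itv/= => ->.
    have ne : a_fun u0 f y x t != 0 by rewrite lt_eqF// (le_lt_trans ay)// oppr_lt0.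
    by rewrite invrN mulrN mulrN mulrCA divff// mulr1.
  by rewrite phiN// mulr0; move: nJ; rewrite /J/= in_itv/= => /negP/negbTE ->.
have iphi : mu.-integrable I01 (EFin \o phi).
  apply: (@integrable_bounded_I01 _ s^-1) => // y _; by rewrite ger0_norm ?phi0.
have iaphi : mu.-integrable I01 (fun y => (a_fun u0 f y x t * phi y)%:E).
  apply: (@integrable_bounded_I01 _ (M / s)); first exact: measurable_funM.
  move=> y _; rewrite aphi; case: ifP => _; first by rewrite normrN ger0_norm// divr_ge0// ltW.
  by rewrite normr0 divr_ge0// ltW.
exists phi.
  split => //; split => //; split => //.
  by apply: aeW => y _; exact: phi0.
have lin : lin_energy u0 f x t phi = (- (M / 2))%:E.
  rewrite /lin_energy (@integral_shrink _ _ J); last 2 first.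
  - by move=> y /J0[].
  - by move=> y _ /phiN ->; rewrite mulr0.
  transitivity (\int[mu]_(y in J) (cst (- (M / s))%:E y))%E.
    apply: eq_integral => y; rewrite inE /J/= in_itv/= => Jy.
    by rewrite aphi Jy.
  rewrite integral_cst// [X in (_ * X)%E](_ : _ = (s - s / 2)%:E); last first.
    rewrite [LHS]lebesgue_measure_itv/= lte_fin -EFinB ifT//.
    by rewrite ltr_pdivrMr// ltr_pMr// ltrDl.
  by rewrite -EFinM; congr EFin; field; rewrite gt_eqF.
have abel_in c : `]0, b[%classic c -> (abel phi c <= (pi / s)%:E)%E.
  rewrite /= in_itv/= => /andP[c0 cb].
  have D0 y : `](Num.sqrt c), s[%classic y -> 0 < y /\ I01 y.
    rewrite /= in_itv/= => /andP[h1 h2].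
    have y0 : 0 < y by rewrite (le_lt_trans _ h1)// sqrtr_ge0.
    split => //; rewrite /Defs.I01/= in_itv/= y0/=; apply: (lt_trans h2).
    by rewrite /s -[ltRHS]sqrtr1 ltr_sqrt.
  have msq : measurable_fun setT (fun z : R => z ^+ 2) by exact: measurable_funX.
  have mk : measurable_fun (`](Num.sqrt c), s[ : set R) (fun y => (y * abk b (y ^+ 2) * abk (y ^+ 2) c)%:E).
    apply/measurable_EFinP; apply: measurable_funTS.
    by apply: measurable_funM; [apply: measurable_funM => //|]; exact: measurable_abk.
  have k0 y : `](Num.sqrt c), s[%classic y -> (0 <= (y * abk b (y ^+ 2) * abk (y ^+ 2) c)%:E)%E.
    by move=> /D0[/ltW y0 _]; rewrite lee_fin mulr_ge0 ?abk_ge0// mulr_ge0 ?abk_ge0.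
  have s20 : 0 <= 2 / s by rewrite divr_ge0// ltW.
  rewrite /abel (@integral_shrink _ _ `](Num.sqrt c), s[%classic); last 2 first.
  - by move=> y /D0[].
  - move=> y Iy; rewrite /= in_itv/= => /negP; rewrite negb_and => /orP[|].
      rewrite -leNgt => h; rewrite abk_le0 ?mulr0// -(sqr_sqrtr (ltW c0)).
      by rewrite ler_sqr ?nnegrE ?sqrtr_ge0//; move: Iy; rewrite /Defs.I01/= in_itv/= => /andP[/ltW].
    by move=> h; rewrite phiN ?mul0r// /J/= in_itv/= => /andP[_]; exact/negP.
  (* On [J], [1 / s] is at most [(2 / s) y (b - y^2)^(-1/2)], whose transform is given by
     [int_abk_beta_sq]. *)
  have -> : (pi / s)%:E = (\int[mu]_(y in `](Num.sqrt c), s[)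
      ((2 / s)%:E * (y * abk b (y ^+ 2) * abk (y ^+ 2) c)%:E))%E.
    rewrite ge0_integralZl// int_abk_beta_sq ?ltW// -EFinM; congr EFin; field.
    by rewrite gt_eqF.
  apply: ge0_le_integral.
  - exact: measurable_itv.
  - by move=> y _; rewrite lee_fin mulr_ge0 ?abk_ge0.
  - apply/measurable_EFinP; apply: measurable_funM; last by apply: measurable_funTS; exact: measurable_abk.
    by apply: (measurable_funS mI) mphi => y /D0[].
  - by apply: measurable_funeM.
  move=> y Dy; have [y0 _] := D0 _ Dy; rewrite -EFinM lee_fin mulrA.
  apply: ler_wpM2r; first exact: abk_ge0.
  have [Jy|nJ] := pselect (J y); last first.
    by rewrite phiN// mulr_ge0// mulr_ge0 ?abk_ge0// ltW.
  apply: (le_trans (phi_le y)); have [_ yb _ _] := J0 _ Jy.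
  have h : s^-1 <= abk b (y ^+ 2).
    rewrite /abk lef_pV2 ?posrE ?sqrtr_gt0 ?subr_gt0//.
    by apply: ler_wsqrtr; rewrite gerBl sqr_ge0.
  have h2 : 1 <= 2 / s * y.
    move: Jy; rewrite /J/= in_itv/= => /andP[h1 _].
    by rewrite mulrAC ler_pdivlMr// mul1r mulrC -ler_pdivrMr// ltW.
  rewrite mulrA -[leLHS]mul1r; apply: ler_pM => //.
  by rewrite invr_ge0 ltW.
have abel_out c : b <= c -> abel phi c = 0%E.
  move=> bc; apply: integral0_eq => y _; have [/J0[_ yb _ _]|nJ] := pselect (J y).
    by rewrite abk_le0 ?mulr0// ltW// (lt_le_trans yb).
  by rewrite phiN// mul0r.
have quad : (quad_energy phi <= (pi / 2)%:E)%E.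
  have sA : measurable_fun I01 (abel phi) by apply: measurable_abel.
  rewrite quad_energyE// (@integral_shrink _ _ `]0, b[%classic); last 2 first.
  - by move=> c; rewrite /Defs.I01/= !in_itv/= => /andP[-> h]; exact: lt_trans b1.
  - move=> c; rewrite /Defs.I01/= !in_itv/= => /andP[-> _] /= /negP; rewrite -leNgt => bc.
    by rewrite (abel_out _ bc) mul0e.
  apply: (@le_trans _ _ ((2 * pi)^-1%:E * \int[mu]_(c in `]0%R, b[) (cst ((pi / s) ^+ 2)%:E c))%E).
    apply: lee_wpmul2l; first by rewrite lee_fin invr_ge0 mulr_ge0// pi_ge0.
    apply: ge0_le_integral.
    - exact: measurable_itv.
    - by move=> c _; apply: mule_ge0; apply: abel_ge0 => y _; exact: phi0.
    - apply: emeasurable_funM; apply: (measurable_funS mI) sA => c;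
        by rewrite /Defs.I01/= !in_itv/= => /andP[-> h]; exact: lt_trans b1.
    - exact: measurable_cst.
    move=> c cI; rewrite /= expr2 EFinM; apply: lee_pmul; [| |exact: abel_in|exact: abel_in];
      by apply: abel_ge0 => y _; exact: phi0.
  rewrite integral_cst// [X in (_ * (_ * X))%E](_ : _ = b%:E); last first.
    by rewrite [LHS]lebesgue_measure_itv/= lte_fin b0 -EFinB subr0.
  rewrite -!EFinM lee_fin le_eqVlt; apply/orP; left; apply/eqP.
  have -> : b = s ^+ 2 by rewrite sqr_sqrtr// ltW.
  have pn : (pi : R) != 0 by rewrite gt_eqF// pi_gt0.
  have sn : s != 0 by rewrite gt_eqF.
  have fld (p q : R) : p != 0 -> q != 0 -> (2 * p)^-1 * ((p / q) ^+ 2 * q ^+ 2) = p / 2.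
    by move=> p0 q0; field; apply/andP.
  exact: fld.
rewrite /energy lin; apply: (@le_lt_trans _ _ ((pi / 2)%:E + (- (M / 2))%:E)%E).
  by rewrite leeD2r.
rewrite -EFinD lte_fin /M; have := ler_norm (- L); rewrite normrN.
by move: (`|L|) (pi : R) => p q; lra.
Qed.

End unbounded_profile.

Section has_integral2.
Context d (T : measurableType d) (R : realType) (mu : {measure set T -> \bar R}).
Implicit Types (D : set T) (g h : T -> R) (r s : R).

Lemma has_int_le D g h r s : has_int mu D g r -> has_int mu D h s ->
  (forall x, D x -> g x <= h x) -> r <= s.
Proof.
move=> [mD ig eg] [_ ih eh] gh; rewrite -lee_fin -eg -eh.
by apply: le_integral => // x /[1!inE] /gh; rewrite lee_fin.
Qed.

Lemma has_int_dominated D g h r : has_int mu D g r -> measurable_fun D h ->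
  (forall x, D x -> `|h x| <= `|g x|) -> exists s, has_int mu D h s.
Proof.
move=> [mD ig _] mh hg; exists (\int[mu]_(x in D) h x); apply: has_int_fine => //.
apply: le_integrable ig => //; first exact/measurable_EFinP.
Qed.

Lemma has_int_uniq D g r s : has_int mu D g r -> has_int mu D g s -> r = s.
Proof. by move=> [_ _ e1] [_ _ e2]; move: e1; rewrite e2 => -[]. Qed.

Lemma measurable_has_int D g r : has_int mu D g r -> measurable_fun D g.
Proof. by move=> [mD /integrableP[/measurable_EFinP]]. Qed.

End has_integral2.

(** * Comparison with the minimizing density *)

Section abel_energy.
Context {R : realType}.
Local Notation mu := (@lebesgue_measure R).
Local Notation I01 := (@I01 R).
Context (u0 f : R -> R).
Hypothesis hu0_range : forall y : R, 0 < u0 y < 1.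
Hypothesis hu0_smooth : smooth u0.
Hypothesis hu0_decr : forall y z : R, y < z -> u0 z < u0 y.
Hypothesis hf_inv2 : forall u : R, 0 < u < 1 -> u0 (f u) = u.
Hypothesis hf_smooth : smooth_on I01 f.
Hypothesis hf_neg : forall u : R, 0 < u < 1 -> derive1 f u < 0.
Context (B : R).
Hypothesis hB : forall c, I01 c -> f c <= B * abk c 0.
Context (x t : R).
Hypothesis t0 : 0 < t.

Let mI : measurable I01 := @measurable_I01 R.

(** Chosen to make [K] nonnegative: [|x| + 30 t] absorbs [x - 30 t c^2] and [|B|] absorbs [f], as
    [c^(-1/2) >= 1]. *)
Let C : R := `|x| + 30 * t + `|B|.
Let K (c : R) : R := hodo f t x c + C * abk c 0.

Lemma abk0_ge1 (c : R) : I01 c -> 1 <= abk c 0.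
Proof.
rewrite /Defs.I01/= in_itv/= => /andP[c0 c1].
rewrite /abk subr0 -[leLHS]invr1 lef_pV2 ?posrE ?sqrtr_gt0//.
by rewrite -[leRHS]sqrtr1; apply: ler_wsqrtr; exact: ltW.
Qed.

Let K_ge0 c : I01 c -> 0 <= K c.
Proof.
move=> Ic; have k1 := abk0_ge1 Ic.
have h1 := hB Ic.
have h2 : B * abk c 0 <= `|B| * abk c 0 by rewrite ler_wpM2r ?abk_ge0// ler_norm.
have h3 : t * c ^+ 2 <= t.
  move: Ic; rewrite /Defs.I01/= in_itv/= => /andP[c0 c1].
  by rewrite ler_piMr ?ltW// expr_lt1// ltW.
have h4 : (`|x| + 30 * t) * 1 <= (`|x| + 30 * t) * abk c 0.
  by rewrite ler_wpM2l// addr_ge0// mulr_ge0// ltW.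
have h5 := ler_norm (- x); rewrite normrN in h5.
have -> : K c = x - 30 * (t * c ^+ 2) - f c + ((`|x| + 30 * t) * abk c 0 + `|B| * abk c 0).
  by rewrite /K /hodo /C; ring.
move: h1 h2 h3 h4 h5.
move: (f c) (B * abk c 0) (`|B| * abk c 0) (t * c ^+ 2) ((`|x| + 30 * t) * abk c 0) (`|x|) => ? ? ? ? ? ?.
lra.
Qed.

Lemma measurable_hodo : measurable_fun I01 (hodo f t x).
Proof.
have cH : {in `]0, 1[, continuous (hodo f t x)} by exact: continuous_hodo.
exact: (continuous_measurable_oo cH).
Qed.

Let measurable_K : measurable_fun I01 K.
Proof.
apply: measurable_funD; first exact: measurable_hodo.
by apply: measurable_funM => //; exact: measurable_abk.
Qed.

Let a_K (eta : R) : I01 eta ->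
  (\int[mu]_(c in I01) (K c * abk (eta ^+ 2) c)%:E = (2 * a_fun u0 f eta x t + C * pi)%:E)%E.
Proof. by move=> Ie; exact: (a_funE hu0_range hu0_smooth hu0_decr hf_inv2 hf_smooth hf_neg hB). Qed.

Let int_K (psi : R -> R) : measurable_fun I01 psi -> (forall eta, I01 eta -> 0 <= psi eta) ->
  (\int[mu]_(c in I01) ((K c)%:E * abel psi c) =
   \int[mu]_(eta in I01) (psi eta * (2 * a_fun u0 f eta x t + C * pi))%:E)%E.
Proof.
move=> mpsi p0; rewrite int_abel_transform//.
- by apply: eq_integral => eta /[1!inE] Ie; rewrite EFinM -a_K.
- by apply/measurable_EFinP; exact: measurable_K.
Qed.

Let int_abk0 (psi : R -> R) : measurable_fun I01 psi -> (forall eta, I01 eta -> 0 <= psi eta) ->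
  (\int[mu]_(c in I01) ((abk c 0)%:E * abel psi c) = pi%:E * \int[mu]_(eta in I01) (psi eta)%:E)%E.
Proof.
move=> mpsi p0.
have := abel_inversion (lexx 0) ltr01 mpsi p0.
by rewrite expr0n.
Qed.

Section transform.
Context (psi : R -> R).
Hypothesis mpsi : measurable_fun I01 psi.
Hypothesis psi0 : forall eta, I01 eta -> 0 <= psi eta.
Hypothesis ipsi : mu.-integrable I01 (EFin \o psi).

Definition fabel (c : R) : R := fine (abel psi c).

Let mA : measurable_fun I01 (abel psi).
Proof. exact: measurable_abel. Qed.

Lemma measurable_fabel : measurable_fun I01 fabel.
Proof. exact: (measurableT_comp (f := fine)). Qed.

Lemma fabel_ge0 c : 0 <= fabel c.
Proof. by apply: fine_ge0; exact: abel_ge0. Qed.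

(** The transform times [c^(-1/2)] has a finite integral, [pi] times the mass of [psi]. Squares and
    differences can thus be formed with the real values [fabel]. *)
Lemma fabel_ae : {ae mu, forall c, I01 c -> abel psi c = (fabel c)%:E}.
Proof.
have mk : measurable_fun I01 (fun c => ((abk c 0)%:E * abel psi c)%E).
  by apply: emeasurable_funM => //; apply/measurable_EFinP; exact: measurable_abk.
have k0 c : I01 c -> (0 <= (abk c 0)%:E * abel psi c)%E.
  by move=> _; rewrite mule_ge0 ?lee_fin ?abk_ge0// abel_ge0.
have i : mu.-integrable I01 (fun c => ((abk c 0)%:E * abel psi c)%E).
  apply/integrableP; split => //.
  under eq_integral => c /[1!inE] Ic do rewrite gee0_abs ?k0//.
  rewrite int_abk0// -EFin_Rintegral// -EFinM; exact: ltry.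
have : {ae mu, forall c, I01 c -> ((abk c 0)%:E * abel psi c)%E \is a fin_num} by apply: integrable_ae.
apply: ae_sub => c h Ic; rewrite /fabel fineK//.
have {h} := h Ic; have := abel_ge0 c psi0.
have a0 : 0 < abk c 0 by exact: lt_le_trans (abk0_ge1 Ic).
case: (abel psi c) => // _.
by rewrite mulry gtr0_sg// mul1e.
Qed.

Lemma int_fabel (k : R -> R) : measurable_fun I01 k -> (forall c, I01 c -> 0 <= k c) ->
  (\int[mu]_(c in I01) (k c * fabel c)%:E = \int[mu]_(c in I01) ((k c)%:E * abel psi c))%E.
Proof.
move=> mk k0; apply: ge0_ae_eq_integral => //.
- by apply/measurable_EFinP; apply: measurable_funM => //; exact: measurable_fabel.
- by apply: emeasurable_funM => //; exact/measurable_EFinP.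
- by move=> c Ic; rewrite lee_fin mulr_ge0 ?fabel_ge0// k0.
- by move=> c Ic; rewrite mule_ge0 ?lee_fin ?k0// abel_ge0.
- by apply: ae_sub fabel_ae => c h Ic; rewrite h// EFinM.
Qed.

Lemma int_fabel_swap (k : R -> R) : measurable_fun I01 k -> (forall c, 0 <= k c) ->
  (\int[mu]_(c in I01) (k c * fabel c)%:E = \int[mu]_(eta in I01) ((psi eta)%:E *
     \int[mu]_(c in I01) ((k c)%:E * (abk (eta ^+ 2) c)%:E)))%E.
Proof.
move=> mk k0; rewrite (int_fabel mk (fun c _ => k0 c)).
rewrite (int_abel_transform mI mpsi psi0); [by []|exact/measurable_EFinP|].
by move=> c _; rewrite lee_fin.
Qed.

Lemma measurable_int_abk (k : R -> R) : measurable_fun I01 k -> (forall c, 0 <= k c) ->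
  measurable_fun I01 (fun eta => (psi eta)%:E *
     \int[mu]_(c in I01) ((k c)%:E * (abk (eta ^+ 2) c)%:E))%E.
Proof.
move=> mk k0; apply: emeasurable_funM; first exact/measurable_EFinP.
apply: (measurable_int_snd (f := fun z => ((k z.2)%:E * (abk (z.1 ^+ 2) z.2)%:E)%E)) => //.
  apply: emeasurable_funM; apply/measurable_EFinP.
    apply: (measurable_comp (F := I01)) => //; first by move=> _ [z [z1 z2] <-].
    exact: measurable_funTS.
  by apply: measurable_abk; apply: measurable_funTS => //; exact: measurable_funX.
by move=> z _; rewrite mule_ge0 ?lee_fin ?abk_ge0.
Qed.

Lemma quad_energy_fabel :
  quad_energy psi = ((2 * pi)^-1%:E * \int[mu]_(c in I01) (fabel c ^+ 2)%:E)%E.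
Proof.
rewrite quad_energyE//; congr (_ * _)%E.
apply: ge0_ae_eq_integral => //.
- exact: emeasurable_funM.
- by apply/measurable_EFinP; apply: measurable_funX; exact: measurable_fabel.
- by move=> c _; apply: mule_ge0; exact: abel_ge0.
- by move=> c _; rewrite lee_fin sqr_ge0.
- by apply: ae_sub fabel_ae => c h Ic; rewrite h.
Qed.

(** A difference of two nonnegative identities: the weight [K] gives [2 l] plus [C pi] times the
    mass, the weight [c^(-1/2)] gives [pi] times the mass. *)
Lemma has_int_hodo_fabel (l : R) : has_int mu I01 (fun eta => a_fun u0 f eta x t * psi eta) l ->
  has_int mu I01 (fun c => hodo f t x c * fabel c) (2 * l).
Proof.
move=> hl.
have mk0 : measurable_fun I01 (fun c => abk c 0) by apply: measurable_abk.
have [p hp] : exists p, has_int mu I01 psi p.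
  by exists (\int[mu]_(eta in I01) psi eta); apply: has_int_fine.
have h1 : has_int mu I01 (fun c => abk c 0 * fabel c) (pi * p).
  apply: has_int_ge0 => //.
  - by apply: measurable_funM => //; exact: measurable_fabel.
  - by move=> c _; rewrite mulr_ge0 ?abk_ge0 ?fabel_ge0.
  - rewrite int_fabel//; last by move=> c _; exact: abk_ge0.
    by rewrite int_abk0//; case: hp => _ _ ->.
have h2 : has_int mu I01 (fun c => K c * fabel c) (2 * l + C * pi * p).
  apply: has_int_ge0 => //.
  - by apply: measurable_funM => //; exact: measurable_fabel.
  - by move=> c Ic; rewrite mulr_ge0 ?K_ge0 ?fabel_ge0.
  - rewrite int_fabel// int_K//.
    have [_ _ <-] := has_intD (has_intZ 2 hl) (has_intZ (C * pi) hp).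
    by apply: eq_integral => eta _; congr EFin; ring.
have := has_intD h2 (has_intZ (- C) h1).
rewrite (_ : 2 * l + C * pi * p + - C * (pi * p) = 2 * l); last by ring.
by apply: eq_has_int => c _; rewrite /K; ring.
Qed.

Lemma energy_fabel (l : R) : has_int mu I01 (fun eta => a_fun u0 f eta x t * psi eta) l ->
  (energy u0 f x t psi = (2 * pi)^-1%:E * \int[mu]_(c in I01) (fabel c ^+ 2)%:E + l%:E)%E.
Proof. by move=> [_ _ hl]; rewrite /energy quad_energy_fabel /lin_energy hl. Qed.

End transform.

(** [hodo] need not be bounded near 1, which is harmless when the transform vanishes beyond [u].
    Below [u], [f >= f u] gives [K <= M c^(-1/2)], and the field is integrable against [psi]. *)
Lemma admissible_of_abel (psi : R -> R) (u : R) : 0 < u -> u < 1 ->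
  measurable_fun I01 psi -> (forall eta, I01 eta -> 0 <= psi eta) ->
  mu.-integrable I01 (EFin \o psi) -> (forall c, u <= c -> abel psi c = 0%E) ->
  admissible u0 f x t psi.
Proof.
move=> u00 u1 mpsi p0 ipsi out.
have ma := measurable_a_fun hu0_range hu0_smooth hu0_decr hf_inv2 hf_smooth hf_neg x t.
split => //; split => //; split; first by apply: aeW => eta Ie; exact: p0.
have [p hp] : exists p, has_int mu I01 psi p.
  by exists (\int[mu]_(eta in I01) psi eta); apply: has_int_fine.
have mk0 : measurable_fun I01 (fun c => abk c 0) by apply: measurable_abk.
pose M := `|x| + `|f u| + C.
have g0 eta : I01 eta -> 0 <= psi eta * (2 * a_fun u0 f eta x t + C * pi).
  move=> Ie; rewrite mulr_ge0 ?p0// -lee_fin -a_K//; apply: integral_ge0 => c Ic.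
  by rewrite lee_fin mulr_ge0 ?abk_ge0// K_ge0.
have mg : measurable_fun I01 (fun eta => psi eta * (2 * a_fun u0 f eta x t + C * pi)).
  by apply: measurable_funM => //; apply: measurable_funD => //; exact: measurable_funM.
have fin : (\int[mu]_(eta in I01) (psi eta * (2 * a_fun u0 f eta x t + C * pi))%:E < +oo)%E.
  rewrite -int_K//; apply: (@le_lt_trans _ _ (\int[mu]_(c in I01) (M%:E * ((abk c 0)%:E * abel psi c)))%E).
    have A0 c : (0 <= abel psi c)%E by exact: abel_ge0.
    apply: ge0_le_integral => //.
    - by move=> c Ic; rewrite mule_ge0 ?lee_fin ?K_ge0.
    - apply: emeasurable_funM; first by apply/measurable_EFinP; exact: measurable_K.
      exact: measurable_abel.
    - apply: measurable_funeM; apply: emeasurable_funM; first exact/measurable_EFinP.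
      exact: measurable_abel.
    move=> c Ic; have [uc|cu] := leP u c; first by rewrite out// !mule0.
    rewrite muleA -EFinM; apply: lee_wpmul2r => //; rewrite lee_fin.
    have k1 := abk0_ge1 Ic.
    move: (Ic); rewrite /Defs.I01/= in_itv/= => /andP[c0 c1].
    have h1 : f u <= f c by apply: profile_nincr => //; exact: ltW.
    have h2 : (`|x| + `|f u|) * 1 <= (`|x| + `|f u|) * abk c 0 by rewrite ler_wpM2l// addr_ge0.
    have h3 : 0 <= t * c ^+ 2 by rewrite mulr_ge0 ?sqr_ge0// ltW.
    have h4 := ler_norm x; have h5 := ler_norm (- f u); rewrite normrN in h5.
    rewrite /M mulrDl /K lerD2r; apply: le_trans h2; rewrite /hodo -mulrA.
    by move: h1 h3 h4 h5; move: (f u) (f c) (t * c ^+ 2) (`|x|) (`|f u|) => ? ? ? ? ?; lra.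
  rewrite ge0_integralZl//.
  - by rewrite int_abk0//; case: hp => _ _ ->; rewrite -!EFinM ltry.
  - by apply: emeasurable_funM; [exact/measurable_EFinP|exact: measurable_abel].
  - by move=> c Ic; rewrite mule_ge0 ?lee_fin ?abk_ge0// abel_ge0.
  - by rewrite lee_fin /M /C !addr_ge0// mulr_ge0// ltW.
have [q hq] : exists q, has_int mu I01 (fun eta => psi eta * (2 * a_fun u0 f eta x t + C * pi)) q.
  exists (\int[mu]_(eta in I01) (psi eta * (2 * a_fun u0 f eta x t + C * pi))).
  apply: has_int_fine => //; apply/integrableP; split; first exact/measurable_EFinP.
  by under eq_integral => eta /[1!inE] Ie do rewrite /= ger0_norm ?g0//.
have [_ i _] := has_intZ (2^-1) (has_intD hq (has_intZ (- (C * pi)) hp)).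
by apply: eq_integrable i => // eta _; rewrite /=; congr EFin; field.
Qed.

End abel_energy.

Section comparison.
Context {R : realType}.
Local Notation mu := (@lebesgue_measure R).
Local Notation I01 := (@I01 R).
Context (u0 f : R -> R).
Hypothesis hu0_range : forall y : R, 0 < u0 y < 1.
Hypothesis hu0_smooth : smooth u0.
Hypothesis hu0_decr : forall y z : R, y < z -> u0 z < u0 y.
Hypothesis hf_inv2 : forall u : R, 0 < u < 1 -> u0 (f u) = u.
Hypothesis hf_smooth : smooth_on I01 f.
Hypothesis hf_neg : forall u : R, 0 < u < 1 -> derive1 f u < 0.
Hypothesis hf_0 : f u @[u --> 0^'+] --> +oo.
Context (B : R).
Hypothesis hB : forall c, I01 c -> f c <= B * abk c 0.
Context (x t u : R).
Hypothesis t0 : 0 < t.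
Hypothesis u01 : 0 < u < 1.
Hypothesis Hu : hodo f t x u = 0.
Hypothesis P0 : forall xi, 0 < xi < u -> 0 <= Phi0 f t xi u.
Hypothesis outer : forall v, u < v < 1 ->
     (\int[mu]_(c in `]u, v[) (Num.max (- hodo f t x c) 0 * abk v c)%:E <=
      \int[mu]_(c in `]u, v[) (Num.max (hodo f t x c) 0 * abk v c)%:E)%E.

Let mI : measurable I01 := @measurable_I01 R.
Let H := hodo f t x.
Let mH : measurable_fun I01 H := measurable_hodo hf_smooth x t.
Let chi e := density f t u e.

(** On the support [(eta^2 - e)^(-1/2) >= 1], so the mass is at most the transform at [e]. *)
Lemma integrable_density (e : R) : 0 < e -> e < u -> mu.-integrable I01 (EFin \o chi e).
Proof.
move=> e0 eu.
have md : measurable_fun I01 (chi e) by apply: measurable_density.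
have d0 y : I01 y -> 0 <= chi e y by apply: density_ge0 => //; exact: ltW.
apply/integrableP; split; first exact/measurable_EFinP.
apply: (@le_lt_trans _ _ (abel (chi e) e)).
  apply: ge0_le_integral => //.
  - by apply: measurableT_comp => //; exact/measurable_EFinP.
  - apply/measurable_EFinP; apply: measurable_funM => //; apply: measurable_funTS.
    by apply: measurable_abk => //; exact: measurable_funX.
  move=> y Iy; rewrite /= lee_fin ger0_norm ?d0// /chi /density.
  case: ifPn => [/andP[ey yu]|_]; last by rewrite mul0r.
  rewrite -[leLHS]mulr1; apply: ler_wpM2l.
    by have := d0 _ Iy; rewrite /chi /density ey yu.
  rewrite /abk -[leLHS]invr1 lef_pV2 ?posrE ?sqrtr_gt0 ?subr_gt0//.
  rewrite -[leRHS]sqrtr1; apply: ler_wsqrtr.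
  rewrite lerBlDr (le_trans (ltW yu))// (le_trans (ltW (andP u01).2))// lerDl ltW//.
by rewrite (abel_density hf_smooth u01 Hu P0)// ltry.
Qed.


Lemma fabel_density (e c : R) : 0 < e -> e <= c -> I01 c ->
  fabel (chi e) c = if c < u then - (pi / 2) * H c else 0.
Proof.
move=> e0 ec Ic; rewrite /fabel; case: ltP => cu; first by rewrite (abel_density hf_smooth u01 Hu P0).
by rewrite abel_density_out.
Qed.

(** With [f e] that large, [hodo] at [e] is at least twice [hodo] at [c]. For the transform [V] the
    bounds mean [V^2 + pi H V <= 0] below the cut-off. *)
Lemma fabel_density_small (e c : R) : 0 < e -> e < u -> 30 * t + `|x| <= f e -> 0 < c -> c < e ->
  0 <= fabel (chi e) c <= - pi * H c.
Proof.
move=> e0 eu fe c0 ce.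
have d0 y : I01 y -> 0 <= chi e y by apply: density_ge0 => //; exact: ltW.
have A0 : (0 <= abel (chi e) c)%E by exact: abel_ge0.
have A1 : (abel (chi e) c <= (- (pi / 2) * H e)%:E)%E by apply: abel_density_in => //; exact: ltW.
have Af : abel (chi e) c \is a fin_num by rewrite ge0_fin_numE// (le_lt_trans A1)// ltry.
rewrite /fabel fine_ge0//=.
have : fine (abel (chi e) c) <= - (pi / 2) * H e by rewrite -lee_fin fineK.
move=> /le_trans; apply.
have -> : - (pi / 2) * H e = - pi * (H e / 2) by rewrite mulNr mulNr mulrAC mulrA.
rewrite !mulNr lerN2 ler_pM2l ?pi_gt0//.
have e1 : e < 1 by rewrite (lt_trans eu)//; case/andP: u01.
have h1 : f e <= f c by apply: profile_nincr => //; exact: ltW.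
have h2 : t * e ^+ 2 <= t by rewrite ler_piMr ?ltW// expr_lt1// ltW.
have h3 : 0 <= t * c ^+ 2 by rewrite mulr_ge0 ?sqr_ge0// ltW.
have h4 := ler_norm x.
have -> : H e / 2 = (x - 30 * (t * e ^+ 2) - f e) / 2 by rewrite /H /hodo mulrA.
have -> : H c = x - 30 * (t * c ^+ 2) - f c by rewrite /H /hodo mulrA.
move: h1 h2 h3 h4 fe; move: (f e) (f c) (t * e ^+ 2) (t * c ^+ 2) (`|x|) => ? ? ? ? ?.
by lra.
Qed.

Section minimizer.
Context (psi : R -> R).
Hypothesis mpsi : measurable_fun I01 psi.
Hypothesis psi0 : forall eta, I01 eta -> 0 <= psi eta.
Hypothesis ipsi : mu.-integrable I01 (EFin \o psi).
Hypothesis iapsi : mu.-integrable I01 (EFin \o (fun eta => a_fun u0 f eta x t * psi eta)).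
Hypothesis min : forall phi, admissible u0 f x t phi ->
  (energy u0 f x t psi <= energy u0 f x t phi)%E.

Let W := fabel psi.
Let mW : measurable_fun I01 W := measurable_fabel mpsi psi0.
Let W0 c : 0 <= W c := fabel_ge0 psi0 c.

Let HW : exists h, has_int mu I01 (fun c => H c * W c) h.
Proof.
exists (2 * \int[mu]_(eta in I01) (a_fun u0 f eta x t * psi eta)).
apply: (has_int_hodo_fabel hu0_range hu0_smooth hu0_decr hf_inv2 hf_smooth hf_neg hB t0 mpsi psi0 ipsi).
by apply: has_int_fine.
Qed.

Let mHW : measurable_fun I01 (fun c => H c * W c).
Proof. exact: measurable_funM. Qed.

(** Split [hodo] beyond [u] into its positive and negative parts and exchange integrals: for each
    [eta] the two Abel integrals are compared by the hypothesis [outer] at [v = eta^2]. *)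
Lemma outer_ge0 : exists2 o, 0 <= o &
  has_int mu I01 (fun c => if u < c then H c * W c else 0) o.
Proof.
pose Kp c := if u < c then Num.max (H c) 0 else 0.
pose Km c := if u < c then Num.max (- H c) 0 else 0.
have Kp0 c : 0 <= Kp c by rewrite /Kp; case: ifP => // _; rewrite le_max lexx orbT.
have Km0 c : 0 <= Km c by rewrite /Km; case: ifP => // _; rewrite le_max lexx orbT.
have mlt : measurable_fun I01 (fun c => u < c).
  by apply: measurable_funTS; exact: measurable_fun_ltr.
have mKp : measurable_fun I01 Kp.
  apply: measurable_fun_if => //; apply: (measurable_funS mI); first exact: subIsetl.
  by apply: measurable_maxr => //; exact: measurable_cst.
have mKm : measurable_fun I01 Km.
  apply: measurable_fun_if => //; apply: (measurable_funS mI); first exact: subIsetl.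
  by apply: measurable_maxr; [exact: measurableT_comp|exact: measurable_cst].
have [h hHW] := HW.
have [op hp] : exists o, has_int mu I01 (fun c => Kp c * W c) o.
  apply: (has_int_dominated hHW); first exact: measurable_funM.
  move=> c _; rewrite !normrM ler_wpM2r//; rewrite /Kp; case: ifP; rewrite ?normr0// => _.
  by rewrite /Num.max; case: ifP; rewrite ?normr0.
have [om hm] : exists o, has_int mu I01 (fun c => Km c * W c) o.
  apply: (has_int_dominated hHW); first exact: measurable_funM.
  move=> c _; rewrite !normrM ler_wpM2r//; rewrite /Km; case: ifP; rewrite ?normr0// => _.
  by rewrite /Num.max; case: ifP; rewrite ?normr0// normrN.
have le_o : om <= op.
  rewrite -lee_fin; have [_ _ <-] := hp; have [_ _ <-] := hm.
  rewrite (int_fabel_swap mpsi psi0 ipsi mKm Km0) (int_fabel_swap mpsi psi0 ipsi mKp Kp0).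
  have k0 (k : R -> R) eta : (forall c, 0 <= k c) ->
     (0 <= \int[mu]_(c in I01) ((k c)%:E * (abk (eta ^+ 2) c)%:E))%E.
    by move=> kk; apply: integral_ge0 => c _; rewrite mule_ge0 ?lee_fin ?abk_ge0.
  apply: ge0_le_integral.
  - exact: measurable_I01.
  - by move=> eta Ie; apply: mule_ge0; [rewrite lee_fin; exact: psi0|exact: k0].
  - exact: measurable_int_abk.
  - exact: measurable_int_abk.
  move=> eta Ie; apply: lee_wpmul2l; first by rewrite lee_fin; exact: psi0.
  have sh (g k : R -> R) : (forall c, k c = if u < c then g c else 0) -> u < eta ^+ 2 ->
    (\int[mu]_(c in I01) ((k c)%:E * (abk (eta ^+ 2) c)%:E) =
     \int[mu]_(c in `]u, (eta ^+ 2)%R[) (g c * abk (eta ^+ 2) c)%:E)%E.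
    move=> kE ue; rewrite (@integral_shrink _ _ `]u, (eta ^+ 2)%R[%classic).
    - by apply: eq_integral => c; rewrite inE/= in_itv/= => /andP[uc _]; rewrite kE uc.
    - move=> c; have := sqr_I01 Ie; rewrite /Defs.I01/= !in_itv/= => /andP[_ e1] /andP[uc ce].
      by rewrite (lt_trans (andP u01).1 uc) (lt_trans ce).
    - move=> c _; rewrite /= in_itv/= => /negP; rewrite negb_and => /orP[nuc|].
        by rewrite kE (negbTE nuc) mul0e.
      by rewrite -leNgt => ec; rewrite (abk_le0 ec) mule0.
  have [ue|eu] := ltP u (eta ^+ 2).
    rewrite (sh (fun c => Num.max (- H c) 0))// (sh (fun c => Num.max (H c) 0))//.
    by apply: outer; rewrite ue/=; have := sqr_I01 Ie; rewrite /Defs.I01/= in_itv/= => /andP[].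
  rewrite integral0_eq ?k0// => c Ic; rewrite /Km; case: ifP => [uc|_]; last by rewrite mul0e.
  by rewrite (abk_le0 (le_trans eu (ltW uc))) mule0.
exists (op - om); first by rewrite subr_ge0.
have := has_intD hp (has_intZ (-1) hm); rewrite mulN1r; apply: eq_has_int => c _.
rewrite /Kp /Km; case: ifP => _; last by rewrite !mul0r mulr0 addr0.
rewrite mulN1r -mulNr -mulrDl; congr (_ * _).
rewrite !maxEle; case: ifPn => h1; case: ifPn => h2; move: h1 h2; move: (H c) => q; lra.
Qed.

(** On [[e, 1)] the transform of [chi e'] is the same for all [e' <= e], so [gap e] can be estimated
    with ever smaller cut-offs. *)
Definition gap (e c : R) : R := if e <= c then (W c - fabel (chi e) c) ^+ 2 else 0.

Lemma gap_ge0 e c : 0 <= gap e c.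
Proof. by rewrite /gap; case: ifP => // _; exact: sqr_ge0. Qed.

Lemma measurable_gap (e : R) : 0 < e -> measurable_fun I01 (gap e).
Proof.
move=> e0; apply: measurable_fun_if => //.
- by apply: measurable_funTS; exact: measurable_fun_ler.
- apply: (measurable_funS mI); first exact: subIsetl.
  apply: measurable_funX; apply: measurable_funB => //; apply: measurable_fabel.
    exact: measurable_density.
  by move=> y Iy; apply: density_ge0 => //; exact: ltW.
Qed.

(** Boundedness of its transform makes the quadratic energy of the cut-off density finite. *)
Lemma fabel_density_le (e c : R) : 0 < e -> e < u -> I01 c ->
  `|fabel (chi e) c| <= pi / 2 * (f e + 30 * t + `|x|).
Proof.
move=> e0 eu Ic.
have e1 : e < 1 by rewrite (lt_trans eu)//; case/andP: u01.
have d0 y : I01 y -> 0 <= chi e y by apply: density_ge0 => //; exact: ltW.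
have He b : e <= b -> b < 1 -> - (pi / 2) * H b <= pi / 2 * (f e + 30 * t + `|x|).
  move=> eb b1; rewrite mulNr -mulrN; apply: ler_wpM2l; first by rewrite divr_ge0// pi_ge0.
  have b0 : 0 < b by exact: lt_le_trans eb.
  have h1 : f b <= f e by exact: profile_nincr.
  have h2 : t * b ^+ 2 <= t by rewrite ler_piMr ?ltW// expr_lt1// ltW.
  have h4 := ler_norm (- x); rewrite normrN in h4.
  have -> : - H b = f b + 30 * (t * b ^+ 2) - x by rewrite /H /hodo; ring.
  by move: h1 h2 h4; move: (f e) (f b) (t * b ^+ 2) (`|x|) => ? ? ? ?; lra.
have He0 : 0 <= pi / 2 * (f e + 30 * t + `|x|).
  apply: le_trans (He e (lexx e) e1).
  have := fabel_ge0 d0 e; rewrite fabel_density// ?eu//.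
  by rewrite /Defs.I01/= in_itv/= e0.
rewrite ger0_norm; last exact: fabel_ge0.
have c1 : c < 1 by move: Ic; rewrite /Defs.I01/= in_itv/= => /andP[].
have [ec|ce] := leP e c.
  by rewrite fabel_density//; case: ifP => // _; exact: He.
have A1 : (abel (chi e) c <= (- (pi / 2) * H e)%:E)%E by apply: abel_density_in => //; exact: ltW.
have A0 : (0 <= abel (chi e) c)%E by exact: abel_ge0.
rewrite -lee_fin /fabel fineK; last by rewrite ge0_fin_numE// (le_lt_trans A1)// ltry.
by apply: (le_trans A1); rewrite lee_fin He.
Qed.

(* On [[e, u)] the transform of the competitor is [V = - (pi / 2) H], so that the difference of the
   energy densities [W^2 + pi H W] is the square [(W - V)^2]; on [(0, e)] one has
   [V^2 + pi H V <= 0]. *)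
Lemma gap_le (e0 e : R) : 0 < e -> e <= e0 -> e0 < u -> 30 * t + `|x| <= f e ->
  exists s n, [/\ has_int mu I01 (gap e0) s,
    has_int mu I01 (fun c => if c < e then `|H c * W c| else 0) n & s <= pi * n].
Proof.
move=> e_gt0 ee0 e0u fe.
have eu : e < u by exact: le_lt_trans e0u.
have e0_gt0 : 0 < e0 by exact: lt_le_trans ee0.
have [u_gt0 u1] := andP u01.
have pi0 : 0 < pi :> R by exact: pi_gt0.
have d0 y : I01 y -> 0 <= chi e y by apply: density_ge0 => //; exact: ltW.
have md : measurable_fun I01 (chi e) by exact: measurable_density.
have id := integrable_density e_gt0 eu.
have ad : admissible u0 f x t (chi e).
  apply: (admissible_of_abel hu0_range hu0_smooth hu0_decr hf_inv2 hf_smooth hf_neg hB x t0 u_gt0 u1 md d0 id).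
  by move=> c uc; exact: abel_density_out.
pose V := fabel (chi e).
have mV : measurable_fun I01 V by exact: measurable_fabel.
have [l hl] : exists l, has_int mu I01 (fun eta => a_fun u0 f eta x t * psi eta) l.
  by exists (\int[mu]_(eta in I01) (a_fun u0 f eta x t * psi eta)); apply: has_int_fine.
have [lx hlx] : exists l, has_int mu I01 (fun eta => a_fun u0 f eta x t * chi e eta) l.
  exists (\int[mu]_(eta in I01) (a_fun u0 f eta x t * chi e eta)); apply: has_int_fine => //.
  by case: ad => _ [_ [_]].
have hHW := has_int_hodo_fabel hu0_range hu0_smooth hu0_decr hf_inv2 hf_smooth hf_neg hB t0 mpsi psi0 ipsi hl.
have hHV := has_int_hodo_fabel hu0_range hu0_smooth hu0_decr hf_inv2 hf_smooth hf_neg hB t0 md d0 id hlx.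
have [qx hqx] : exists q, has_int mu I01 (fun c => V c ^+ 2) q.
  exists (\int[mu]_(c in I01) (V c ^+ 2)); apply: has_int_fine => //.
  apply: (@integrable_bounded_I01 _ _ ((pi / 2 * (f e + 30 * t + `|x|)) ^+ 2)).
    exact: measurable_funX.
  move=> c Ic; rewrite normrX; have h := fabel_density_le e_gt0 eu Ic.
  by rewrite ler_sqr// nnegrE// (le_trans _ h).
have [q [hq le_en]] : exists q, has_int mu I01 (fun c => W c ^+ 2) q /\
    q + pi * (2 * l) <= qx + pi * (2 * lx).
  have := min ad; rewrite (energy_fabel mpsi psi0 ipsi hl) (energy_fabel md d0 id hlx).
  have [_ _ ->] := hqx.
  have i0 : (0 <= \int[mu]_(c in I01) (fabel psi c ^+ 2)%:E)%E.
    by apply: integral_ge0 => c _; rewrite lee_fin sqr_ge0.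
  have k0 : 0 < (2 * pi)^-1 :> R by rewrite invr_gt0 mulr_gt0.
  (* An infinite quadratic energy of [psi] is excluded by comparison with the finite energy of
     [chi e]. *)
  case E : (\int[mu]_(c in I01) (fabel psi c ^+ 2)%:E)%E i0 => [q| |] // q0; last first.
    by rewrite mulry gtr0_sg// mul1e addye// -EFinM -EFinD leye_eq.
  rewrite -!EFinM -!EFinD lee_fin => le_q; exists q; split.
    apply: has_int_ge0 => //; first exact: measurable_funX.
    by move=> c _; exact: sqr_ge0.
  have e1 (p a b : R) : p != 0 -> a + p * (2 * b) = 2 * p * ((2 * p)^-1 * a + b).
    by move=> p0; field.
  by rewrite !e1 ?gt_eqF// ler_pM2l// mulr_gt0.
have hD := has_intD (has_intD hq (has_intZ pi hHW)) (has_intZ (-1) (has_intD hqx (has_intZ pi hHV))).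
have mlt : measurable_fun I01 (fun c => c < e).
  by apply: measurable_funTS; exact: measurable_fun_ltr.
have mHW' := measurable_has_int hHW.
have [n' hn'] : exists n, has_int mu I01 (fun c => if c < e then H c * W c else 0) n.
  apply: (has_int_dominated hHW).
    apply: measurable_fun_if => //; apply: (measurable_funS mI); first exact: subIsetl.
    exact: mHW'.
  by move=> c _; case: ifP => // _; rewrite normr0.
have [n hn] : exists n, has_int mu I01 (fun c => if c < e then `|H c * W c| else 0) n.
  apply: (has_int_dominated hHW).
    apply: measurable_fun_if => //; apply: (measurable_funS mI); first exact: subIsetl.
    exact: measurableT_comp.
  by move=> c _; case: ifP => _; rewrite ?normr0// normr_id.
have nn' : - n <= n'.
  rewrite -mulN1r; apply: (has_int_le (has_intZ (-1) hn) hn') => c _.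
  by case: ifP => _; rewrite mulN1r ?oppr0//; exact: lerNnormlW.
have [m m0 hm] := outer_ge0.
have hG := has_intD hD (has_intZ (- pi) (has_intD hn' hm)).
(* The subtracted terms remove [pi H W] on [(0, e)], where no square is completed, and on [(u, 1)],
   where the transform of the cut-off density is 0 and [W^2] remains. The first is paid for by [n],
   the second has the right sign by [outer_ge0]. *)
have gap_dom c : I01 c -> gap e0 c <=
    W c ^+ 2 + pi * (H c * W c) + -1 * (V c ^+ 2 + pi * (H c * V c)) +
    - pi * ((if c < e then H c * W c else 0) + (if u < c then H c * W c else 0)).
  move=> Ic; have c0 : 0 < c by move: Ic; rewrite /Defs.I01/= in_itv/= => /andP[].
  have [ec|ce] := leP e c; last first.
    have c_u : c < u by exact: lt_trans eu.
    have -> : gap e0 c = 0 by rewrite /gap leNgt (lt_le_trans ce ee0).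
    rewrite ltNge (ltW c_u)/= addr0.
    have /andP[v0 v1] := fabel_density_small e_gt0 eu fe c0 ce.
    have : 0 <= V c * (- pi * H c - V c) by rewrite mulr_ge0// subr_ge0.
    have := sqr_ge0 (W c); move: (V c) (W c) (H c) => v w h; nra.
  rewrite add0r; have VE : V c = if c < u then - (pi / 2) * H c else 0 by exact: fabel_density.
  have gle : gap e0 c <= (W c - V c) ^+ 2.
    rewrite /gap; case: ifPn => [e0c|_]; last exact: sqr_ge0.
    by rewrite VE fabel_density.
  apply: (le_trans gle); rewrite VE.
  have [cu|uc|->] := ltgtP c u.
  - by rewrite mulr0 addr0 le_eqVlt; apply/orP; left; apply/eqP; field.
  - by rewrite le_eqVlt; apply/orP; left; apply/eqP; ring.
  - have -> : H u = 0 by exact: Hu.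
    by rewrite le_eqVlt; apply/orP; left; apply/eqP; ring.
have [s hs] : exists s, has_int mu I01 (gap e0) s.
  apply: (has_int_dominated hG); first exact: measurable_gap.
  move=> c Ic; rewrite ger0_norm ?gap_ge0//.
  exact: le_trans (gap_dom _ Ic) (ler_norm _).
exists s, n; split => //.
have := has_int_le hs hG gap_dom.
have : 0 <= pi * m by rewrite mulr_ge0// ltW.
have : pi * - n <= pi * n' by rewrite ler_pM2l.
move: le_en.
rewrite (_ : - pi * (n' + m) = - (pi * n') - pi * m); last by ring.
rewrite (_ : pi * - n = - (pi * n)); last by ring.
by move: (pi * (2 * l)) (pi * (2 * lx)) (pi * n) (pi * n') (pi * m) => ? ? ? ? ?; lra.
Qed.

(** With [e0] fixed, let the cut-off [e] of [gap_le] tend to 0: the bound is [pi] times the integral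
    of [|H W|] over [(0, e)], which tends to 0 by absolute continuity. *)
Lemma gap_eq0 (e0 : R) : 0 < e0 -> e0 < u -> {ae mu, forall c, I01 c -> gap e0 c = 0}.
Proof.
move=> e0_gt0 e0u.
have [h hHW] := HW.
have [_ iHW _] := hHW.
pose g : R -> R := (fun c => H c * W c) \_ I01.
have ig : mu.-integrable setT (EFin \o g).
  rewrite /g -restrict_EFin; apply/(integrable_restrict _ _ _) => //.
  by rewrite setTI.
have [a /andP[a0 a1] ha] := profile_large hf_0 (30 * t + `|x|).
have small eps : 0 < eps -> exists s, has_int mu I01 (gap e0) s /\ s <= pi * eps.
  move=> eps0; have [d [d0 hd]] := integral_normr_continuous ig eps0.
  have [e1 [e1_gt0 e1a e1e]] := exists_pos_lt2 a0 e0_gt0.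
  have [e [e_gt0 ee1 ed]] := exists_pos_lt2 e1_gt0 d0.
  have ee0 : e <= e0 by exact: ltW (lt_trans ee1 e1e).
  have fe : 30 * t + `|x| <= f e by apply/ltW/ha; rewrite e_gt0 ltW// (lt_trans ee1).
  have [s [n [hs hn sn]]] := gap_le e_gt0 ee0 e0u fe.
  exists s; split => //; apply: (le_trans sn); rewrite ler_pM2l ?pi_gt0//.
  have := hd `]0, e[%classic (measurable_itv _).
  rewrite [X in (X < _)%E](_ : _ = e%:E); last first.
    by rewrite [LHS]lebesgue_measure_itv/= lte_fin e_gt0 -EFinB subr0.
  rewrite lte_fin => /(_ ed)/ltW; apply: le_trans.
  have [_ _ en] := hn.
  rewrite le_eqVlt; apply/orP; left; apply/eqP.
  rewrite /Rintegral (_ : n = fine n%:E)// -en; congr fine.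
  rewrite (@integral_shrink _ _ `]0, e[%classic).
  - apply: eq_integral => c; rewrite inE/= in_itv/= => /andP[c0 ce].
    rewrite ce /g patchE ifT// inE /Defs.I01/= in_itv/= c0 (lt_trans ce)//.
    exact: lt_trans (le_lt_trans ee0 e0u) (andP u01).2.
  - move=> c; rewrite /Defs.I01/= !in_itv/= => /andP[-> ce].
    exact: lt_trans ce (lt_trans (le_lt_trans ee0 e0u) (andP u01).2).
  - move=> c; rewrite /Defs.I01/= !in_itv/= => /andP[-> _] /= /negP/negbTE ->; by [].
have [s [hs _]] := small 1 ltr01.
have s0 : s <= 0.
  apply/ler_addgt0Pl => eps eps0; rewrite addr0.
  have pe : 0 < eps / pi by rewrite divr_gt0// pi_gt0.
  have [s' [hs' s'e]] := small _ pe.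
  rewrite (has_int_uniq hs hs'); apply: (le_trans s'e).
  by rewrite mulrCA divff ?mulr1// gt_eqF// pi_gt0.
have s00 : s = 0.
  apply/eqP; rewrite eq_le s0/= -lee_fin; have [_ _ <-] := hs.
  by apply: integral_ge0 => c _; rewrite lee_fin gap_ge0.
have mg : measurable_fun I01 (EFin \o gap e0) by apply/measurable_EFinP; exact: measurable_gap.
have /(ae_eq_integral_abs mu mI mg) : (\int[mu]_(c in I01) `|(EFin \o gap e0) c| = 0)%E.
  have [_ _] := hs; rewrite s00 => e; rewrite -[RHS]e.
  by apply: eq_integral => c _; rewrite /= ger0_norm ?gap_ge0.
by apply: ae_sub => c h' Ic; have := h' Ic => -[].
Qed.

(** The transforms agree almost everywhere beyond [beta^2], and Abel inversion turns this into
    equality of tails. *)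
Lemma tail_eq (e beta : R) : 0 < e -> e < u -> 0 <= beta -> beta < 1 -> e <= beta ^+ 2 ->
  (\int[mu]_(eta in `]beta, 1%R[) (psi eta)%:E = \int[mu]_(eta in `]beta, 1%R[) (chi e eta)%:E)%E.
Proof.
move=> e0 eu b0 b1 eb.
have d0 y : I01 y -> 0 <= chi e y by apply: density_ge0 => //; exact: ltW.
have md : measurable_fun I01 (chi e) by exact: measurable_density.
have id := integrable_density e0 eu.
have e1 := abel_inversion b0 b1 mpsi psi0.
have e2 := abel_inversion b0 b1 md d0.
have sub : `](beta ^+ 2), 1[%classic `<=` I01.
  move=> c; rewrite /Defs.I01/= !in_itv/= => /andP[h ->]; rewrite andbT.
  exact: lt_trans (lt_le_trans e0 eb) h.
have mk : measurable_fun (`](beta ^+ 2), 1[ : set R) (fun c => (abk c (beta ^+ 2))%:E).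
  by apply/measurable_EFinP; exact: measurable_abk.
have E : (\int[mu]_(c in `](beta ^+ 2)%R, 1%R[) ((abk c (beta ^+ 2))%:E * abel psi c) =
          \int[mu]_(c in `](beta ^+ 2)%R, 1%R[) ((abk c (beta ^+ 2))%:E * abel (chi e) c))%E.
  apply: ge0_ae_eq_integral.
  - exact: measurable_itv.
  - by apply: emeasurable_funM => //; exact: measurable_abel.
  - by apply: emeasurable_funM => //; exact: measurable_abel.
  - by move=> c _; rewrite mule_ge0 ?lee_fin ?abk_ge0// abel_ge0.
  - by move=> c _; rewrite mule_ge0 ?lee_fin ?abk_ge0// abel_ge0.
  have [N1 [mN1 N10 s1]] := fabel_ae mpsi psi0 ipsi.
  have [N2 [mN2 N20 s2]] := fabel_ae md d0 id.
  have [N3 [mN3 N30 s3]] := gap_eq0 e0 eu.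
  exists (N1 `|` N2 `|` N3); split.
  - by apply: measurableU => //; exact: measurableU.
  - by rewrite !measureU0//; exact: measurableU.
  move=> c /= nc; apply: contrapT => /not_orP[/not_orP[n1 n2] n3]; apply: nc => cI.
  have Ic := sub _ cI.
  have E1 := contrapT (contra_not (s1 c) n1) Ic.
  have E2 := contrapT (contra_not (s2 c) n2) Ic.
  have E3 := contrapT (contra_not (s3 c) n3) Ic.
  have ec : e <= c by move: cI; rewrite /= in_itv/= => /andP[h _]; exact: le_trans (ltW h).
  move: E3; rewrite /gap ec => /eqP; rewrite sqrf_eq0 subr_eq0 => /eqP E3.
  by rewrite E1 E2 /W in E3 *; rewrite E3.
rewrite E e2 in e1.
have pn : (pi : R) != 0 by rewrite gt_eqF// pi_gt0.
have := congr1 (fun z => (pi^-1)%:E * z)%E e1.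
by rewrite !muleA -!EFinM mulVf// !mul1e.
Qed.

End minimizer.
End comparison.

(** * From the tails to the support *)

Section support.
Context {R : realType}.
Local Notation mu := (@lebesgue_measure R).
Local Notation I01 := (@I01 R).

Lemma ae_eq0_of_integral (D : set R) (g : R -> R) : measurable D -> measurable_fun D g ->
  (forall y, D y -> 0 <= g y) -> (\int[mu]_(y in D) (g y)%:E = 0)%E ->
  {ae mu, forall y, D y -> g y = 0}.
Proof.
move=> mD mg g0 e.
have mg' : measurable_fun D (EFin \o g) by apply/measurable_EFinP.
have /(ae_eq_integral_abs mu mD mg') : (\int[mu]_(y in D) `|(EFin \o g) y| = 0)%E.
  by rewrite -[RHS]e; apply: eq_integral => y /[1!inE] Dy; rewrite /= ger0_norm ?g0.
by apply: ae_sub => y h Dy; have := h Dy => -[].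
Qed.

Lemma integral_ae0 (D : set R) (g : R -> R) : measurable D -> measurable_fun D g ->
  {ae mu, forall y, D y -> g y = 0} -> (\int[mu]_(y in D) (g y)%:E = 0)%E.
Proof.
move=> mD mg g0; rewrite -[RHS](integral0 mu D); apply: ae_eq_integral => //.
- exact/measurable_EFinP.
- by apply: ae_sub g0 => y h Dy; rewrite h.
Qed.

Lemma itv_not_null (a b : R) (g : R -> R) : a < b -> (forall y, a < y < b -> 0 < g y) ->
  ~ {ae mu, forall y, a < y < b -> g y = 0}.
Proof.
move=> ab g0 [N [mN N0 sN]].
have : (mu `]a, b[%classic <= mu N)%E.
  apply: le_measure; rewrite ?inE//.
  move=> y; rewrite /= in_itv/= => yI; apply: sN => /(_ yI) e.
  by have := g0 y yI; rewrite e ltxx.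
rewrite [X in (X <= _)%E](_ : _ = (b - a)%:E); last first.
  by rewrite [LHS]lebesgue_measure_itv/= lte_fin ab -EFinB.
by rewrite [X in (_ <= X)%E]N0 lee_fin leNgt subr_gt0 ab.
Qed.

Lemma ae_and (P Q : R -> Prop) : {ae mu, forall y, P y} -> {ae mu, forall y, Q y} ->
  {ae mu, forall y, P y /\ Q y}.
Proof.
move=> [N [mN N0 sN]] [M [mM M0 sM]]; exists (N `|` M); split.
- exact: measurableU.
- by rewrite measureU0.
move=> y nPQ; apply: contrapT => /not_orP[n1 n2]; apply: nPQ; split.
- exact: contrapT (contra_not (sN y) n1).
- exact: contrapT (contra_not (sM y) n2).
Qed.

Context (u0 f : R -> R).
Hypothesis hu0_range : forall y : R, 0 < u0 y < 1.
Hypothesis hu0_smooth : smooth u0.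
Hypothesis hu0_decr : forall y z : R, y < z -> u0 z < u0 y.
Hypothesis hf_inv2 : forall u : R, 0 < u < 1 -> u0 (f u) = u.
Hypothesis hf_smooth : smooth_on I01 f.
Hypothesis hf_neg : forall u : R, 0 < u < 1 -> derive1 f u < 0.
Hypothesis hf_0 : f u @[u --> 0^'+] --> +oo.
Context (x t u : R).
Hypothesis t0 : 0 < t.
Hypothesis good : good_endpoint f t x u.

(** The tail from [sqrt u] is 0, so nothing lies beyond. If [psi] vanished on a subinterval, two
    tails of the candidate density would agree, although this density is positive in between apart
    from at most one point. *)
Lemma density_support (psi : R -> R) : measurable_fun I01 psi ->
  (forall eta, I01 eta -> 0 <= psi eta) ->
  (forall e beta, 0 < e -> e < u -> 0 <= beta -> beta < 1 -> e <= beta ^+ 2 ->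
    (\int[mu]_(eta in `]beta, 1%R[) (psi eta)%:E =
     \int[mu]_(eta in `]beta, 1%R[) (density f t u e eta)%:E)%E) ->
  supported_on_single_interval psi.
Proof.
move=> mpsi psi0 tail; have [u01 Hu P0 [z Pz] _] := good.
have [u_gt0 u1] := andP u01.
pose s := Num.sqrt u.
have s0 : 0 < s by rewrite sqrtr_gt0.
have s1 : s < 1 by rewrite -sqrtr1 ltr_sqrt.
have s2 : s ^+ 2 = u by rewrite sqr_sqrtr// ltW.
have subI b : 0 <= b -> `]b, 1[%classic `<=` I01.
  by move=> b0 y; rewrite /Defs.I01/= !in_itv/= => /andP[h ->]; rewrite (le_lt_trans b0).
have mI := @measurable_I01 R.
exists 0, s; split; [by []|split; [by []|split; [exact: ltW|split]]].
- have u2 : 0 < u / 2 by rewrite divr_gt0.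
  have u2u : u / 2 < u by rewrite ltr_pdivrMr// ltr_pMr// ltrDl.
  have u2s : u / 2 <= s ^+ 2 by rewrite s2 ltW.
  have e0 : (\int[mu]_(eta in `]s, 1%R[) (psi eta)%:E = 0)%E.
    rewrite (tail _ _ u2 u2u (ltW s0) s1 u2s); apply: integral0_eq => y; rewrite /= in_itv/= => /andP[sy _].
    rewrite /density [X in _ && X](_ : _ = false) ?andbF//; apply/negbTE; rewrite -leNgt -s2.
    by rewrite ler_sqr ?nnegrE ?ltW// (lt_trans s0).
  have : {ae mu, forall y, `]s, 1[%classic y -> psi y = 0}.
    apply: ae_eq0_of_integral => //.
    - by apply: (measurable_funS mI) mpsi; apply: subI; exact: ltW.
    - by move=> y /(subI _ (ltW s0)); exact: psi0.
  apply: ae_sub => y h Iy nI; apply: h; rewrite /= in_itv/=.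
  move: Iy nI; rewrite /Defs.I01 /Icc/= !in_itv/= => /andP[y0 ->] /negP.
  by rewrite (ltW y0)/= -ltNge => ->.
move=> c d c0 cd ds ae0.
(* At most one [y > 0] has [y^2 = z], so one half of [(c, d)] avoids it; that half is shrunk to
   obtain [c < c1] and [d1 < d]. *)
have [c1 [d1 [cc1 c1d1 d1d znot]]] : exists c1 d1, [/\ c < c1, c1 < d1, d1 < d &
    forall y, c1 < y < d1 -> y ^+ 2 != z].
  pose m := (c + d) / 2.
  have [zm|mz] := leP (Num.sqrt z) m.
    exists m, ((m + d) / 2); rewrite /m; split; try lra.
    move=> y /andP[my _]; apply/eqP => e; move: zm; rewrite -e sqrtr_sqr.
    by rewrite ger0_norm /m; lra.
  exists ((c + m) / 2), m; rewrite /m; split; try lra.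
  move=> y /andP[my ym]; apply/eqP => e; move: mz; rewrite -e sqrtr_sqr.
  by rewrite ger0_norm /m; lra.
have c10 : 0 < c1 by exact: le_lt_trans cc1.
have d10 : 0 < d1 by exact: lt_trans c1d1.
have d1s : d1 < s by exact: lt_le_trans ds.
have c1s : c1 < s by exact: lt_trans d1s.
have d11 : d1 < 1 by exact: lt_trans s1.
have c11 : c1 < 1 by exact: lt_trans s1.
(* With this cut-off the density is intact on [(c1, d1)], and both tails qualify for [tail]. *)
pose e := c1 ^+ 2.
have e0 : 0 < e by rewrite exprn_gt0.
have eu : e < u by rewrite -s2 /e ltr_sqr// nnegrE ltW.
have ed : e <= d1 ^+ 2 by rewrite /e ler_sqr ?nnegrE ?ltW.
pose chi := density f t u e.
have chi0 y : I01 y -> 0 <= chi y by apply: density_ge0 => //; exact: ltW.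
have mchi : measurable_fun I01 chi by exact: measurable_density.
have T1 := tail e c1 e0 eu (ltW c10) c11 (lexx _).
have T2 := tail e d1 e0 eu (ltW d10) d11 ed.
have split_int (g : R -> R) : measurable_fun I01 g -> (forall y, I01 y -> 0 <= g y) ->
  (\int[mu]_(y in `]c1, 1%R[) (g y)%:E =
   \int[mu]_(y in `]c1, d1]) (g y)%:E + \int[mu]_(y in `]d1, 1%R[) (g y)%:E)%E.
  move=> mg g0.
  have -> : `]c1, 1[%classic = `]c1, d1]%classic `|` `]d1, 1[%classic :> set R.
    by rewrite -itv_bndbnd_setU// bnd_simp ltW.
  have sub : `]c1, d1]%classic `|` `]d1, 1[%classic `<=` I01.
    rewrite -itv_bndbnd_setU ?bnd_simp; [exact/subI/ltW|exact: ltW|exact: d11].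
  apply: ge0_integral_setU.
  - exact: measurable_itv.
  - exact: measurable_itv.
  - by apply/measurable_EFinP; apply: (measurable_funS mI) mg.
  - by move=> y /sub Iy; rewrite lee_fin g0.
  - apply/disj_setPRL => y; rewrite /= !in_itv/= => /andP[h1 _] /andP[_ h2].
    by rewrite ltNge h2 in h1.
have subc : `]c1, d1]%classic `<=` I01.
  by move=> y; rewrite /Defs.I01/= !in_itv/= => /andP[h1 h2]; rewrite (lt_trans c10)//= (le_lt_trans h2).
have z0 : (\int[mu]_(y in `]c1, d1]) (psi y)%:E = 0)%E.
  apply: integral_ae0; first exact: measurable_itv.
    exact: (measurable_funS mI) mpsi.
  apply: ae_sub ae0 => y h; rewrite /= in_itv/= => /andP[h1 h2]; apply: h.
  by rewrite /Ioo/= in_itv/= (lt_trans cc1)//= (le_lt_trans h2).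
rewrite !split_int// z0 add0e T2 in T1.
have fin : (\int[mu]_(y in `]d1, 1%R[) (chi y)%:E)%E \is a fin_num.
  have ic : mu.-integrable I01 (EFin \o chi) by apply: (integrable_density hf_smooth u01 Hu P0).
  have mD : measurable (`]d1, 1[ : set (measurableTypeR R)) by exact: measurable_itv.
  apply: integrable_fin_num => //.
  by apply: integrableS ic => //; apply: subI; exact: ltW.
have z1 : (\int[mu]_(y in `]c1, d1]) (chi y)%:E = 0)%E.
  move: T1 fin; rewrite -/chi.
  have : (0 <= \int[mu]_(y in `]c1, d1]) (chi y)%:E)%E.
    by apply: integral_ge0 => y /subc Iy; rewrite lee_fin chi0.
  case: (integral _ _ _) => [p| |] // _; case: (integral _ _ _) => [q| |] //= [] e1 _.
  by congr EFin; lra.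
have : {ae mu, forall y, c1 < y < d1 -> chi y = 0}.
  have : {ae mu, forall y, `]c1, d1]%classic y -> chi y = 0}.
    apply: ae_eq0_of_integral => //.
      exact: (measurable_funS mI) mchi.
    by move=> y /subc; exact: chi0.
  by apply: ae_sub => y h /andP[h1 h2]; apply: h; rewrite /= in_itv/= h1 ltW.
apply: itv_not_null => // y yI; have [h1 h2] := andP yI.
have y0 : 0 < y by exact: lt_trans h1.
have yu : y ^+ 2 < u by rewrite -s2 ltr_sqr ?nnegrE ?ltW// (lt_trans h2).
have ey : e < y ^+ 2 by rewrite /e ltr_sqr// nnegrE ltW.
rewrite /chi /density ey yu/=; apply: mulr_gt0; last by apply: Pz; [rewrite exprn_gt0|exact: znot].
by rewrite mulr_gt0 ?sqrtr_gt0 ?subr_gt0// mulr_gt0.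
Qed.

Lemma minimizer_support (psi : R -> R) : is_minimizer u0 f x t psi ->
  supported_on_single_interval psi.
Proof.
move=> [ad min].
have ma := measurable_a_fun hu0_range hu0_smooth hu0_decr hf_inv2 hf_smooth hf_neg x t.
have [mpsi [ipsi [psi0 iapsi]]] := ad.
have adp := admissible_pos_part ma ad.
have mp := measurable_pos_part mpsi.
have p0 eta : I01 eta -> 0 <= pos_part psi eta by move=> _; exact: pos_part_ge0.
have minp phi : admissible u0 f x t phi -> (energy u0 f x t (pos_part psi) <= energy u0 f x t phi)%E.
  by move=> /min; rewrite (energy_pos_part mpsi psi0 ma).
have [_ [ip [_ iap]]] := adp.
(* Without such a [B] some competitor has energy below the linear energy of the minimizer, hence
   below its energy, the quadratic part being nonnegative. *)
have [[B hB]|nB] := pselect (exists B, forall c, I01 c -> f c <= B * abk c 0); last first.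
  exfalso.
  have [_ _ el] : has_int mu I01 (fun eta => a_fun u0 f eta x t * pos_part psi eta)
      (\int[mu]_(eta in I01) (a_fun u0 f eta x t * pos_part psi eta)).
    by apply: has_int_fine => //; exact: measurable_I01.
  have [phi aphi] := energy_unbounded_below hu0_range hu0_smooth hu0_decr hf_inv2 hf_smooth hf_neg x t0
    (\int[mu]_(eta in I01) (a_fun u0 f eta x t * pos_part psi eta)) nB.
  rewrite ltNge => /negP; apply; apply: le_trans (minp _ aphi).
  rewrite /energy /lin_energy el quad_energyE//; apply: leeDr.
  apply: mule_ge0; first by rewrite lee_fin invr_ge0 mulr_ge0// pi_ge0.
  by apply: integral_ge0 => c _; apply: mule_ge0; exact: abel_ge0.
have [u01 Hu P0 _ outer] := good.
have [al [be [a0 [ab [b1 [out ins]]]]]] : supported_on_single_interval (pos_part psi).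
  apply: density_support => // e beta e0 eu b0 b1 eb.
  exact: (tail_eq hu0_range hu0_smooth hu0_decr hf_inv2 hf_smooth hf_neg hf_0 hB t0 u01 Hu P0 outer mp p0 ip iap minp).
have pe := pos_part_ae psi0.
exists al, be; split => //; split => //; split => //; split.
  by apply: ae_sub (ae_and pe out) => y [h1 h2] Iy nI; rewrite h1// h2.
move=> c d ac cd db aez; apply: (ins c d ac cd db).
apply: ae_sub (ae_and pe aez) => y [h1 h2] yI; rewrite -h1 ?h2//.
move: yI; rewrite /Ioo /Defs.I01/= !in_itv/= => /andP[cy yd].
by rewrite (le_lt_trans (le_trans a0 ac) cy) (lt_le_trans yd (le_trans db b1)).
Qed.

End support.

(** * Single-interval support up to the trailing edge and from the leading edge on *)

Theorem theorem5p1 (R : realType) (u0 f : R -> R)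
  (* standing assumptions on u0 *)
  (hu0_range : forall y : R, 0 < u0 y < 1)
  (hu0_smooth : smooth u0)
  (hu0_decr : forall y z : R, y < z -> u0 z < u0 y)
  (hu0_minf : u0 y @[y --> -oo] --> (1 : R))
  (hu0_pinf : u0 y @[y --> +oo] --> (0 : R))
  (* f is the inverse of u0, smooth on (0,1), f' < 0, f(0+) = +oo, f(1-) = -oo *)
  (hf_inv1 : forall y : R, f (u0 y) = y)
  (hf_inv2 : forall u : R, 0 < u < 1 -> u0 (f u) = u)
  (hf_smooth : smooth_on (@I01 R) f)
  (hf_neg : forall u : R, 0 < u < 1 -> derive1 f u < 0)
  (hf_0 : f u @[u --> 0^'+] --> +oo)
  (hf_1 : f u @[u --> 1^'-] --> -oo)
  (* f''' < 0 in a neighborhood of 0 and of 1 *)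
  (hf3 : exists eps : R, 0 < eps /\
     forall u : R, 0 < u < 1 -> (u < eps \/ 1 - eps < u) -> derive1n 3 f u < 0)
  (* delta and delta_2 *)
  (delta : R) (hdelta : 0 < delta)
  (hF0 : forall xi u1 : R, 0 < xi < 1 -> 1 - delta < u1 < 1 ->
     derive1n 2 (fun z => F0 f z u1) xi < 0)
  (delta2 : R) (hdelta2 : 0 < delta2)
  (hf2 : forall u : R, 0 < u < delta2 -> 0 < derive1n 2 f u)
  (* trailing edge: T^-, u1^-(t), u3^-(t), x^-(t) *)
  (Tm : R) (u1m u3m xm : R -> R) (hTm : 0 < Tm)
  (hm_sol : forall t : R, Tm < t ->
     0 < u3m t /\ u3m t < u1m t /\ u1m t < 1 /\
     trailing_sys f t (u1m t) (u3m t) (xm t))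
  (hm_uniq : forall t u1 u3 x : R, Tm < t -> 0 < u3 -> u3 < u1 -> u1 < 1 ->
     trailing_sys f t u1 u3 x -> u1 = u1m t /\ u3 = u3m t /\ x = xm t)
  (hm_incr : forall s t : R, Tm < s -> s < t -> u1m s < u1m t)
  (hm_lim1 : u1m t @[t --> +oo] --> (1 : R))
  (hm_lim3 : u3m t @[t --> +oo] --> (1 / 4 : R))
  (* leading edge: T^+, u1^+(t), u3^+(t), x^+(t) *)
  (Tp : R) (u1p u3p xp : R -> R) (hTp : 0 < Tp)
  (hp_sol : forall t : R, Tp < t ->
     0 < u3p t /\ u3p t < u1p t /\ u1p t < 1 /\
     leading_sys f t (u1p t) (u3p t) (xp t))
  (hp_uniq : forall t u1 u3 x : R, Tp < t -> 0 < u3 -> u3 < u1 -> u1 < 1 ->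
     leading_sys f t u1 u3 x -> u1 = u1p t /\ u3 = u3p t /\ x = xp t)
  (hp_incr : forall s t : R, Tp < s -> s < t -> u1p s < u1p t)
  (hp_decr : forall s t : R, Tp < s -> s < t -> u3p t < u3p s)
  (hp_lim1 : u1p t @[t --> +oo] --> (1 : R))
  (hp_lim3 : u3p t @[t --> +oo] --> (0 : R))
  (hp_bnd : forall t : R, Tp < t ->
     1 - delta < u1p t < 1 /\ 0 < u3p t < delta2) :
  forall (t x : R) (psi : R -> R),
    Num.max Tm Tp < t ->
    (x <= xm t \/ xp t <= x) ->
    is_minimizer u0 f x t psi ->
    supported_on_single_interval psi.
Proof.
move=> t x psi; rewrite gt_max => /andP[Tmt Tpt] hx hpsi.
have t0 : 0 < t by exact: lt_trans Tmt.
have [u hu] : exists u, good_endpoint f t x u.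
  case: hx => [xx|xx].
    exact: (good_endpoint_trailing hf_smooth hf_neg hf_0 hf_1 hf3 hTm hm_sol hm_uniq hm_incr Tmt xx).
  have [_ /andP[_ u3d]] := hp_bnd t Tpt.
  exact: (good_endpoint_leading hf_smooth hf_neg hf_0 hf_1 hdelta2 hf2 t0 hp_sol hp_uniq u3d Tpt xx).
exact: (minimizer_support hu0_range hu0_smooth hu0_decr hf_inv2 hf_smooth hf_neg hf_0 t0 hu hpsi).
Qed.
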